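(* Let $G$ be a finite group, $p$ a prime and $(\mathbb{K},R,\mathbb{F})$ a splitting $p$-modular system for $G$. Then in the Green ring of $RG$, $$P_{1,p,G}-R=\sum_{1\neq Q/G}\mathrm{Ind}_{N_G(Q)}^{G}\left(P\left[\mathrm{St}_p(N_G(Q)/Q)\right]-\mathrm{St}_p(N_G(Q)/Q)\right),$$ where $R$ on the left denotes the trivial $RG$-module, the sum is over a set of representatives for the $G$-conjugacy classes of non-trivial $p$-subgroups $Q$ of $G$ with $Q=O_p(N_G(Q))$, and $\mathrm{St}_p(N_G(Q)/Q)$ is regarded as a virtual $RN_G(Q)$-module by inflation.
   Context: A splitting $p$-modular system $(\mathbb{K},R,\mathbb{F})$ for $G$ consists of a complete discrete valuation ring $R$ with field of fractions $\mathbb{K}$ of characteristic $0$ and residue field $\mathbb{F}$ of characteristic $p$, such that $\mathbb{K}$ and $\mathbb{F}$ are splitting fields for $G$. An element of $G$ is $p$-regular if its order is prime to $p$ and $p$-singular otherwise; a $p$-element is an element whose order is a power of $p$ (including the identity). $\Psi_{1,p,G}$ is the class function of $G$ which is $0$ on all $p$-singular elements and whose value at a $p$-regular $y\in G$ is the number of $p$-elements of $C_G(y)$. It is a generalized character of $G$ vanishing on $p$-singular elements. $P_{1,p,G}$ denotes the unique virtual projective module (i.e. $\mathbb{Z}$-linear combination of projective $RG$-modules) in the Green ring of $RG$ affording the virtual character $\Psi_{1,p,G}$. The Green ring of $RG$ is that of isomorphism classes of finitely generated $R$-free $RG$-modules with respect to direct sums. For a finite group $X$, let $\mathcal{S}_p(X)$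 be the set of all chains $\sigma = (Q_1<Q_2<\dots<Q_n)$ of non-trivial $p$-subgroups of $X$ (strictly increasing), including the empty chain; $|\sigma|=n$ is the number of subgroups in $\sigma$ and $X_\sigma$ is the stabilizer of $\sigma$ in $X$ under conjugation (so the empty chain has $|\sigma|=0$ and stabilizer $X$). The Steinberg virtual module of $X$ is $$\mathrm{St}_p(X)=\sum_{\sigma\in\mathcal{S}_p(X)/X}(-1)^{|\sigma|}\mathrm{Ind}_{X_\sigma}^{X}(R)$$ in the Green ring of $RX$, where $R$ denotes the trivial module and the sum is over representatives of the $X$-orbits of chains. It is known (Webb) that $\mathrm{St}_p(X)$ is a virtual projective $RX$-module. If $M=A-B$ is a virtual projective $R[N_G(Q)/Q]$-module (with $A,B$ projective), $P[M]$ denotes the virtual projective $RN_G(Q)$-module $P(A)-P(B)$, where $P(A)$ is the projective cover, as $RN_G(Q)$-module, of the inflation of $A$ to $N_G(Q)$, and likewise for $B$; this is well defined. $O_p(X)$ is the largest normal $p$-subgroup of $X$. *)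

(* Defs.v *)
From HB Require Import structures.
From mathcomp Require Import all_boot all_order all_algebra.
From mathcomp Require Import all_fingroup all_solvable all_character.
From mathcomp Require Import boolp.

Set Implicit Arguments.
Unset Strict Implicit.
Unset Printing Implicit Defensive.

Import GRing.Theory.
Local Open Scope group_scope.
Local Open Scope ring_scope.
Local Open Scope quotient_scope.

(* R is a discrete valuation ring and its maximal ideal is generated by t. *)
Definition uniformizer (R : idomainType) (t : R) : Prop :=
  [/\ t != 0, t \isn't a GRing.unit &
      forall a : R, a != 0 ->
        exists u : R, exists k : nat, u \is a GRing.unit /\ a = u * t ^+ k].

Definition congr_exp (R : idomainType) (t : R) (n : nat) (a b : R) : Prop :=
  exists c : R, a - b = c * t ^+ n.

Definition adic_complete (R : idomainType) (t : R) : Prop :=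
  forall u : nat -> R,
    (forall n, exists N, forall i j, (N <= i)%N -> (N <= j)%N ->
       congr_exp t n (u i) (u j)) ->
    exists l : R, forall n, exists N, forall i, (N <= i)%N ->
       congr_exp t n (u i) l.

Definition complete_dvr (R : idomainType) : Prop :=
  exists2 t : R, uniformizer t & adic_complete t.

Definition is_fraction_field (R : idomainType) (K : fieldType)
    (iota : {rmorphism R -> K}) : Prop :=
  injective iota /\
  forall x : K, exists a : R, exists b : R, b != 0 /\ x = iota a / iota b.

(* The kernel of the residue map is the set of non-units, i.e. the maximal
   ideal of the local ring R. *)
Definition is_residue_field (R : idomainType) (F : fieldType)
    (red : {rmorphism R -> F}) : Prop :=
  (forall y : F, exists a : R, red a = y) /\
  (forall a : R, red a = 0 <-> a \isn't a GRing.unit).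

Record splitting_modular_system (p : nat) (K : fieldType) (R : idomainType)
    (F : fieldType) (iota : {rmorphism R -> K}) (red : {rmorphism R -> F})
    (gT : finGroupType) (G : {group gT}) : Prop := SplittingModularSystem {
  sms_dvr : complete_dvr R;
  sms_frac : is_fraction_field iota;
  sms_res : is_residue_field red;
  sms_char0 : [pchar K] =i pred0;
  sms_charp : p \in [pchar F];
  sms_splitK : group_splitting_field K G;
  sms_splitF : group_splitting_field F G
}.

(* Finitely generated R-free RG-modules, as matrix representations over R.  The
   matrices act on row vectors, so that modules are right modules. *)
Record glattice (R : comUnitRingType) (gT : finGroupType) (G : {group gT}) :=
  Glattice { gdeg : nat; grep :> mx_representation R G gdeg }.
Arguments Glattice {R gT G gdeg} grep.

Section Glattice.
Variables (R : comUnitRingType) (gT : finGroupType) (G : {group gT}).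
Implicit Types A B C : glattice R G.

Definition ghom A B (f : 'M[R]_(gdeg A, gdeg B)) : Prop :=
  forall x, x \in G -> A x *m f = f *m B x.

Definition giso A B : Prop :=
  exists f : 'M[R]_(gdeg A, gdeg B), exists g : 'M[R]_(gdeg B, gdeg A),
    [/\ ghom f, f *m g = 1%:M & g *m f = 1%:M].

Lemma giso_refl A : giso A A.
Proof.
by exists 1%:M, 1%:M; rewrite !mulmx1; split=> // x _; rewrite mulmx1 mul1mx.
Qed.

Lemma giso_sym A B : giso A B -> giso B A.
Proof.
move=> [f [g [hf fg gf]]]; exists g, f; split=> // x Gx.
by rewrite -[LHS]mul1mx -gf -mulmxA (mulmxA f) -hf // -mulmxA fg mulmx1.
Qed.

Lemma giso_trans A B C : giso A B -> giso B C -> giso A C.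
Proof.
move=> [f [g [hf fg gf]]] [h [k [hh hk kh]]]; exists (f *m h), (k *m g).
split=> [x Gx||]; first by rewrite mulmxA hf // -mulmxA hh // mulmxA.
  by rewrite mulmxA -(mulmxA f) hk mulmx1.
by rewrite mulmxA -(mulmxA k) gf mulmx1.
Qed.

Lemma gzero_repr : mx_repr G (fun _ : gT => 1%:M : 'M[R]_0).
Proof. by split=> // x y _ _; rewrite mulmx1. Qed.
Definition gzero : glattice R G := Glattice (MxRepresentation gzero_repr).

Lemma gtriv_repr : mx_repr G (fun _ : gT => 1%:M : 'M[R]_1).
Proof. by split=> // x y _ _; rewrite mulmx1. Qed.
Definition gtriv : glattice R G := Glattice (MxRepresentation gtriv_repr).

Definition gregular : glattice R G := Glattice (regular_repr R G).

Section DirectSum.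
Variables A B : glattice R G.
Definition gsum_mx (x : gT) := block_mx (A x) 0 0 (B x).
Lemma gsum_repr : mx_repr G gsum_mx.
Proof.
rewrite /gsum_mx; split=> [|x y Gx Gy]; first by rewrite !repr_mx1 scalar_mx_block.
by rewrite mulmx_block !repr_mxM // !mulmx0 !mul0mx !addr0 !add0r.
Qed.
Definition gsum : glattice R G := Glattice (MxRepresentation gsum_repr).
End DirectSum.

Lemma giso_sum A A' B B' :
  giso A A' -> giso B B' -> giso (gsum A B) (gsum A' B').
Proof.
move=> [f [g [hf fg gf]]] [h [k [hh hk kh]]].
exists (block_mx f 0 0 h), (block_mx g 0 0 k).
split=> [x Gx||] /=; rewrite /gsum_mx !mulmx_block !mulmx0 !mul0mx !addr0 !add0r.
- by rewrite hf // hh.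
- by rewrite fg hk -scalar_mx_block.
by rewrite gf kh -scalar_mx_block.
Qed.

Lemma gsumC A B : giso (gsum A B) (gsum B A).
Proof.
exists (block_mx 0 1%:M 1%:M 0), (block_mx 0 1%:M 1%:M 0).
split=> [x Gx||] /=; rewrite /gsum_mx !mulmx_block ?(mulmx0, mul0mx, mulmx1)
  ?(mul1mx, addr0, add0r) // -?scalar_mx_block //.
Qed.

Lemma gsum0 A : giso (gsum gzero A) A.
Proof.
exists (col_mx 0 1%:M), (row_mx 0 1%:M).
split=> [x Gx||] /=; rewrite /gsum_mx.
- by rewrite mul_block_col mul_col_mx ?(mul0mx, mulmx0) ?(mulmx1, mul1mx)
    ?(add0r, addr0).
- rewrite mul_col_row ?(mul0mx, mulmx0) mulmx1 [RHS]scalar_mx_block.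
  by congr block_mx; apply/matrixP=> -[].
by rewrite mul_row_col mul0mx add0r mulmx1.
Qed.

Lemma giso_cast A B (e : gdeg A = gdeg B) :
  (forall x, castmx (e, e) (A x) = B x) -> giso A B.
Proof.
case: A B e => [n rA] [m rB] /= e; case: _ / e rB => rB eAB.
exists 1%:M, 1%:M; rewrite !mulmx1; split=> // x _.
by rewrite mulmx1 mul1mx /= -eAB castmx_id.
Qed.

Lemma gsumA A B C : giso (gsum A (gsum B C)) (gsum (gsum A B) C).
Proof.
apply: (@giso_cast (gsum A (gsum B C)) (gsum (gsum A B) C) (addnA _ _ _)) => x /=.
rewrite /gsum_mx /= /gsum_mx -[in LHS]row_mx0 -[in LHS]col_mx0 block_mxA.
by rewrite castmx_comp castmx_id /= row_mx0 col_mx0.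
Qed.

End Glattice.

(* The Grothendieck group of a commutative monoid, as formal differences. *)

Section Groth.
Variable M : nmodType.

Definition groth_eq : rel (M * M) :=
  fun x y => `[< exists z : M, x.1 + y.2 + z = y.1 + x.2 + z >].

Lemma groth_eq_refl : reflexive groth_eq.
Proof. by move=> x; apply/asboolP; exists 0. Qed.

Lemma groth_eq_sym : symmetric groth_eq.
Proof. by move=> x y; apply/asboolP/asboolP=> -[z e]; exists z. Qed.

Lemma groth_eq_trans : transitive groth_eq.
Proof.
move=> y x z /asboolP[u eu] /asboolP[v ev]; apply/asboolP.
exists (y.1 + y.2 + u + v).
have -> : x.1 + z.2 + (y.1 + y.2 + u + v) = (x.1 + y.2 + u) + (y.1 + z.2 + v).
  by rewrite [LHS](AC (2*4) ((1*4*5)*(3*2*6))).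
rewrite eu ev.
by rewrite [LHS](AC (3*3) ((4*2)*(1*5*3*6))).
Qed.

Canonical groth_eq_equiv :=
  EquivRel groth_eq groth_eq_refl groth_eq_sym groth_eq_trans.

Definition groth := {eq_quot groth_eq}.
HB.instance Definition _ := Choice.on groth.
HB.instance Definition _ := EqQuotient.on groth.

Definition groth_zero : groth := \pi_groth (0, 0).
Definition groth_opp (x : groth) : groth :=
  let a := generic_quotient.repr x in \pi_groth (a.2, a.1).
Definition groth_add (x y : groth) : groth :=
  let a := generic_quotient.repr x in let b := generic_quotient.repr y in
  \pi_groth (a.1 + b.1, a.2 + b.2).

Lemma groth_piP (a b : M * M) :
  \pi_groth a = \pi_groth b <-> exists z : M, a.1 + b.2 + z = b.1 + a.2 + z.
Proof.
split=> [/eqmodP/asboolP //|e].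
by apply/eqmodP/asboolP.
Qed.

Lemma groth_oppE a : groth_opp (\pi a) = \pi_groth (a.2, a.1).
Proof.
apply/groth_piP => /=; have /groth_piP[z e] := reprK (\pi_groth a).
by exists z; rewrite [X in X + z = _]addrC -e [X in X + z = _]addrC.
Qed.

Lemma groth_addE a b :
  groth_add (\pi a) (\pi b) = \pi_groth (a.1 + b.1, a.2 + b.2).
Proof.
apply/groth_piP => /=.
have /groth_piP[z e] := reprK (\pi_groth a).
have /groth_piP[w f] := reprK (\pi_groth b).
exists (z + w); set p := generic_quotient.repr _ in e *.
set q := generic_quotient.repr _ in f *.
transitivity ((p.1 + a.2 + z) + (q.1 + b.2 + w)).
  by rewrite [LHS](AC ((2*2)*2) ((1*3*5)*(2*4*6))).
by rewrite e f [RHS](AC ((2*2)*2) ((1*3*5)*(2*4*6))).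
Qed.

Lemma groth_addA : associative groth_add.
Proof.
move=> x y z; rewrite -[x]reprK -[y]reprK -[z]reprK !groth_addE /=.
by rewrite !addrA.
Qed.

Lemma groth_addC : commutative groth_add.
Proof.
move=> x y; rewrite -[x]reprK -[y]reprK !groth_addE.
by congr (\pi_groth (_, _)); rewrite addrC.
Qed.

Lemma groth_add0 : left_id groth_zero groth_add.
Proof.
by move=> x; rewrite -[x]reprK groth_addE !add0r -surjective_pairing.
Qed.

Lemma groth_addN : left_inverse groth_zero groth_opp groth_add.
Proof.
move=> x; rewrite -[x]reprK groth_oppE groth_addE /=.
by apply/groth_piP; exists 0 => /=; rewrite !addr0 !add0r addrC.
Qed.

HB.instance Definition _ :=
  GRing.isZmodule.Build groth groth_addA groth_addC groth_add0 groth_addN.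

Definition groth_in (a : M) : groth := \pi_groth (a, 0).

Lemma groth_inD : {morph groth_in : a b / a + b}.
Proof. by move=> a b; rewrite [RHS]groth_addE /= addr0. Qed.

Lemma groth_in_eq (a b : M) :
  groth_in a = groth_in b <-> exists z : M, a + z = b + z.
Proof. by rewrite /groth_in groth_piP /= !addr0. Qed.

Lemma groth_piE (a : M * M) : \pi_groth a = groth_in a.1 - groth_in a.2.
Proof.
have eN : - groth_in a.2 = \pi_groth (0, a.2) by exact: groth_oppE.
by rewrite eN [RHS]groth_addE /= addr0 add0r -surjective_pairing.
Qed.

End Groth.

(* Isomorphism classes of modules, a commutative monoid under direct sum. *)

Section IsoClass.
Variables (R : comUnitRingType) (gT : finGroupType) (G : {group gT}).

HB.instance Definition _ := gen_eqMixin (glattice R G).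
HB.instance Definition _ := gen_choiceMixin (glattice R G).

Definition gisob : rel (glattice R G) := fun A B => `[< giso A B >].

Lemma gisob_refl : reflexive gisob.
Proof. by move=> A; apply/asboolP; apply: giso_refl. Qed.

Lemma gisob_sym : symmetric gisob.
Proof. by move=> A B; apply/asboolP/asboolP; apply: giso_sym. Qed.

Lemma gisob_trans : transitive gisob.
Proof.
by move=> B A C /asboolP AB /asboolP BC; apply/asboolP; apply: giso_trans BC.
Qed.

Canonical gisob_equiv := EquivRel gisob gisob_refl gisob_sym gisob_trans.

Definition isoclass := {eq_quot gisob}.
HB.instance Definition _ := Choice.on isoclass.
HB.instance Definition _ := EqQuotient.on isoclass.

Lemma isoclass_piP A B : \pi_isoclass A = \pi_isoclass B <-> giso A B.
Proof. by split=> [/eqmodP/asboolP|e]; last exact/eqmodP/asboolP. Qed.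

Definition isoclass_zero : isoclass := \pi_isoclass (gzero R G).
Definition isoclass_add (x y : isoclass) : isoclass :=
  \pi_isoclass (gsum (generic_quotient.repr x) (generic_quotient.repr y)).

Lemma isoclass_addE A B :
  isoclass_add (\pi A) (\pi B) = \pi_isoclass (gsum A B).
Proof. by apply/isoclass_piP/giso_sum; apply/isoclass_piP; rewrite reprK. Qed.

Lemma isoclass_addA : associative isoclass_add.
Proof.
move=> x y z; rewrite -[x]reprK -[y]reprK -[z]reprK !isoclass_addE.
exact/isoclass_piP/gsumA.
Qed.

Lemma isoclass_addC : commutative isoclass_add.
Proof.
move=> x y; rewrite -[x]reprK -[y]reprK !isoclass_addE.
exact/isoclass_piP/gsumC.
Qed.

Lemma isoclass_add0 : left_id isoclass_zero isoclass_add.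
Proof.
by move=> x; rewrite -[x]reprK isoclass_addE; apply/isoclass_piP/gsum0.
Qed.

HB.instance Definition _ :=
  GRing.isNmodule.Build isoclass isoclass_addA isoclass_addC isoclass_add0.

(* Only the additive group of the Green ring is defined: no statement below uses
   its multiplication. *)
Definition green := groth isoclass.

Definition gclass (A : glattice R G) : green := groth_in (\pi_isoclass A).

Lemma gclassD A B : gclass (gsum A B) = gclass A + gclass B.
Proof. by rewrite /gclass -isoclass_addE; apply: groth_inD. Qed.

Lemma gclass_eq A B :
  gclass A = gclass B <-> exists C, giso (gsum A C) (gsum B C).
Proof.
rewrite /gclass groth_in_eq; split=> [[z]|[C AC]].
  rewrite -[z]reprK => e; exists (generic_quotient.repr z).
  by apply/isoclass_piP; rewrite -!isoclass_addE.
exists (\pi_isoclass C); apply: etrans (isoclass_addE _ _) _.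
by apply: etrans (esym (isoclass_addE _ _)); apply/isoclass_piP.
Qed.

Lemma gclassP (x : green) : exists A B, x = gclass A - gclass B.
Proof.
rewrite -[x]reprK groth_piE; case: (generic_quotient.repr x) => a b /=.
exists (generic_quotient.repr a), (generic_quotient.repr b).
by rewrite /gclass !reprK.
Qed.

End IsoClass.

(* The additive extension to Green rings of an operation on modules which
   preserves isomorphism and direct sums, see glift_class. *)
Definition glift (R : comUnitRingType) (gT hT : finGroupType)
    (G : {group gT}) (H : {group hT}) (f : glattice R G -> glattice R H)
    (x : green R G) : green R H :=
  let a := generic_quotient.repr x in
  gclass (f (generic_quotient.repr a.1)) - gclass (f (generic_quotient.repr a.2)).

Lemma glift_class (R : comUnitRingType) (gT hT : finGroupType)
    (G : {group gT}) (H : {group hT}) (f : glattice R G -> glattice R H) :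
    (forall A B, giso A B -> giso (f A) (f B)) ->
    (forall A B, giso (f (gsum A B)) (gsum (f A) (f B))) ->
  forall A B, glift f (gclass A - gclass B) = gclass (f A) - gclass (f B).
Proof.
move=> fiso fsum A B.
have giso_class C D : giso C D -> gclass C = gclass D :> green R H.
  by move=> CD; congr groth_in; apply/isoclass_piP.
rewrite /glift; set x := gclass A - gclass B.
set a := generic_quotient.repr x.
set C := generic_quotient.repr a.1; set D := generic_quotient.repr a.2.
have ex : x = gclass C - gclass D.
  by rewrite -[x]reprK groth_piE /gclass !reprK.
have : gclass (gsum A D) = gclass (gsum C B).
  rewrite !gclassD; move: ex; rewrite /x => /eqP.
  by rewrite subr_eq addrAC eq_sym subr_eq => /eqP ->.
case/gclass_eq=> E /fiso AE.
have : gclass (f A) + gclass (f D) = gclass (f C) + gclass (f B).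
  have eE X Y : gclass (f (gsum (gsum X Y) E)) =
      gclass (f X) + gclass (f Y) + gclass (f E) :> green R H.
    by rewrite (giso_class _ _ (fsum _ _)) gclassD (giso_class _ _ (fsum _ _)) gclassD.
  by apply: (addIr (gclass (f E))); rewrite -!eE; apply: giso_class.
by move=> e; apply/eqP; rewrite subr_eq addrAC eq_sym subr_eq e.
Qed.

Section Inflation.
Variables (R : comUnitRingType) (gT : finGroupType) (N Q : {group gT}).
Hypothesis nQN : N \subset 'N(Q).

Definition ginf (A : glattice R (N / Q)%G) : glattice R N :=
  Glattice (morphim_repr (A : mx_representation R (coset Q @* N) _) nQN).

Lemma ginf_iso A B : giso A B -> giso (ginf A) (ginf B).
Proof.
move=> [f [g [hf fg gf]]]; exists f, g; split=> // x Nx.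
by apply: hf; apply: mem_quotient.
Qed.

Lemma ginf_sum A B : giso (ginf (gsum A B)) (gsum (ginf A) (ginf B)).
Proof. exact: giso_refl. Qed.

Definition Inf : green R (N / Q)%G -> green R N := glift ginf.

Lemma InfE A B : Inf (gclass A - gclass B) = gclass (ginf A) - gclass (ginf B).
Proof. by apply: glift_class; [apply: ginf_iso | apply: ginf_sum]. Qed.

End Inflation.

(* Induction from H to G.  With t_i representatives of the right cosets H t_i
   in G, the blocks of the matrix of x are A (t_i * x * t_j^-1) when this
   element is in H, and 0 otherwise. *)

Section Induction.
Variables (R : comUnitRingType) (gT : finGroupType) (G H : {group gT}).
Hypothesis sHG : H \subset G.
Implicit Types A B : glattice R H.

Let k := #|rcosets H G|.

Definition ind_rep (i : 'I_k) : gT := fingroup.repr (enum_val i).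

Definition ind_block A (x : gT) (i j : 'I_k) : 'M[R]_(gdeg A) :=
  let h := (ind_rep i * x * (ind_rep j)^-1)%g in if h \in H then A h else 0.

Definition ind_mx A (x : gT) : 'M[R]_(\sum_(i < k) gdeg A) :=
  \mxblock_(i, j) ind_block A x i j.

Lemma ind_repP i : (H :* ind_rep i)%g = enum_val i.
Proof.
have /rcosetsP[y _ e] := enum_valP i.
by rewrite /ind_rep e; apply/rcoset_eqP/mem_repr_rcoset.
Qed.

Lemma ind_rep_in i : ind_rep i \in G.
Proof.
have /rcosetsP[y Gy e] := enum_valP i.
have : ind_rep i \in (H :* y)%g by rewrite -e -ind_repP rcoset_refl.
by case/rcosetP=> h Hh ->; rewrite groupM // (subsetP sHG).
Qed.

Lemma ind_rep_eq i j : ((ind_rep i * (ind_rep j)^-1)%g \in H) = (i == j).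
Proof.
rewrite -mem_rcoset; apply/idP/eqP=> [|->]; last exact: rcoset_refl.
by move/rcoset_eqP; rewrite !ind_repP => /enum_val_inj.
Qed.

Lemma ind_repE y : y \in G -> exists i, (y * (ind_rep i)^-1)%g \in H.
Proof.
move=> Gy; have Hy : (H :* y)%g \in rcosets H G by apply/rcosetsP; exists y.
exists (enum_rank_in Hy (H :* y)%g); rewrite -mem_rcoset ind_repP.
by rewrite enum_rankK_in // rcoset_refl.
Qed.

Lemma ind_repr A : mx_repr G (ind_mx A).
Proof.
split=> [|x y Gx Gy].
  rewrite -[RHS](mxdiagZ (p_ := fun _ : 'I_k => gdeg A)) /mxdiag.
  apply/eq_mxblockP => i j; rewrite /ind_block mulg1 ind_rep_eq.
  case: eqP => [->|_]; last by [].
  by rewrite mulgV repr_mx1 conform_mx_id.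
rewrite /ind_mx mul_mxblock; apply/eq_mxblockP => i j.
have [l Hl] := ind_repE (groupM (ind_rep_in i) Gx).
have eh : (ind_rep i * (x * y) * (ind_rep j)^-1 =
  (ind_rep i * x * (ind_rep l)^-1) * (ind_rep l * y * (ind_rep j)^-1))%g.
  by rewrite !mulgA mulgKV.
rewrite (bigD1 l) //= big1 ?addr0 => [|m lm].
  rewrite /ind_block Hl eh groupMl //.
  by case: ifP => [Hh|_]; rewrite ?mulmx0 // repr_mxM.
rewrite {1}/ind_block ifF ?mul0mx //; apply: contraNF lm => Hm.
rewrite -ind_rep_eq; move: (groupM (groupVr Hm) Hl).
by rewrite !invMg invgK !mulgA !mulgKV.
Qed.

Definition gind A : glattice R G := Glattice (MxRepresentation (ind_repr A)).

Definition ind_diag m n (f : 'M[R]_(m, n)) :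
    'M[R]_(\sum_(i < k) m, \sum_(j < k) n) :=
  \mxblock_(i, j) (if i == j then f else 0).

Lemma ind_diagM m n q (f : 'M[R]_(m, n)) (g : 'M[R]_(n, q)) :
  ind_diag f *m ind_diag g = ind_diag (f *m g).
Proof.
rewrite /ind_diag mul_mxblock; apply/eq_mxblockP => i j.
rewrite (bigD1 i) //= eqxx big1 ?addr0 => [|l li].
  by case: eqP; rewrite ?mulmx0.
by rewrite eq_sym (negPf li) mul0mx.
Qed.

Lemma ind_diag1 m : ind_diag (1%:M : 'M[R]_m) = 1%:M.
Proof.
rewrite -[RHS](mxdiagZ (p_ := fun _ : 'I_k => m)) /mxdiag.
by apply/eq_mxblockP => i j; case: eqP => // _; rewrite conform_mx_id.
Qed.

Lemma ind_diagD m n (f g : 'M[R]_(m, n)) :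
  ind_diag f + ind_diag g = ind_diag (f + g).
Proof.
rewrite /ind_diag -mxblockD; apply/eq_mxblockP => i j.
by case: eqP; rewrite ?addr0.
Qed.

Lemma ind_diag0 m n : ind_diag (0 : 'M[R]_(m, n)) = 0.
Proof.
by rewrite -[RHS]mxblock0; apply/eq_mxblockP => i j; case: eqP.
Qed.

Lemma ind_diag_hom A B (f : 'M[R]_(gdeg A, gdeg B)) (x : gT) :
  ghom f -> ind_mx A x *m ind_diag f = ind_diag f *m ind_mx B x.
Proof.
move=> hf; rewrite /ind_diag /ind_mx !mul_mxblock.
apply/eq_mxblockP => i j.
rewrite [LHS](bigD1 j) //= eqxx big1 ?addr0 => [|l /negPf->]; last first.
  by rewrite mulmx0.
rewrite [RHS](bigD1 i) //= eqxx big1 ?addr0 => [|l]; last first.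
  by rewrite eq_sym => /negPf->; rewrite mul0mx.
by rewrite /ind_block; case: ifP => Hh; rewrite ?hf // mulmx0 mul0mx.
Qed.

Lemma gind_iso A B : giso A B -> giso (gind A) (gind B).
Proof.
move=> [f [g [hf fg gf]]]; exists (ind_diag f), (ind_diag g).
by split=> [x _||]; rewrite ?ind_diag_hom // ind_diagM ?fg ?gf ind_diag1.
Qed.

Lemma gind_sum A B : giso (gind (gsum A B)) (gsum (gind A) (gind B)).
Proof.
pose m := gdeg A; pose n := gdeg B.
pose pA : 'M[R]_(gdeg (gsum A B), m) := col_mx 1%:M 0.
pose pB : 'M[R]_(gdeg (gsum A B), n) := col_mx 0 1%:M.
pose iA : 'M[R]_(m, gdeg (gsum A B)) := row_mx 1%:M 0.
pose iB : 'M[R]_(n, gdeg (gsum A B)) := row_mx 0 1%:M.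
have hA : ghom pA.
  by move=> x _ /=; rewrite mul_block_col mul_col_mx ?(mul0mx, mulmx0)
    ?(mulmx1, mul1mx) ?(addr0, add0r).
have hB : ghom pB.
  by move=> x _ /=; rewrite mul_block_col mul_col_mx ?(mul0mx, mulmx0)
    ?(mulmx1, mul1mx) ?(addr0, add0r).
exists (row_mx (ind_diag pA) (ind_diag pB)), (col_mx (ind_diag iA) (ind_diag iB)).
split=> [x Gx||] /=.
- rewrite mul_mx_row /gsum_mx mul_row_block !mulmx0 addr0 add0r /=.
  by rewrite -(ind_diag_hom x hA) -(ind_diag_hom x hB).
- rewrite mul_row_col !ind_diagM ind_diagD !mul_col_row ?(mul0mx, mulmx0) !mulmx1.
  by rewrite add_block_mx ?(addr0, add0r) -scalar_mx_block ind_diag1.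
rewrite mul_col_row !ind_diagM !mul_row_col ?(mul0mx, mulmx0) !mulmx1.
by rewrite ?(addr0, add0r) !ind_diag1 !ind_diag0 -scalar_mx_block.
Qed.

Definition Ind : green R H -> green R G := glift gind.

Lemma IndE A B : Ind (gclass A - gclass B) = gclass (gind A) - gclass (gind B).
Proof. by apply: glift_class; [apply: gind_iso | apply: gind_sum]. Qed.

End Induction.

(* Projective modules, defined as retracts of free RG-modules of finite rank. *)

Section Projective.
Variables (R : comUnitRingType) (gT : finGroupType) (G : {group gT}).
Implicit Types A B P : glattice R G.

Definition gfree (n : nat) : glattice R G :=
  iter n (gsum (gregular R G)) (gzero R G).

Definition projective A : Prop :=
  exists n : nat, exists i : 'M[R]_(gdeg A, gdeg (gfree n)),
  exists s : 'M[R]_(gdeg (gfree n), gdeg A),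
    [/\ ghom i, ghom s & i *m s = 1%:M].

Definition submodule A (U : 'rV[R]_(gdeg A) -> Prop) : Prop :=
  [/\ U 0, forall (a : R) u v, U u -> U v -> U (a *: u + v) &
      forall x u, x \in G -> U u -> U (u *m A x)].

(* The submodule U is superfluous: U + V = A implies V = A. *)
Definition superfluous A (U : 'rV[R]_(gdeg A) -> Prop) : Prop :=
  forall V, submodule V ->
    (forall w, exists u, exists v, [/\ U u, V v & w = u + v]) ->
    forall w, V w.

Definition projective_cover P A : Prop :=
  projective P /\
  exists f : 'M[R]_(gdeg P, gdeg A),
    [/\ ghom f, forall v : 'rV[R]_(gdeg A), exists u, u *m f = v &
        @superfluous P (fun u => u *m f = 0)].

End Projective.

(* An element satisfying Q, or 0 if there is none.  Over a complete discrete
   valuation ring the predicates it is applied to determine a unique element of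
   the Green ring. *)
Definition the_elt (V : zmodType) (Q : V -> Prop) : V :=
  if pselect (exists x, Q x) is left h then sval (cid h) else 0.

(* P[M] for a virtual projective R[N / Q]-module M. *)
Definition cover_lift (R : comUnitRingType) (gT : finGroupType)
    (N Q : {group gT}) (nQN : N \subset 'N(Q))
    (M : green R (N / Q)%G) : green R N :=
  the_elt (fun V : green R N =>
    exists A B : glattice R (N / Q)%G, exists PA PB : glattice R N,
      [/\ projective A, projective B & M = gclass A - gclass B] /\
      [/\ projective_cover PA (ginf nQN A), projective_cover PB (ginf nQN B) &
          V = gclass PA - gclass PB]).

Definition Psi1 (p : nat) (gT : finGroupType) (G : {group gT}) (y : gT) : nat :=
  if p^'.-elt y then #|[set x in 'C_G[y] | p.-elt x]| else 0%N.

(* P_{1,p,G}; iota is the embedding of R in its field of fractions, where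
   characters take their values. *)
Definition P1 (p : nat) (R : comUnitRingType) (K : fieldType)
    (iota : {rmorphism R -> K}) (gT : finGroupType) (G : {group gT}) :
    green R G :=
  the_elt (fun V : green R G =>
    exists A B : glattice R G,
      [/\ projective A, projective B, V = gclass A - gclass B &
          forall y, y \in G ->
            iota (\tr (A y)) - iota (\tr (B y)) = (Psi1 p G y)%:R]).

Definition nontrivial_psubgroups (p : nat) (gT : finGroupType)
    (X : {group gT}) : {set {group gT}} :=
  [set Q : {group gT} | [&& Q \subset X, p.-group Q & Q :!=: 1%g]].

(* A chain Q_1 < ... < Q_n is encoded by the set of its members, a set of
   subgroups totally ordered by inclusion. *)
Definition pchains (p : nat) (gT : finGroupType) (X : {group gT}) :
    {set {set {group gT}}} :=
  [set s : {set {group gT}} | (s \subset nontrivial_psubgroups p X) &&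
    [forall P in s, forall Q in s, (P \subset Q) || (Q \subset P)]].

Definition steinberg (R : comUnitRingType) (p : nat) (gT : finGroupType)
    (X : {group gT}) : green R X :=
  \sum_(s in orbit_transversal ('JG^*)%act X (pchains p X))
    gclass (gind (subsetIl X 'C[s | 'JG^*]) (gtriv R 'C_X[s | 'JG^*]%G))
      *~ (-1) ^+ #|s|.

Definition radical_psubgroups (p : nat) (gT : finGroupType)
    (G : {group gT}) : {set {group gT}} :=
  [set Q in nontrivial_psubgroups p G | Q :==: 'O_p('N_G(Q))].

(* Main.v *)
Require Import Defs.
From HB Require Import structures.
From mathcomp Require Import all_boot all_order all_algebra.
From mathcomp Require Import all_fingroup all_solvable all_character.
From mathcomp Require Import boolp ring zify.

Set Implicit Arguments.
Unset Strict Implicit.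
Unset Printing Implicit Defensive.

Import GRing.Theory.
Local Open Scope group_scope.
Local Open Scope ring_scope.

(** Virtual projective lattices are determined by their characters on p-regular
    elements, and these characters vanish on p-singular elements.  So it is enough
    to find a virtual projective lattice with character [Psi1] which differs from
    the trivial lattice by the right-hand side.

    Consider the pairs (u, s) of a chain s = (Q_0 < ... < Q_n) of p-subgroups of G,
    with Q_0 = 1 allowed, and an element u of Q_0, counted with sign (-1)^n.
    Sign-reversing G-equivariant involutions, which add to s or remove from s a
    subgroup determined by (u, s), cancel all pairs but the (u, {<u>}); others
    cancel all pairs but those for which Q_0 is normal in every Q_i and is either
    trivial or radical.  For u = 1 the equality of the two remainders is
      R = sum of Ind (Inf (St (N_G(Q) / Q))), over Q = 1 and Q in T.
    For arbitrary u, taking characters, the first remainder gives the number of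
    p-elements of C_G(y), while the term of Q in the second one gets multiplied by
    |C_Q(y)|.  On p-regular y this is also the effect of replacing St (N_G(Q) / Q)
    by its projective cover.  Finally the term Q = 1 is not changed by this
    replacement, because St is virtually projective (Webb).

    For Webb's theorem, let P be a Sylow p-subgroup.  The chains whose stabilizer
    in P is trivial span a free module, and the other ones span a complex with a
    P-equivariant contraction: the complex of chains normalized by a p-group S <> 1
    is contractible along Q <= QS >= S, whence an acyclic carrier.  Averaged over
    the cosets of P, this contraction becomes equivariant under the whole group up
    to a relative trace from 1, and it splits the complex up to projectives. *)

(** * Relative traces and projectivity *)

(** No decomposition into indecomposables is used. Projectivity is handled by Higman's criterion:
    the identity is a relative trace from 1.

    That characters determine projective lattices is proved by comparing the reductions [A] and [B]
    through the dimensions of Hom(W, A) and Hom(W, B), for all modular [W]. The obstacle is that [W]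
    need not lift to [R]. But Hom(W, A) is projective, hence it lifts, and the character of the lift
    vanishes on p-singular elements and is determined on p-regular ones by restriction to cyclic
    p'-groups, over which everything lifts.

    The factor |C_Q(y)| in the character of the projective cover of [A] comes from a sum over the
    coset Qy. This sum is |Q| times the character of [A] at y, while only p-regular elements
    contribute to it, and by Schur-Zassenhaus these are the |Q : C_Q(y)| conjugates of y under Q.
    The same factor counts the elements of Q_0 fixed by y, and this is why the chains are decorated
    with an element u of their bottom. *)

Section Higman.
Variables (R : comUnitRingType) (gT : finGroupType) (G : {group gT}).
Implicit Types A B C : glattice R G.

Definition trG A B (f : 'M[R]_(gdeg A, gdeg B)) : 'M[R]_(gdeg A, gdeg B) :=
  \sum_(x in G) A (x^-1)%g *m f *m B x.

Lemma trG_hom A B f : ghom (@trG A B f).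
Proof.
move=> y Gy; rewrite /trG mulmx_sumr mulmx_suml.
rewrite (reindex_inj (mulIg y)) /= (eq_bigl (mem G)) => [|x]; last exact: groupMr.
apply: eq_bigr => x Gx; rewrite invMg !repr_mxM ?groupV // !mulmxA.
by rewrite -repr_mxM ?groupV // mulgV repr_mx1 mul1mx.
Qed.

Lemma trG_mull A B C (a : 'M_(gdeg A, gdeg B)) (f : 'M_(gdeg B, gdeg C)) :
  ghom a -> a *m trG f = trG (a *m f).
Proof.
move=> ha; rewrite /trG mulmx_sumr; apply: eq_bigr => x Gx.
by rewrite !mulmxA -ha ?groupV // !mulmxA.
Qed.

Lemma trG_mulr A B C (f : 'M_(gdeg A, gdeg B)) (a : 'M_(gdeg B, gdeg C)) :
  ghom a -> trG f *m a = trG (f *m a).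
Proof.
move=> ha; rewrite /trG mulmx_suml; apply: eq_bigr => x Gx.
by rewrite -!mulmxA ha.
Qed.

Lemma ghom1 A : @ghom R gT G A A 1%:M.
Proof. by move=> x _; rewrite mulmx1 mul1mx. Qed.

Lemma ghomM A B C (f : 'M_(gdeg A, gdeg B)) (g : 'M_(gdeg B, gdeg C)) :
  ghom f -> ghom g -> ghom (f *m g).
Proof. by move=> hf hg x Gx; rewrite mulmxA hf // -!mulmxA hg. Qed.

Lemma ghomD A B (f g : 'M_(gdeg A, gdeg B)) : ghom f -> ghom g -> ghom (f + g).
Proof. by move=> hf hg x Gx; rewrite mulmxDr hf // hg // mulmxDl. Qed.

Lemma ghomN A B (f : 'M_(gdeg A, gdeg B)) : ghom f -> ghom (- f).
Proof. by move=> hf x Gx; rewrite mulmxN hf // mulNmx. Qed.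

Lemma ghomB A B (f g : 'M_(gdeg A, gdeg B)) : ghom f -> ghom g -> ghom (f - g).
Proof. by move=> hf hg; apply/ghomD/ghomN. Qed.

Lemma trGD A B (f g : 'M_(gdeg A, gdeg B)) : trG (f + g) = trG f + trG g.
Proof.
by rewrite /trG -big_split; apply: eq_bigr => x _; rewrite mulmxDr mulmxDl.
Qed.

Lemma trGN A B (f : 'M_(gdeg A, gdeg B)) : trG (- f) = - trG f.
Proof.
by rewrite /trG -sumrN; apply: eq_bigr => x _; rewrite mulmxN mulNmx.
Qed.

(** Higman's criterion, equivalent to [projective] by [projective_higman] and [higman_projective].
    It involves one endomorphism and no free lattice, so the closure properties of projective
    lattices are proved in this form. *)
Definition higman A := exists f, @trG A A f = 1%:M.

Lemma higman_retract A B (i : 'M_(gdeg A, gdeg B)) (s : 'M_(gdeg B, gdeg A)) :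
  ghom i -> ghom s -> i *m s = 1%:M -> higman B -> higman A.
Proof.
move=> hi hs is1 [f f1]; exists (i *m f *m s).
by rewrite -trG_mulr // -trG_mull // f1 mulmx1.
Qed.

Lemma ghom_inv A B (f : 'M_(gdeg A, gdeg B)) (g : 'M_(gdeg B, gdeg A)) :
  ghom f -> f *m g = 1%:M -> g *m f = 1%:M -> ghom g.
Proof.
move=> hf fg gf x Gx.
by rewrite -[LHS]mul1mx -gf -mulmxA (mulmxA f) -hf // -mulmxA fg mulmx1.
Qed.

Lemma higman_sum A B : higman A -> higman B -> higman (gsum A B).
Proof.
move=> [f f1] [g g1]; exists (block_mx f 0 0 g); rewrite /trG /=.
transitivity (\sum_(x in G) block_mx (A (x^-1)%g *m f *m A x) 0 0
                                    (B (x^-1)%g *m g *m B x)).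
  apply: eq_bigr => x _; rewrite /gsum_mx !mulmx_block.
  by rewrite !(mul0mx, mulmx0, addr0, add0r).
rewrite (scalar_mx_block (gdeg A) (gdeg B)) -f1 -g1 /trG.
elim/big_rec3: _ => [|x M N L _ ->]; first by rewrite block_mx0.
by rewrite add_block_mx !addr0.
Qed.

Lemma higman_zero : higman (gzero R G).
Proof. by exists 0; apply/matrixP=> -[]. Qed.

(** The projection onto the basis vector 1 works: its conjugates are the projections onto the other
    basis vectors, and they add up to the identity. *)
Lemma higman_regular : higman (gregular R G).
Proof.
pose o := gring_index G 1%g; exists (delta_mx o o); rewrite /trG /=.
transitivity (\sum_(x in G) delta_mx (gring_index G x) (gring_index G x) : 'M[R]_#|G|).
  apply: eq_bigr => x Gx.
  have -> : delta_mx o o = delta_mx o 0 *m delta_mx (0 : 'I_1) o :> 'M[R]_#|G|.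
    by rewrite mul_delta_mx.
  rewrite !mulmxA -colE -mulmxA -rowE rowK gring_indexK ?group1 // mul1g.
  rewrite -[RHS](mul_delta_mx (0 : 'I_1)); congr (_ *m _).
  apply/matrixP => i k; rewrite !mxE ord1 !eqxx andbT /= eq_sym.
  rewrite -!(can_eq (@gring_valK _ G)) !gring_indexK ?groupM ?groupV ?enum_valP //.
  by rewrite -eq_mulgV1.
rewrite (reindex_onto enum_val (gring_index G)) => [|x Gx]; last exact: gring_indexK.
apply/matrixP => i j; rewrite summxE (bigD1 i) /=; last first.
  by rewrite enum_valP gring_valK eqxx.
rewrite gring_valK !mxE eqxx eq_sym big1 ?addr0 //= => k /andP[_ ki].
by rewrite gring_valK mxE eq_sym (negPf ki).
Qed.

Lemma higman_free n : higman (gfree R G n).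
Proof.
elim: n => [|n IHn]; first exact: higman_zero.
exact: higman_sum higman_regular IHn.
Qed.

Lemma projective_higman A : projective A -> higman A.
Proof.
by move=> [n [i [s [hi hs is1]]]]; apply: higman_retract hi hs is1 (higman_free n).
Qed.

Lemma retract_free A n (i : 'I_n -> 'M[R]_(gdeg A, #|G|))
    (s : 'I_n -> 'M[R]_(#|G|, gdeg A)) :
  (forall k, @ghom _ _ _ A (gregular R G) (i k)) ->
  (forall k, @ghom _ _ _ (gregular R G) A (s k)) ->
  exists (I : 'M[R]_(gdeg A, gdeg (gfree R G n))) (S : 'M[R]_(gdeg (gfree R G n), gdeg A)),
  [/\ ghom I, ghom S & I *m S = \sum_k i k *m s k].
Proof.
elim: n i s => [|n IHn] i s hi hs.
  by exists 0, 0; split=> [x _|x _|]; rewrite ?mulmx0 ?mul0mx // big_ord0.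
have [I [S [hI hS IS]]] := IHn (i \o lift ord0) (s \o lift ord0)
  (fun k => hi _) (fun k => hs _).
exists (row_mx (i ord0) I), (col_mx (s ord0) S); split=> [x Gx|x Gx|] /=.
- rewrite /gsum_mx mul_mx_row mul_row_block hi // hI //.
  by rewrite !mulmx0 addr0 add0r.
- rewrite /gsum_mx mul_block_col mul_col_mx -hs // -hS //.
  by rewrite !mul0mx addr0 add0r.
by rewrite mul_row_col big_ord_recl IS.
Qed.

Lemma ghom_regular A (v : 'rV[R]_(gdeg A)) :
  @ghom _ _ _ (gregular R G) A (\matrix_(k < #|G|) (v *m A (enum_val k))).
Proof.
move=> x Gx; apply/row_matrixP => k; rewrite !row_mul !rowK -rowE rowK.
by rewrite gring_indexK ?groupM ?enum_valP // repr_mxM ?enum_valP // mulmxA.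
Qed.

(** The group ring is coinduced as well as induced: a linear form [w] gives the equivariant map
    sending [v] to the sum of the [(v k^-1 w) k] over [k] in [G]. *)
Lemma regular_cohom A (w : 'cV[R]_(gdeg A)) :
  @ghom _ _ _ A (gregular R G)
    (\matrix_(i < gdeg A, k < #|G|) (A (enum_val k)^-1%g *m w) i 0).
Proof.
move=> x Gx; apply/matrixP => i k; rewrite mxE.
under eq_bigr => j _ do rewrite mxE.
have -> : \sum_j A x i j * (A (enum_val k)^-1%g *m w) j 0 =
    (A (x * (enum_val k)^-1)%g *m w) i 0.
  by rewrite repr_mxM ?groupV ?enum_valP // -mulmxA [RHS]mxE.
have Hk : (enum_val k * x^-1)%g \in G by rewrite groupM ?groupV ?enum_valP.
rewrite [RHS]mxE (bigD1 (gring_index G (enum_val k * x^-1))) //= big1 => [|j jk].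
  rewrite !mxE gring_indexK // mulgKV gring_valK !eqxx mulr1 addr0.
  by rewrite invMg invgK.
rewrite !mxE /=; case: eqP => [e|_]; last by rewrite mulr0.
by case/eqP: jk; rewrite e gring_indexK ?groupM ?enum_valP // mulgK gring_valK.
Qed.

(** The matrix [f] is the sum of its columns times the unit rows, and the relative trace of a rank
    one matrix [w *m v] is the map of [regular_cohom] for [w] followed by that of [ghom_regular] for
    [v]. *)
Lemma trG_free A f : exists n (I : 'M[R]_(gdeg A, gdeg (gfree R G n)))
    (S : 'M[R]_(gdeg (gfree R G n), gdeg A)),
  [/\ ghom I, ghom S & I *m S = @trG A A f].
Proof.
exists (gdeg A).
have [I [S [hI hS IS]]] := retract_free
  (fun k => regular_cohom (col k f)) (fun k => ghom_regular (delta_mx 0 k)).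
exists I, S; split=> //; rewrite IS /trG.
transitivity (\sum_(k < gdeg A) \sum_(x in G)
    (A (x^-1)%g *m col k f) *m (delta_mx 0 k *m A x)).
  apply: eq_bigr => k _.
  rewrite (big_enum_val (fun x => A x^-1%g *m col k f *m (delta_mx 0 k *m A x))).
  apply/matrixP => i j; rewrite summxE mxE; apply: eq_bigr => l _.
  by rewrite [RHS]mxE big_ord1; congr (_ * _); rewrite mxE.
rewrite exchange_big; apply: eq_bigr => x _ /=; rewrite -mulmxA.
under eq_bigr => k _ do rewrite -mulmxA.
rewrite -mulmx_sumr; congr (_ *m _).
under eq_bigr => k _ do rewrite mulmxA.
rewrite -mulmx_suml; congr (_ *m _).
apply/matrixP => i j; rewrite summxE (bigD1 j) //= big1 => [|k kj].
  by rewrite !mxE big_ord1 !mxE !eqxx mulr1 addr0.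
by rewrite !mxE big_ord1 !mxE eqxx eq_sym (negPf kj) mulr0.
Qed.

Lemma higman_projective A : higman A -> projective A.
Proof.
move=> [f f1]; have [n [I [S [hI hS IS]]]] := trG_free f.
by exists n, I, S; split=> //; rewrite IS.
Qed.

End Higman.

(** * Lifting from the residue field *)

(** The group-independent part of the modular system, with a chosen uniformizer: it applies at once
    to [G], to the normalizers and to their quotients. *)
Record pmodular (p : nat) (R : idomainType) (F : fieldType)
    (red : {rmorphism R -> F}) (t : R) : Prop := PModular {
  pm_unif : uniformizer t;
  pm_complete : adic_complete t;
  pm_res : is_residue_field red;
  pm_char0 : forall n : nat, n%:R = 0 :> R -> n = 0%N;
  pm_charp : p \in [pchar F]
}.

Section Local.
Variables (p : nat) (R : idomainType) (F : fieldType).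
Variables (red : {rmorphism R -> F}) (t : R) (pmt : pmodular p red t).

Lemma unif_red : red t = 0.
Proof. by case: pmt => [[_ tu _] _ [_ rk] _ _]; apply/rk. Qed.

Lemma red_unit a : (a \is a GRing.unit) = (red a != 0).
Proof.
case: pmt => [_ _ [_ rk] _ _]; apply/idP/idP => [ua|].
  by apply/eqP => /rk; rewrite ua.
by apply: contraNT => /rk ->.
Qed.

Lemma red_eq0 a : red a = 0 -> exists c, a = c * t.
Proof.
move=> ra; have [->|a0] := eqVneq a 0; first by exists 0; rewrite mul0r.
case: (pm_unif pmt) => _ tu /(_ _ a0)[u [[|k] [uu e]]]; last first.
  by exists (u * t ^+ k); rewrite e exprSr mulrA.
by move: uu; rewrite red_unit -[u]mulr1 -(expr0 t) -e ra eqxx.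
Qed.

Lemma unif_sep a : (forall n, exists c, a = c * t ^+ n) -> a = 0.
Proof.
move=> ha; apply/eqP/negPn/negP => a0.
case: (pm_unif pmt) => t0 tu /(_ _ a0)[u [k [uu e]]].
have [c ec] := ha k.+1.
have : u = c * t.
  by apply: (mulIf (expf_neq0 k t0)); rewrite -e ec exprS mulrA.
by move=> e'; move: uu; rewrite red_unit e' rmorphM unif_red mulr0 eqxx.
Qed.

Lemma red_mx_unit n (M : 'M[R]_n) : map_mx red M \in unitmx -> M \in unitmx.
Proof. by rewrite !unitmxE det_map_mx unitfE -red_unit. Qed.

Lemma lift_mx m n (N : 'M[F]_(m, n)) : exists M : 'M[R]_(m, n), map_mx red M = N.
Proof.
case: pmt => [_ _ [rs _] _ _].
exists (\matrix_(i, j) sval (cid (rs (N i j)))).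
by apply/matrixP => i j; rewrite !mxE; case: cid.
Qed.

Lemma red_mx0 m n (M : 'M[R]_(m, n)) : map_mx red M = 0 -> exists C, M = t *: C.
Proof.
move=> /matrixP M0.
have h i j : exists c, M i j = c * t.
  by apply: red_eq0; have := M0 i j; rewrite !mxE.
exists (\matrix_(i, j) sval (cid (h i j))).
by apply/matrixP => i j; rewrite !mxE; case: cid => c /= ->; rewrite mulrC.
Qed.

Lemma unif_sep_mx m n (M : 'M[R]_(m, n)) :
  (forall k, exists C, M = t ^+ k *: C) -> M = 0.
Proof.
move=> hM; apply/matrixP => i j; rewrite mxE; apply: unif_sep => k.
by have [C ->] := hM k; exists (C i j); rewrite mxE mulrC.
Qed.

Lemma limit_mx m n (U : nat -> 'M[R]_(m, n)) :
    (forall k, exists C, U k.+1 - U k = t ^+ k *: C) ->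
  exists L, forall k, exists C, L - U k = t ^+ k *: C.
Proof.
move=> hU.
have hUk k l : exists C, U (k + l)%N - U k = t ^+ k *: C.
  elim: l => [|l [C hC]]; first by exists 0; rewrite addn0 subrr scaler0.
  have [D hD] := hU (k + l)%N; exists (t ^+ l *: D + C).
  by rewrite addnS -(subrKA (U (k + l)%N)) hC hD scalerDr scalerA exprD.
have lim i j : exists l : R, forall k, exists c, l - U k i j = c * t ^+ k.
  case: (pm_complete pmt (u := fun k => U k i j)) => [k|l hl].
    exists k => a b ka kb.
    have [C hC] := hUk k (a - k)%N; have [D hD] := hUk k (b - k)%N.
    exists (C i j - D i j); rewrite -(subrKA (U k i j)).
    move/matrixP/(_ i j): hC; move/matrixP/(_ i j): hD; rewrite !mxE !subnKC //.
    by move=> eD eC; rewrite eC -opprB eD mulrBl ![t ^+ k * _]mulrC.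
  exists l => k; have [N /(_ (k + N)%N (leq_addl _ _)) [c ec]] := hl k.
  have [C /matrixP/(_ i j)] := hUk k N; rewrite !mxE => eC.
  exists (C i j - c); rewrite mulrBl -ec [C i j * _]mulrC -eC; ring.
exists (\matrix_(i, j) sval (cid (lim i j))) => k.
have h i j : exists c, sval (cid (lim i j)) - U k i j = c * t ^+ k.
  by case: cid => l /= hl; apply: hl.
exists (\matrix_(i, j) sval (cid (h i j))); apply/matrixP => i j.
by rewrite !mxE; case: (cid (h i j)) => c /= ->; rewrite mulrC.
Qed.

(** Newton iteration [e |-> e + (e^2 - e) (1 - 2 e)], that is [3 e^2 - 2 e^3], which turns the
    defect [d = e^2 - e] into [d^2 (4 d - 3)]. It runs in [R[X]], so the limit commutes with
    whatever commutes with [X]. The defect of [X] is only nilpotent modulo [t], as it will be for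
    projective covers. *)
Lemma idem_lift n (X D : 'M[R]_n) k :
    iter k (mulmx (X *m X - X)) 1%:M = t *: D ->
  exists W : 'M[R]_n, (forall Y, Y *m X = X *m Y -> Y *m W = W *m Y) /\
    let E := X + (X *m X - X) *m W in E *m E = E.
Proof.
case: n X D => [|n] X D hD.
  by exists 0; split=> [Y _|]; apply/matrixP=> -[].
pose d0 : {poly R} := 'X * 'X - 'X.
(* A pair [(w, v)] stands for the approximation [e = X + d0 w] with defect [d0 v]; [st] is one
   Newton step in these coordinates. *)
pose st (wv : {poly R} * {poly R}) :=
  let e := 'X + d0 * wv.1 in
  (wv.1 + wv.2 * (1 - 2 * e), wv.2 * wv.2 * d0 * (4 * d0 * wv.2 - 3)).
pose wv j := iter j st (0, 1); have wvS j : wv j.+1 = st (wv j) by [].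
have st_inv j : let e := 'X + d0 * (wv j).1 in e * e - e = d0 * (wv j).2.
  elim: j => [|j IHj]; first by rewrite /= mulr0 addr0 mulr1.
  rewrite wvS /st; move: IHj; case: (wv j) => w v /=.
  set e := 'X + d0 * w => IHj.
  have -> : 'X + d0 * (w + v * (1 - 2 * e)) = e + (e * e - e) * (1 - 2 * e).
    by rewrite IHj /e; ring.
  have -> : d0 * (v * v * d0 * (4 * d0 * v - 3)) =
     (d0 * v) * (d0 * v) * (4 * (d0 * v) - 3) by ring.
  by rewrite -IHj; ring.
have vdvd j : exists q, (wv j).2 = d0 ^+ j * q.
  elim: j => [|j [q hq]]; first by exists 1; rewrite mulr1.
  rewrite wvS {1}/st; cbn [fst snd]; rewrite {1 2}hq; exists (d0 ^+ j * q * q * (4 * d0 * (wv j).2 - 3)).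
  by rewrite exprS; ring.
pose ev : {rmorphism {poly R} -> 'M[R]_n.+1} := horner_mx X.
have evX : ev 'X = X by apply: horner_mx_X.
have evd0 : ev d0 = X *m X - X by rewrite /d0 rmorphB rmorphM evX.
have evd j : exists C, ev (d0 ^+ (j * k)) = t ^+ j *: C.
  elim: j => [|j [C hC]]; first by exists 1; rewrite mul0n !expr0 rmorph1 scale1r.
  exists (D * C); rewrite mulSn exprD rmorphM hC.
  have -> : ev (d0 ^+ k) = t *: D.
    rewrite -hD rmorphXn evd0; elim: (k) => [|l /= <-] //.
    by rewrite exprS.
  by rewrite exprS -scalerAl -scalerAr scalerA.
(* Each step puts at least one more factor [d0] into the defect, and [d0 ^+ k] becomes divisible by
   [t] at [X]; so the iterates of index [j * k] converge t-adically. *)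
have Ucv j : exists C, ev (wv (j.+1 * k)%N).1 - ev (wv (j * k)%N).1 = t ^+ j *: C.
  have h l : exists q, (wv (j * k + l)%N).1 - (wv (j * k)%N).1 = d0 ^+ (j * k) * q.
    elim: l => [|l [q hq]]; first by exists 0; rewrite addn0 subrr mulr0.
    rewrite addnS; have [v hv] := vdvd (j * k + l)%N.
    rewrite wvS [(st _).1]/= addrAC hq hv exprD -!mulrA -mulrDr.
    by eexists.
  have [q hq] := h k; have [C hC] := evd j.
  exists (C * ev q); rewrite mulSn [(k + _)%N]addnC -rmorphB hq rmorphM hC.
  by rewrite -scalerAl.
have [W hW] := limit_mx Ucv.
have comm_ev Y q : Y *m X = X *m Y -> Y *m ev q = ev q *m Y.
  exact: comm_mx_horner.
exists W; split=> [Y cYX|].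
  apply/eqP; rewrite -subr_eq0; apply/eqP/unif_sep_mx => j.
  have [C hC] := hW j; exists (Y *m C - C *m Y).
  have -> : W = ev (wv (j * k)%N).1 + t ^+ j *: C by rewrite -hC addrC subrK.
  rewrite mulmxDr mulmxDl comm_ev // -scalemxAl -scalemxAr scalerBr.
  by rewrite opprD addrACA subrr add0r.
move=> E; apply/eqP; rewrite -subr_eq0; apply/eqP/unif_sep_mx => j.
have [C hC] := hW j.
pose e := ev ('X + d0 * (wv (j * k)%N).1).
have [C' hE] : exists C', E = e + t ^+ j *: C'.
  exists ((X *m X - X) *m C); rewrite /E /e rmorphD rmorphM evd0 evX.
  by rewrite -addrA scalemxAr -hC -mulmxE -mulmxDr; congr (_ + _ *m _); rewrite addrC subrK.
have [C2 he] : exists C2, e *m e - e = t ^+ j *: C2.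
  rewrite /e mulmxE -rmorphM -rmorphB st_inv; have [q ->] := vdvd (j * k)%N.
  have [C0 h0] := evd j; exists (ev d0 *m C0 *m ev q).
  by rewrite mulrA !rmorphM h0 -!mulmxE -scalemxAr -scalemxAl.
exists (C2 + C' *m e + e *m C' + t ^+ j *: (C' *m C') - C').
rewrite hE !mulmxDl !mulmxDr -!scalemxAl -!scalemxAr !scalerDr scalerN -he.
by apply/matrixP => a b; rewrite !mxE; ring.
Qed.

End Local.

Section IdemFactor.
Variables (p : nat) (R : idomainType) (F : fieldType).
Variables (red : {rmorphism R -> F}) (t : R) (pmt : pmodular p red t).

Lemma idem_base n (E : 'M[F]_n) : E *m E = E -> row_base E *m col_base E = 1%:M.
Proof.
move=> EE.
have /row_fullP[C' C'C] : row_full (col_base E) by apply: col_base_full.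
have /row_freeP[R' RR'] : row_free (row_base E) by apply: row_base_free.
move: (col_base E) (row_base E) (mulmx_base E) C'C RR' => C B CB C'C BR'.
have : C' *m (C *m B *m (C *m B)) *m R' = C' *m (C *m B) *m R' by rewrite CB EE.
by rewrite !mulmxA C'C !mul1mx -!mulmxA BR' mulmx1.
Qed.

(** Images of idempotents over [R] are free. A rank factorization of the reduction lifts, up to
    correction by the unit [u]; the remaining difference [E - S *m I] is idempotent and divisible by
    [t], hence by all powers of [t], hence zero. *)
Lemma idem_factor n (E : 'M[R]_n) : E *m E = E ->
  exists (I : 'M[R]_(\rank (map_mx red E), n)) (S : 'M[R]_(n, \rank (map_mx red E))),
    I *m S = 1%:M /\ S *m I = E.
Proof.
move=> EE; pose e := map_mx red E.
have ee : e *m e = e by rewrite -map_mxM EE.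
have [S0 hS] := lift_mx pmt (col_base e); have [I0 hI] := lift_mx pmt (row_base e).
pose u := I0 *m E *m S0.
have redu : map_mx red u = 1%:M.
  rewrite !map_mxM hS hI -/e.
  have eS : e *m col_base e = col_base e.
    have : col_base e *m row_base e *m col_base e = col_base e.
      by rewrite -mulmxA idem_base // mulmx1.
    by rewrite mulmx_base.
  by rewrite -mulmxA eS idem_base.
have uu : u \in unitmx by rewrite (red_mx_unit pmt) // redu unitmx1.
pose I := invmx u *m (I0 *m E); pose S := E *m S0.
have IS : I *m S = 1%:M.
  by rewrite /I /S -mulmxA [X in _ *m X]mulmxA -(mulmxA I0) EE mulVmx.
have IE : I *m E = I by rewrite /I -!mulmxA EE.
have ES : E *m S = S by rewrite /S mulmxA EE.
exists I, S; split=> //; apply/esym/eqP; rewrite -subr_eq0; apply/eqP.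
set D := E - S *m I.
have DD : D *m D = D.
  rewrite /D mulmxBl !mulmxBr EE mulmxA ES -(mulmxA S I E) IE -(mulmxA S I) (mulmxA I S).
  by rewrite IS mul1mx subrr subr0.
have redV : map_mx red (invmx u) = 1%:M.
  by rewrite -[LHS]mul1mx -redu -map_mxM mulmxV // map_mx1.
have D0 : map_mx red D = 0.
  rewrite map_mxB /S /I !map_mxM redV mul1mx hI hS -/e.
  have eb : e *m (col_base e *m row_base e) = col_base e *m row_base e.
    by rewrite mulmx_base ee.
  by rewrite mulmxA -(mulmxA e) eb mulmx_base ee subrr.
have [C eC] := red_mx0 pmt D0.
apply: (unif_sep_mx pmt) => k; elim: k => [|k [C' eC']].
  by exists D; rewrite scale1r.
exists (C *m C'); rewrite -{1}DD {1}eC {1}eC' -scalemxAl -scalemxAr scalerA.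
by rewrite exprS.
Qed.

End IdemFactor.

Section Retract.
Variables (R : comUnitRingType) (gT : finGroupType) (G : {group gT}).

(** The module structure of the image of an equivariant idempotent [S *m I], in the coordinates
    given by its factorization. *)
Lemma retract_lattice (L : glattice R G) r (I : 'M[R]_(r, gdeg L))
    (S : 'M[R]_(gdeg L, r)) : I *m S = 1%:M -> @ghom _ _ _ L L (S *m I) ->
  exists rP : mx_representation R G r,
    @ghom _ _ _ (Glattice rP) L I /\ @ghom _ _ _ L (Glattice rP) S.
Proof.
move=> IS hE.
have hr : mx_repr G (fun x => I *m L x *m S).
  split=> [|x y Gx Gy]; first by rewrite repr_mx1 mulmx1.
  rewrite repr_mxM // -[in LHS](mul1mx I) -IS -!mulmxA (mulmxA S I) (mulmxA _ (L x)).
  by rewrite -hE // !mulmxA.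
exists (MxRepresentation hr); split=> x Gx /=.
  by rewrite -!mulmxA hE // !mulmxA IS mul1mx.
rewrite !mulmxA -hE // -!mulmxA; congr (_ *m _).
by rewrite IS mulmx1.
Qed.

End Retract.

Section Gmap.
Variables (R S : comUnitRingType) (f : {rmorphism R -> S}).
Variables (gT : finGroupType) (G : {group gT}).
Implicit Types A B : glattice R G.

Definition gmap A : glattice S G := Glattice (map_repr f A).

Lemma gmapE A x : gmap A x = map_mx f (A x). Proof. by []. Qed.

Lemma ghom_map A B (h : 'M_(gdeg A, gdeg B)) :
  ghom h -> @ghom _ _ _ (gmap A) (gmap B) (map_mx f h).
Proof. by move=> hh x Gx; rewrite !gmapE -!map_mxM hh. Qed.

Lemma trG_map A B (h : 'M_(gdeg A, gdeg B)) :
  map_mx f (trG h) = @trG _ _ _ (gmap A) (gmap B) (map_mx f h).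
Proof.
by rewrite /trG map_mx_sum; apply: eq_bigr => x _; rewrite !map_mxM.
Qed.

Lemma higman_map A : higman A -> higman (gmap A).
Proof. by move=> [h h1]; exists (map_mx f h); rewrite -trG_map h1 map_mx1. Qed.

Lemma giso_eq (A B : glattice S G) (e : gdeg A = gdeg B) :
  (forall x, x \in G -> castmx (e, e) (A x) = B x) -> giso A B.
Proof.
case: A B e => [n rA] [m rB] /= e; case: _ / e rB => rB eAB.
exists 1%:M, 1%:M; rewrite !mulmx1; split=> // x Gx.
by rewrite mulmx1 mul1mx /= -eAB // castmx_id.
Qed.

Lemma gmap_regular : giso (gmap (gregular R G)) (gregular S G).
Proof.
apply: (@giso_eq (gmap (gregular R G)) (gregular S G) erefl) => x Gx.
by rewrite castmx_id; apply: map_regular_repr.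
Qed.

Lemma gmap_free n : giso (gmap (gfree R G n)) (gfree S G n).
Proof.
elim: n => [|n IHn].
  by apply: (@giso_eq (gmap (gzero R G)) (gzero S G) erefl) => x _; apply/matrixP=> -[].
apply: giso_trans (giso_sum gmap_regular IHn).
apply: (@giso_eq (gmap (gsum (gregular R G) (gfree R G n)))
          (gsum (gmap (gregular R G)) (gmap (gfree R G n))) erefl) => x _.
by rewrite castmx_id /= /gsum_mx /map_repr_mx map_block_mx !map_mx0.
Qed.

End Gmap.

Section Lifting.
Variables (p : nat) (R : idomainType) (F : fieldType).
Variables (red : {rmorphism R -> F}) (t : R) (pmt : pmodular p red t).
Variables (gT : finGroupType) (G : {group gT}).

(** Since the identity of [B] is the trace of [f], [h] is the trace of [h *m map_mx red f]. So an
    arbitrary matrix lift of [h], composed with [f], becomes an equivariant lift under the trace. *)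
Lemma lift_hom (A B : glattice R G) (h : 'M[F]_(gdeg A, gdeg B)) : higman B ->
    @ghom _ _ _ (gmap red A) (gmap red B) h ->
  exists h' : 'M[R]_(gdeg A, gdeg B), ghom h' /\ map_mx red h' = h.
Proof.
move=> [f f1] hh; have [h0 e0] := lift_mx pmt h.
exists (trG (h0 *m f)); split; first exact: trG_hom.
rewrite trG_map map_mxM e0 -[LHS](@trG_mull _ _ _ (gmap red A) (gmap red B) (gmap red B) h (map_mx red f) hh) -trG_map f1.
by rewrite map_mx1 mulmx1.
Qed.

Lemma lift_iso (A B : glattice R G) : higman A -> higman B ->
  giso (gmap red A) (gmap red B) -> giso A B.
Proof.
move=> HA HB [h [k [hh hk kh]]].
have [f [hf ef]] := lift_hom HB hh.
have [g [hg eg]] := lift_hom HA (ghom_inv hh hk kh).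
have ufg : f *m g \in unitmx.
  by rewrite (red_mx_unit pmt) // map_mxM ef eg hk unitmx1.
have ugf : g *m f \in unitmx.
  by rewrite (red_mx_unit pmt) // map_mxM ef eg kh unitmx1.
pose g1 := g *m invmx (f *m g); pose g2 := invmx (g *m f) *m g.
have fg1 : f *m g1 = 1%:M by rewrite mulmxA mulmxV.
have g2f : g2 *m f = 1%:M by rewrite -mulmxA mulVmx.
have g12 : g1 = g2 by rewrite -[LHS]mul1mx -g2f -mulmxA fg1 mulmx1.
by exists f, g1; split=> //; rewrite g12.
Qed.

(** A projective module is the image of an equivariant idempotent of a free one. This lifts to an
    endomorphism by [lift_hom], then to an idempotent by [idem_lift]. *)
Lemma lift_module (M : glattice F G) : higman M ->
  exists2 A : glattice R G, higman A & giso (gmap red A) M.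
Proof.
move/higman_projective=> [n [i0 [s0 [hi0 hs0 is0]]]].
pose L := gfree R G n; have HL : higman L := higman_free _ _ _.
have [a [b [ha ab ba]]] : giso (gmap red L) (gfree F G n) := gmap_free _ _ _.
have hb := ghom_inv ha ab ba.
pose i := i0 *m b; pose s := a *m s0.
have hi : @ghom _ _ _ M (gmap red L) i := ghomM hi0 hb.
have hs : @ghom _ _ _ (gmap red L) M s := ghomM ha hs0.
have is1 : i *m s = 1%:M by rewrite /i /s -mulmxA (mulmxA b) ba mul1mx.
clearbody i s; have [X [hX eX]] := lift_hom HL (ghomM hs hi).
have XX : map_mx red (X *m X - X) = 0.
  by rewrite map_mxB map_mxM eX -mulmxA (mulmxA i s) is1 mul1mx subrr.
have [D eD] := red_mx0 pmt XX.
have [|W [cW EE]] := @idem_lift _ _ _ _ _ pmt _ X D 1; first by rewrite /= mulmx1.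
set E := X + _ in EE.
have hE : @ghom _ _ _ L L E.
  have hW : @ghom _ _ _ L L W by move=> x Gx; apply: cW; apply: hX.
  exact: ghomD hX (ghomM (ghomB (ghomM hX hX) hX) hW).
have eE : map_mx red E = s *m i by rewrite /E map_mxD map_mxM XX mul0mx addr0.
have [I [S [IS SI]]] := idem_factor pmt EE.
move: (\rank _) I S IS SI => r I S IS SI.
have [|rP [hI hS]] := @retract_lattice _ _ _ L r I S IS; first by rewrite SI.
exists (Glattice rP); first exact: higman_retract hI hS IS HL.
exists (map_mx red I *m s), (i *m map_mx red S); split.
- exact: ghomM (ghom_map red hI) hs.
- rewrite -mulmxA (mulmxA s) -eE -SI -!map_mxM !mulmxA IS mul1mx.
  by rewrite -(map_mx1 red) -IS.
by rewrite -mulmxA (mulmxA (map_mx red S)) -map_mxM SI eE !mulmxA is1 mul1mx.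
Qed.

End Lifting.

(** * Characters of projective lattices vanish on singular elements *)

Section IdemTrace.
Variables (P : comNzRingType) (h : P) (al : {rmorphism P -> P}).

Lemma horner_sub0 (f : {poly P}) a : exists b, f.[a] - f.[0] = a * b.
Proof.
elim/poly_ind: f => [|f c _]; first by exists 0; rewrite !horner0 subrr mulr0.
exists f.[a]; rewrite !hornerE /=; ring.
Qed.

Lemma det_1add d (Q : 'M[P]_d) : exists q, \det (1%:M + h *: Q) - 1 = h * q.
Proof.
pose f := \det (1%:M + 'X *: map_mx polyC Q).
have fE a : f.[a] = \det (1%:M + a *: Q).
  rewrite -horner_evalE -det_map_mx; congr (\det _).
  by apply/matrixP => i j; rewrite !mxE /= horner_evalE !hornerE /= hornerMn !hornerE.
by have [q] := horner_sub0 f h; rewrite !fE scale0r addr0 det1 => e; exists q.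
Qed.

Let conj d (E E' : 'M[P]_d) := E *m E' + (1%:M - E) *m (1%:M - E').

Let conj_hom d (E E' Q1 Q2 : 'M[P]_d) :
    E *m E = E + h *: Q1 -> E' *m E' = E' + h *: Q2 ->
  exists Q, E *m conj E E' = conj E E' *m E' + h *: Q.
Proof.
move=> hQ1 hQ2; exists (Q1 *m E' - Q1 *m (1%:M - E') - E *m Q2 + (1%:M - E) *m Q2).
rewrite /conj !(mulmxDr, mulmxDl, mulmxN, mulNmx, mulmx1, mul1mx) !mulmxA.
rewrite !hQ1 -!(mulmxA E E') !hQ2 !(mulmxDl, mulmxDr) -!(scalemxAl, scalemxAr).
by apply/matrixP => a b; rewrite !mxE; ring.
Qed.

Let conj_unit d (E E' Q2 Q3 : 'M[P]_d) :
    E = E' + h *: Q3 -> E' *m E' = E' + h *: Q2 ->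
  exists Q, conj E' E = 1%:M + h *: Q.
Proof.
move=> -> hQ2; exists (Q2 + Q2 + E' *m Q3 - (1%:M - E') *m Q3).
rewrite /conj !(mulmxDr, mulmxDl, mulmxN, mulNmx, mulmx1, mul1mx, opprD, opprK).
rewrite !hQ2 -!(scalemxAl, scalemxAr).
by apply/matrixP => a b; rewrite !mxE; ring.
Qed.

(* Modulo [h], the idempotents [E] and [E' = map_mx al E] are intertwined by
   [w = E E' + (1 - E) (1 - E')], so that [\det w * (\tr E - \tr E') = 0]. *)
Lemma idem_trace d (E : 'M[P]_d) :
    (exists u, al h = h * u) -> (exists Q, E *m E = E + h *: Q) ->
    (exists Q, map_mx al (map_mx al E) = map_mx al E + h *: Q) ->
  exists i, (exists u, al i = h * u) /\
    exists v, (1 - i) * (\tr E - \tr (map_mx al E)) = h * v.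
Proof.
move=> [u hu] [Q1 hQ1] [Q3 hQ3]; set E' := map_mx al E in hQ3 *.
have [Q2 hQ2] : exists Q2, E' *m E' = E' + h *: Q2.
  by exists (u *: map_mx al Q1); rewrite -map_mxM hQ1 map_mxD map_mxZ hu scalerA.
have [Q5 hQ5] := conj_hom hQ1 hQ2; set w := conj E E' in hQ5.
(* [al] sends [E] to [E'] and fixes [E'] modulo [h], so it sends [w] to [E' E' + (1 - E') (1 - E')],
   which is 1 modulo [h]. *)
have [q hq] : exists q, al (\det w) - 1 = h * q.
  rewrite -det_map_mx /w /conj map_mxD !map_mxM !map_mxB !map_mx1 -/E'.
  by have [Q] := conj_unit hQ3 hQ2; rewrite /conj => ->; apply: det_1add.
exists (1 - \det w); split.
  by exists (- q); rewrite rmorphB rmorph1 mulrN -hq opprB.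
exists (\tr (Q5 *m \adj w)); rewrite subKr mulrBr.
have e1 : \tr (E *m w *m \adj w) = \det w * \tr E.
  by rewrite -mulmxA mul_mx_adj -scalemx1 -scalemxAr mulmx1 mxtraceZ.
have e2 : \tr (w *m E' *m \adj w) = \det w * \tr E'.
  by rewrite mxtrace_mulC mulmxA mul_adj_mx -scalemx1 -scalemxAl mul1mx mxtraceZ.
rewrite -e1 -e2 hQ5 mulmxDl mxtraceD -scalemxAl mxtraceZ; ring.
Qed.

End IdemTrace.

Section PolyLift.
Variables (p : nat) (R : idomainType) (F : fieldType).
Variables (red : {rmorphism R -> F}) (t : R) (pmt : pmodular p red t).

Lemma lift_poly (g : {poly F}) : exists f : {poly R}, map_poly red f = g.
Proof.
case: (pmt) => [_ _ [rs _] _ _].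
elim/poly_ind: g => [|g c [f hf]]; first by exists 0; rewrite rmorph0.
have [a ha] := rs c; exists (f * 'X + a%:P).
by rewrite rmorphD rmorphM /= hf map_polyX map_polyC /= ha.
Qed.

Lemma red_poly0 (f : {poly R}) : map_poly red f = 0 -> exists g, f = t *: g.
Proof.
move=> f0; have h i : exists c, f`_i = c * t.
  apply: (red_eq0 pmt); have : (map_poly red f)`_i = 0 by rewrite f0 coef0.
  by rewrite coef_map.
exists (\poly_(i < size f) sval (cid (h i))); apply/polyP => i.
rewrite coefZ coef_poly; case: ltnP => [_|fi]; last by rewrite nth_default // mulr0.
by case: cid => c /= ->; rewrite mulrC.
Qed.

(** The power [p ^ k] is additive in characteristic [p], so it is enough to treat constants, where
    nothing changes, and [X], which is the hypothesis. *)
Lemma frob_comp (h g : {poly F}) (k r : nat) :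
    (exists u, 'X ^+ (r * p ^ k) - 'X ^+ (p ^ k) = h * u) ->
  exists u, g ^+ (p ^ k) - (g \Po 'X^r) ^+ (p ^ k) = h * u.
Proof.
move=> [u hu]; have pF : p \in [pchar {poly F}] by rewrite pchar_poly (pm_charp pmt).
have frD (a b : {poly F}) : (a + b) ^+ (p ^ k) = a ^+ (p ^ k) + b ^+ (p ^ k).
  apply: exprDn_pchar; rewrite (eq_pnat _ (pcharf_eq pF)) pnatX pnat_id //.
  exact: (pcharf_prime pF).
elim/poly_ind: g => [|g c [v hv]].
  by exists 0; rewrite comp_poly0 subrr mulr0.
exists (v * 'X ^+ (p ^ k) - (g \Po 'X^r) ^+ (p ^ k) * u).
rewrite comp_poly_MXaddC !frD !exprMn -exprM.
have -> : g ^+ (p ^ k) = (g \Po 'X^r) ^+ (p ^ k) + h * v by rewrite -hv; ring.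
have -> : 'X ^+ (r * p ^ k) = 'X ^+ (p ^ k) + h * u by rewrite -hu; ring.
ring.
Qed.

(** Modulo [h] one has [d = i d], hence [d = i^m d], and [i^m] is divisible by [t]; so [d] is
    divisible by every power of [t] modulo [h]. As [d] is its own remainder by the monic [h], its
    coefficients are divisible by every power of [t]. *)
Lemma unif_cancel_mod (h d i : {poly R}) m (s u v : {poly R}) :
    h \is monic -> (size d < size h)%N ->
    (1 - i) * d = h * v -> i ^+ m = h * s + t *: u ->
  d = 0.
Proof.
move=> hm sd e1 em.
have e2 l : exists v', d = i ^+ l * d + h * v'.
  elim: l => [|l [v' IH]]; first by exists 0; rewrite mul1r mulr0 addr0.
  exists (v + i * v'); rewrite exprS -mulrA.
  have -> : i ^+ l * d = d - h * v' by rewrite {2}IH; ring.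
  by rewrite (mulrDr h) -e1; ring.
have e3 l : exists w v', d = t ^+ l *: w + h * v'.
  elim: l => [|l [w [v' IH]]]; first by exists d, 0; rewrite scale1r mulr0 addr0.
  have [v2 e] := e2 m; exists (u * w), (s * d + v2 + t *: (u * v')).
  transitivity (h * s * d + t *: u * (t ^+ l *: w + h * v') + h * v2).
    by rewrite -IH {1}e em; ring.
  rewrite exprS -!mul_polyC polyCM; ring.
apply/polyP => j; rewrite coef0; apply: (unif_sep pmt) => l.
have [w [v' e]] := e3 l; exists (Pdiv.Ring.rmodp w h)`_j.
rewrite -[d](Pdiv.RingMonic.rmodp_addl_mul_small hm 0 sd) mul0r add0r e.
rewrite Pdiv.RingMonic.rmodpD // Pdiv.RingMonic.rmodpZ //.
by rewrite [h * v']mulrC Pdiv.RingMonic.rmodp_mull // addr0 coefZ mulrC.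
Qed.

End PolyLift.

Section Restriction.
Variables (gT : finGroupType).

Lemma big_lcosets (V : nmodType) (G H : {group gT}) (f : gT -> V) : H \subset G ->
  \sum_(x in G) f x =
  \sum_(C in lcosets H G) \sum_(h in H) f (fingroup.repr C * h)%g.
Proof.
move=> sHG; rewrite (partition_big (fun x => x *: H)%g (mem (lcosets H G))) /=.
  apply: eq_bigr => C /lcosetsP[y Gy ->].
  have yr : fingroup.repr (y *: H)%g \in (y *: H)%g by rewrite (mem_repr y) ?lcoset_refl.
  rewrite (reindex_inj (mulgI (fingroup.repr (y *: H)%g))) /=.
  apply: eq_bigl => h; set z := fingroup.repr _ in yr *.
  have Gz : z \in G.
    by case/lcosetP: yr => k Hk ->; rewrite groupM // (subsetP sHG).
  have <- : (z *: H = y *: H)%g by apply/lcoset_eqP.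
  apply/andP/idP => [[_ /eqP e]|Hh].
    by have : (z * h \in z *: H)%g by [rewrite -e lcoset_refl]; rewrite mem_lcoset mulKg.
  split; first by rewrite groupM // (subsetP sHG).
  by apply/eqP/lcoset_eqP; rewrite mem_lcoset mulKg.
by move=> x Gx; apply/lcosetsP; exists x.
Qed.

Variables (R : comUnitRingType) (G H : {group gT}) (sHG : H \subset G).

Definition gres (A : glattice R G) : glattice R H :=
  Glattice (subg_repr (grep A) sHG).

(** The trace from 1 to [G] goes through [H]: the witness adds up the conjugates of [f] by coset
    representatives of [H]. *)
Lemma higman_res A : higman A -> higman (gres A).
Proof.
move=> [f f1].
exists (\sum_(C in lcosets H G) A (fingroup.repr C)^-1%g *m f *m A (fingroup.repr C)).
rewrite -[RHS]f1 /trG (big_lcosets _ sHG) exchange_big /=; apply: eq_bigr => h Hh.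
rewrite mulmx_sumr mulmx_suml; apply: eq_bigr => C /lcosetsP[y Gy ->].
have Gh := subsetP sHG _ Hh; set z := fingroup.repr _.
have Gz : z \in G.
  have : z \in (y *: H)%g by rewrite (mem_repr y) ?lcoset_refl.
  by case/lcosetP => k Hk ->; rewrite groupM // (subsetP sHG).
by rewrite invMg !repr_mxM ?groupV // !mulmxA.
Qed.

End Restriction.

Section Singular.
Variables (p : nat) (R : idomainType) (F : fieldType).
Variables (red : {rmorphism R -> F}) (t : R) (pmt : pmodular p red t).
Variables (gT : finGroupType).

Section Cyclic.
Variables (y : gT) (A : glattice R <[y]>%G).
Let n := #[y].
(** [R[X]] modulo [h] is the group ring of [<[y]>], with [X] in the role of [y]. *)
Let h : {poly R} := 'X^n - 1.

Let ngt0 : (0 < n)%N. Proof. exact: order_gt0. Qed.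

Let Xn_congr i j : (y ^+ i = y ^+ j)%g -> exists u : {poly R}, 'X^i - 'X^j = h * u.
Proof.
have h0 k : exists u : {poly R}, 'X^(k * n) - 1 = h * u.
  exists (\sum_(l < k) ('X^n) ^+ l); rewrite mulnC exprM -subrX1; congr (_ - _).
have h1 k l : exists u : {poly R}, 'X^(k * n + l) - 'X^l = h * u.
  have [u hu] := h0 k; exists (u * 'X^l); rewrite mulrA -hu exprD; ring.
move/eqP; rewrite eq_expg_mod_order => /eqP e.
have [u hu] := h1 (i %/ n)%N (i %% n)%N; have [v hv] := h1 (j %/ n)%N (j %% n)%N.
exists (u - v); rewrite mulrBr -hu -hv -!divn_eq -/n e; ring.
Qed.

Let e (x : gT) : nat := if [pick j : 'I_n | y ^+ j == x]%g is Some j then j else 0%N.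

Let e_lt x : (e x < n)%N.
Proof. by rewrite /e; case: pickP => [j _|_]; rewrite ?ltn_ord. Qed.

Let eP x : x \in <[y]> -> (y ^+ e x = x)%g.
Proof.
case/cycleP => i ->; rewrite /e; case: pickP => [j /eqP//|].
move/(_ (Ordinal (ltn_pmod i ngt0))) => /=.
by rewrite expg_mod_order eqxx.
Qed.

Let hmonic : h \is monic. Proof. exact: monicXnsubC. Qed.
Let hsize : size h = n.+1. Proof. exact: size_XnsubC. Qed.

Let cgr_sum d (I : finType) (P : pred I) (M N : I -> 'M[{poly R}]_d) :
    (forall x, P x -> exists Q, M x = N x + h *: Q) ->
  exists Q, \sum_(x | P x) M x = \sum_(x | P x) N x + h *: Q.
Proof.
move=> hM; elim/big_ind2: _ => [|M1 N1 M2 N2 [Q1 ->] [Q2 ->]|//].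
  by exists 0; rewrite scaler0 addr0.
by exists (Q1 + Q2); rewrite scalerDr addrACA.
Qed.

(* Take [r] such that [y ^+ r] is the p'-part of [y].  The group ring idempotent [E]
   of [A] and its image by ['X |-> 'X^r] have the same trace, and [\tr (A y)] is a
   multiple of a coefficient of the first trace which does not occur in the second. *)
Lemma cyclic_singular_trace : (p %| n)%N -> higman A -> \tr (A y) = 0.
Proof.
move=> pn [f f1]; have pF := pm_charp pmt; have ppr := pcharf_prime pF.
pose a := logn p n; pose m' := (n %/ p ^ a)%N.
have nE : n = (m' * p ^ a)%N by rewrite divnK // pfactor_dvdnn.
have agt0 : (0 < a)%N by rewrite logn_gt0 mem_primes ppr ngt0.
have m'gt0 : (0 < m')%N by move: ngt0; rewrite nE muln_gt0 => /andP[].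
have copm : coprime p m'.
  rewrite prime_coprime //; apply/negP => pm.
  have : (p ^ a.+1 %| n)%N by rewrite nE expnS dvdn_mul.
  by rewrite pfactor_dvdn // -/a ltnn.
(* By Euler's theorem [r] is 1 modulo [m'], and it is 0 modulo [p ^ a]; so [r] is idempotent modulo
   [n]. *)
pose r := (p ^ (a * totient m'))%N.
have rmod : r = 1 %[mod m'].
  by rewrite /r expnM Euler_exp_totient // coprimeXl.
have par : (p ^ a %| r)%N by rewrite dvdn_exp2l // leq_pmulr // totient_gt0.
have rr k : (y ^+ (r * (r * k)) = y ^+ (r * k))%g.
  apply/eqP; rewrite eq_expg_mod_order -/n nE chinese_remainder; last first.
    by rewrite coprime_sym coprimeXl.
  rewrite !(eqP (dvdn_mulr _ par)) eqxx andbT.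
  by rewrite -modnMml rmod modnMml mul1n.
pose al : {rmorphism {poly R} -> {poly R}} := comp_poly 'X^r.
have alX k : al 'X^k = 'X^(r * k) by rewrite rmorphXn /= comp_polyX exprM.
have alC c : al c%:P = c%:P by apply: comp_polyC.
have hal : exists u, al h = h * u.
  rewrite /h rmorphB rmorph1 alX -(expr0 'X); apply: Xn_congr.
  by rewrite mulnC expgM expg_order expg1n.
pose M x := map_mx polyC (A x^-1%g *m f).
(* [trG f = 1] makes [A] a retract of a free module over the group ring; [E] is the matrix of the
   corresponding idempotent. *)
pose E := \sum_(x in <[y]>) 'X^(e x) *: M x.
have alM x : map_mx al (M x) = M x by apply/matrixP => i j; rewrite !mxE alC.
have hE2 : exists Q, E *m E = E + h *: Q.
  have -> : E *m E = \sum_(w in <[y]>) \sum_(x in <[y]>)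
      ('X^(e x) *: M x) *m ('X^(e (x^-1 * w)%g) *: M (x^-1 * w)%g).
    rewrite /E mulmx_suml exchange_big /=; apply: eq_bigr => x yx.
    rewrite mulmx_sumr (reindex_inj (mulgI x^-1%g)) /=.
    by apply: eq_bigl => w; rewrite groupMl ?groupV.
  have -> : E = \sum_(w in <[y]>) \sum_(x in <[y]>)
      'X^(e w) *: (M x *m M (x^-1 * w)%g).
    apply: eq_bigr => w yw; rewrite -scaler_sumr; congr (_ *: _); rewrite /M.
    under eq_bigr => x _ do rewrite -map_mxM.
    rewrite -map_mx_sum; congr map_mx.
    transitivity (trG f *m A w^-1%g *m f); first by rewrite f1 mul1mx.
    rewrite /trG !mulmx_suml; apply: eq_bigr => x yx.
    rewrite -!mulmxA; congr (_ *m (_ *m _)); rewrite mulmxA -repr_mxM ?groupV //.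
    rewrite invMg invgK; congr (A _ *m _).
    by apply: (centsP (cycle_abelian y)); rewrite ?groupV.
  apply: cgr_sum => w yw; apply: cgr_sum => x yx.
  have [|u hu] := @Xn_congr (e x + e (x^-1 * w)%g)%N (e w).
    by rewrite expgD !eP ?groupM ?groupV // mulKVg.
  exists (u *: (M x *m M (x^-1 * w)%g)).
  rewrite -scalemxAl -scalemxAr !scalerA -hu scalerBl exprD.
  by rewrite addrC subrK.
have alE : map_mx al E = \sum_(x in <[y]>) 'X^(r * e x) *: M x.
  by rewrite map_mx_sum; apply: eq_bigr => x yx; rewrite map_mxZ alX alM.
have hE3 : exists Q, map_mx al (map_mx al E) = map_mx al E + h *: Q.
  rewrite alE map_mx_sum; apply: cgr_sum => x yx; rewrite map_mxZ alX alM.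
  have [u hu] := Xn_congr (rr (e x)); exists (u *: M x).
  by rewrite scalerA -hu scalerBl addrC subrK.
have [i [[u0 hi] [v0 hv]]] := idem_trace hal hE2 hE3.
pose c x := \tr (A x^-1%g *m f).
have trM x : \tr (M x) = (c x)%:P by rewrite trace_map_mx.
(* The exponents are reduced modulo [n] to bring the degree of [d] below that of [h], as
   [unif_cancel_mod] requires. *)
pose d := \sum_(x in <[y]>) ('X^(e x) * (c x)%:P) -
          \sum_(x in <[y]>) ('X^((r * e x) %% n) * (c x)%:P).
have [v hd] : exists v, (1 - i) * d = h * v.
  have [v1 hv1] : exists v1, \tr E - \tr (map_mx al E) = d + h * v1.
    rewrite alE /E (raddf_sum (@mxtrace _ _)) (raddf_sum (@mxtrace _ _)) /d /=.
    have [v1 hv1] : exists v1, \sum_(x in <[y]>) 'X^((r * e x) %% n) * (c x)%:P =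
        \sum_(x in <[y]>) \tr ('X^(r * e x) *: M x) + h * v1.
      elim/big_ind2: _ => [|x1 x2 z1 z2 [Q1 ->] [Q2 ->]|x yx].
      - by exists 0; rewrite mulr0 addr0.
      - by exists (Q1 + Q2); rewrite mulrDr addrACA.
      have [|u hu] := @Xn_congr ((r * e x) %% n)%N (r * e x)%N.
        by rewrite expg_mod_order.
      by exists (u * (c x)%:P); rewrite mxtraceZ trM mulrA -hu; ring.
    exists v1; rewrite hv1; under eq_bigr => x _ do rewrite mxtraceZ trM.
    ring.
  exists (v0 - (1 - i) * v1); rewrite (mulrBr h) -hv hv1; ring.
have sd : (size d < size h)%N.
  have sX k (b : R) : (k < n)%N -> (size ('X^k * b%:P : {poly R})%R <= n)%N.
    move=> kn; apply: leq_trans (size_polyMleq _ _) _; rewrite size_polyXn.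
    by have := size_polyC_leq1 b; lia.
  rewrite hsize ltnS; apply: leq_trans (size_polyD _ _) _; rewrite geq_max size_polyN.
  by apply/andP; split; apply: (leq_trans (size_sum _ _ _)); apply/bigmax_leqP => x _;
    apply: sX; rewrite ?ltn_mod.
(* By Frobenius, modulo [t] and [h] the element [i ^+ (p ^ a)] agrees with the same power of [al i],
   which is divisible by [h]. *)
have [s hs] : exists s, map_poly red i ^+ (p ^ a) = map_poly red h * s.
  have [|w hw] := @frob_comp _ _ _ _ _ pmt (map_poly red h) (map_poly red i) a r.
    have [|u hu] := @Xn_congr (r * p ^ a)%N (p ^ a)%N.
      apply/eqP; rewrite eq_expg_mod_order -/n nE -!muln_modl rmod.
      by rewrite -{2}[(p ^ a)%N]mul1n -muln_modl.
    exists (map_poly red u).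
    by rewrite -rmorphM -hu rmorphB !rmorphXn /= map_polyX.
  have e1 : map_poly red i \Po 'X^r = map_poly red h * map_poly red u0.
    by rewrite -rmorphM -hi /= map_comp_poly map_polyXn.
  exists (w + map_poly red u0 * (map_poly red h * map_poly red u0) ^+ (p ^ a).-1).
  have pa : (p ^ a = (p ^ a).-1.+1)%N by rewrite prednK // expn_gt0 prime_gt0.
  by rewrite (mulrDr (map_poly red h)) -hw e1 mulrA -exprS -pa subrK.
have [s' hs'] := lift_poly pmt s.
have [|u hu] := @red_poly0 _ _ _ _ _ pmt (i ^+ (p ^ a) - h * s').
  by rewrite rmorphB rmorphXn rmorphM /= hs' hs subrr.
have d0 : d = 0.
  apply: (unif_cancel_mod pmt hmonic sd hd (m := (p ^ a)%N) (s := s') (u := u)).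
  by rewrite -hu; ring.
have yV : (y^-1)%g \in <[y]> by rewrite groupV cycle_id.
have cy0 : c y^-1%g = 0.
  have : d`_(e y^-1%g) = 0 by rewrite d0 coef0.
  rewrite coefB !coef_sum (bigD1 y^-1%g) //= coefMC coefXn eqxx mul1r.
  rewrite big1 ?addr0 => [|x /andP[yx xy]]; last first.
    rewrite coefMC coefXn; case: eqP => [ex|_]; last by rewrite mul0r.
    by move: xy; rewrite -(eP yx) -ex eP ?eqxx.
  rewrite big1 ?subr0 // => x yx; rewrite coefMC coefXn; case: eqP => [ex|_]; last first.
    by rewrite mul0r.
  (* The exponents in the second sum are divisible by [p], because [r] and [n] are; but [e y^-1] is
     -1 modulo [n], so it is prime to [p]. *)
  have pe : (p %| e y^-1%g)%N.
    have pr : (p %| r * e x)%N.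
      by rewrite dvdn_mulr // (dvdn_trans _ par) // dvdn_exp.
    by rewrite ex -(dvdn_addr _ (dvdn_mull (r * e x %/ n) pn)) -divn_eq.
  have : (n %| (e y^-1%g).+1)%N.
    by rewrite order_dvdn expgSr eP // mulVg.
  move/(dvdn_trans pn); rewrite -addn1 dvdn_addr // dvdn1 => /eqP p1.
  by move: ppr; rewrite p1.
transitivity (n%:R * c y^-1%g); last by rewrite cy0 mulr0.
rewrite /c invgK mulr_natl -[A y in LHS]mulmx1 -f1 /trG mulmx_sumr raddf_sum /=.
rewrite -[RHS]sumr_const; apply: eq_bigr => x yx.
rewrite !mulmxA mxtrace_mulC !mulmxA -!repr_mxM ?groupV ?groupM ?groupV ?cycle_id //.
congr (\tr (A _ *m _)).
by rewrite -(centsP (cycle_abelian y) y _ x) ?cycle_id // mulgK.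
Qed.

End Cyclic.

Lemma singular_trace (G : {group gT}) (A : glattice R G) y :
  y \in G -> higman A -> ~~ p^'.-elt y -> \tr (A y) = 0.
Proof.
move=> Gy HA py; have sYG : <[y]> \subset G by rewrite cycle_subG.
apply: (@cyclic_singular_trace y (gres sYG A) _ (higman_res sYG HA)).
move: py; rewrite /p_elt p'natE ?negbK //; exact: pcharf_prime (pm_charp pmt).
Qed.

End Singular.

(** * Characters determine projective lattices *)

Section HomLattice.
Variables (R : comUnitRingType) (gT : finGroupType) (G : {group gT}).
Implicit Types A B W : glattice R G.

(** The matrix of [Z |-> P *m Z *m Q] on vectorized matrices, a Kronecker product. *)
Definition lin_bimul m n m' n' (P : 'M[R]_(m', m)) (Q : 'M[R]_(n, n')) :
  'M[R]_(m * n, m' * n') := lin_mulmx P *m lin_mulmxr Q.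

Lemma lin_bimulE m n m' n' (P : 'M_(m', m)) (Q : 'M_(n, n')) (Z : 'M_(m, n)) :
  mxvec Z *m lin_bimul P Q = mxvec (P *m Z *m Q).
Proof. by rewrite mulmxA mul_vec_lin mul_vec_lin. Qed.

Lemma mxvec_ext m n k (M N : 'M[R]_(m * n, k)) :
  (forall Z : 'M_(m, n), mxvec Z *m M = mxvec Z *m N) -> M = N.
Proof.
move=> MN; apply/row_matrixP => i; rewrite !rowE.
by rewrite -(vec_mxK (delta_mx 0 i)) MN.
Qed.

Lemma lin_bimulM m n m1 n1 m2 n2 (P : 'M_(m1, m)) (Q : 'M_(n, n1))
    (P' : 'M_(m2, m1)) (Q' : 'M_(n1, n2)) :
  lin_bimul P Q *m lin_bimul P' Q' = lin_bimul (P' *m P) (Q *m Q').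
Proof. by apply: mxvec_ext => Z; rewrite mulmxA !lin_bimulE !mulmxA. Qed.

Lemma lin_bimul1 m n : lin_bimul (1%:M : 'M_m) (1%:M : 'M_n) = 1%:M.
Proof. by apply: mxvec_ext => Z; rewrite lin_bimulE mul1mx !mulmx1. Qed.

Lemma lin_bimul_trace m n (P : 'M_m) (Q : 'M_n) :
  \tr (lin_bimul P Q) = \tr P * \tr Q.
Proof.
rewrite /mxtrace (reindex _ (curry_mxvec_bij m n)) /=.
transitivity (\sum_(ij : 'I_m * 'I_n)
    lin_bimul P Q (mxvec_index ij.1 ij.2) (mxvec_index ij.1 ij.2)).
  by apply: eq_bigr => -[i j].
rewrite -(pair_bigA _ (fun i j => lin_bimul P Q (mxvec_index i j) (mxvec_index i j))) /=.
rewrite mulr_suml; apply: eq_bigr => i _; rewrite mulr_sumr; apply: eq_bigr => j _.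
have -> : lin_bimul P Q (mxvec_index i j) (mxvec_index i j) =
    row (mxvec_index i j) (lin_bimul P Q) 0 (mxvec_index i j) by rewrite [RHS]mxE.
rewrite rowE -mxvec_delta lin_bimulE mxvecE -(mul_delta_mx (0 : 'I_1)).
by rewrite mulmxA -colE -mulmxA -rowE mxE big_ord1 !mxE.
Qed.

Lemma ghomlat_repr W A :
  mx_repr G (fun x => lin_bimul (W x^-1%g) (A x)).
Proof.
split=> [|x y Gx Gy]; first by rewrite invg1 !repr_mx1 lin_bimul1.
by rewrite lin_bimulM invMg !repr_mxM ?groupV.
Qed.
(** The lattice Hom_R(W, A) under conjugation; its fixed points are the equivariant maps, see
    [homlat_fix]. *)
Definition ghomlat W A : glattice R G := Glattice (MxRepresentation (ghomlat_repr W A)).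

Lemma ghomlatE W A x : ghomlat W A x = lin_bimul (W x^-1%g) (A x). Proof. by []. Qed.

Lemma higman_homlat W A : higman A -> higman (ghomlat W A).
Proof.
move=> [f f1]; exists (lin_bimul 1%:M f).
rewrite /trG -lin_bimul1 -f1 /trG; apply: mxvec_ext => Z.
rewrite lin_bimulE mul1mx mulmx_sumr mulmx_sumr [RHS]linear_sum /=.
apply: eq_bigr => x Gx.
rewrite !lin_bimulM invgK lin_bimulE mul1mx -repr_mxM ?groupV // mulVg repr_mx1.
by rewrite mul1mx.
Qed.

Lemma homlat_iso W W' A A' :
  giso W W' -> giso A A' -> giso (ghomlat W A) (ghomlat W' A').
Proof.
move=> [f [g [hf fg gf]]] [h [k [hh hk kh]]].
exists (lin_bimul g h), (lin_bimul f k).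
rewrite !lin_bimulM fg gf hk kh !lin_bimul1; split=> // x Gx.
rewrite !ghomlatE !lin_bimulM hh //.
by rewrite (ghom_inv hf fg gf) ?groupV.
Qed.

Lemma homlat_fix W A (Z : 'M_(gdeg W, gdeg A)) :
  ghom Z <-> (forall x, x \in G -> mxvec Z *m ghomlat W A x = mxvec Z).
Proof.
split=> [hZ x Gx|hZ x Gx].
  rewrite ghomlatE lin_bimulE -mulmxA -hZ // mulmxA -repr_mxM ?groupV //.
  by rewrite mulVg repr_mx1 mul1mx.
have := hZ x Gx; rewrite ghomlatE lin_bimulE => /(can_inj mxvecK) e.
by rewrite -{1}e !mulmxA -repr_mxM ?groupV // mulgV repr_mx1 mul1mx.
Qed.

End HomLattice.

Lemma gmap_homlat (R S : comUnitRingType) (f : {rmorphism R -> S})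
    (gT : finGroupType) (G : {group gT}) (W A : glattice R G) :
  giso (gmap f (ghomlat W A)) (ghomlat (gmap f W) (gmap f A)).
Proof.
apply: (@giso_eq _ _ _ (gmap f (ghomlat W A)) (ghomlat (gmap f W) (gmap f A)) erefl).
move=> x Gx; rewrite castmx_id gmapE !ghomlatE /lin_bimul map_mxM.
by congr (_ *m _); apply: map_lin_mx => Z; rewrite map_mxM.
Qed.

Section Fixed.
Variables (R : comUnitRingType) (gT : finGroupType) (G : {group gT}).

Definition gnorm (A : glattice R G) : 'M[R]_(gdeg A) := \sum_(x in G) A x.

(** With [N] the norm, [N f N] equals [trG f] times [N], because [N] absorbs translations. Hence
    [f *m gnorm A] is idempotent. *)
Lemma gnormK (A : glattice R G) f : @trG _ _ _ A A f = 1%:M ->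
  gnorm A *m f *m gnorm A = gnorm A.
Proof.
move=> f1; rewrite {1 3}/gnorm -mulmxA mulmx_suml.
transitivity (\sum_(z in G) trG f *m A z); last by apply: eq_bigr => z _; rewrite f1 mul1mx.
rewrite /trG (reindex_inj invg_inj) /=.
under eq_bigl => x do rewrite groupV.
under [RHS]eq_bigr => z _ do rewrite mulmx_suml.
rewrite [RHS]exchange_big /=; apply: eq_bigr => x Gx.
rewrite -mulmx_sumr -!mulmxA; congr (_ *m (_ *m _)).
rewrite mulmx_sumr /gnorm (reindex_inj (mulgI x)) /=.
apply: eq_big => [z|z]; first by rewrite groupMl.
by rewrite groupMl // => Gz; rewrite repr_mxM.
Qed.

Lemma gnorm_fix (A : glattice R G) m f (v : 'M_(m, gdeg A)) :
    @trG _ _ _ A A f = 1%:M -> (forall x, x \in G -> v *m A x = v) ->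
  v = v *m f *m gnorm A.
Proof.
move=> f1 hv; rewrite -{1}[v]mulmx1 -f1 /trG /gnorm !mulmx_sumr.
by apply: eq_bigr => x Gx; rewrite !mulmxA hv ?groupV.
Qed.

Lemma gnormJ (A : glattice R G) x : x \in G -> gnorm A *m A x = gnorm A.
Proof.
move=> Gx; rewrite /gnorm mulmx_suml [RHS](reindex_inj (mulIg x)) /=.
apply: eq_big => [z|z Gz]; first by rewrite groupMr.
by rewrite repr_mxM.
Qed.

Lemma trace_gnorm (A : glattice R G) f : @trG _ _ _ A A f = 1%:M ->
  \sum_(x in G) \tr (A x) = \tr (f *m gnorm A) *+ #|G|.
Proof.
move=> f1; rewrite -sumr_const.
transitivity (\sum_(z in G) \sum_(x in G) \tr (f *m A (x * z * x^-1)%g)).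
  apply: eq_bigr => z Gz; rewrite -[A z in LHS]mulmx1 -f1 /trG mulmx_sumr raddf_sum /=.
  apply: eq_bigr => x Gx; rewrite !mulmxA mxtrace_mulC !mulmxA mxtrace_mulC.
  by rewrite -!repr_mxM ?groupM ?groupV // mulgA.
rewrite exchange_big /=; apply: eq_bigr => x Gx.
rewrite /gnorm mulmx_sumr raddf_sum /= [RHS](reindex_inj (conjg_inj x^-1%g)) /=.
apply: eq_big => [z|z Gz]; first by rewrite groupJr ?groupV.
by rewrite conjgE invgK mulgA.
Qed.

End Fixed.

(** The trace of the idempotent [f *m gnorm A] is the rank of its reduction, which is that of the
    norm. This reads a dimension over the residue field off a character with values in
    characteristic 0. *)
Lemma fix_rank (p : nat) (R : idomainType) (F : fieldType)
    (red : {rmorphism R -> F}) (t : R) (pmt : pmodular p red t)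
    (gT : finGroupType) (G : {group gT}) (A : glattice R G) : higman A ->
  \sum_(x in G) \tr (A x) = (\rank (gnorm (gmap red A)) * #|G|)%:R.
Proof.
move=> [f f1]; rewrite (trace_gnorm f1) natrM mulr_natr; congr (_ *+ _).
set E := f *m gnorm A.
have EE : E *m E = E by rewrite /E -mulmxA (mulmxA (gnorm A)) gnormK.
have [I [S [IS SI]]] := idem_factor pmt EE.
rewrite -SI mxtrace_mulC IS mxtrace1; congr (_%:R).
rewrite /E map_mxM.
have e : map_mx red (gnorm A) = gnorm (gmap red A) by rewrite map_mx_sum.
rewrite e; apply/eqP; rewrite eqn_leq mxrankM_maxr /=.
rewrite -{1}e -(gnormK f1) -mulmxA map_mxM map_mxM e.
exact: mxrankM_maxr.
Qed.

Section HomCount.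
Variables (F : fieldType) (gT : finGroupType) (G : {group gT}).
Implicit Types A B W : glattice F G.

(** For projective [A] the image of the norm on Hom(W, A) consists of all equivariant maps, see
    [homP]; so this is the dimension of their space. *)
Definition hom_dim W A := \rank (gnorm (ghomlat W A)).

Lemma homP W A (Z : 'M[F]_(gdeg W, gdeg A)) : higman A ->
  reflect (ghom Z) (mxvec Z <= gnorm (ghomlat W A))%MS.
Proof.
move=> HA; have [f f1] := cid (higman_homlat W HA).
apply: (iffP idP) => [/submxP[D eD]|hZ].
  by apply/homlat_fix => x Gx; rewrite eD -mulmxA gnormJ.
by rewrite (gnorm_fix f1 (proj1 (homlat_fix Z) hZ)) submxMl.
Qed.

Lemma gnorm_rank_iso A B : giso A B -> \rank (gnorm A) = \rank (gnorm B).
Proof.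
suff h (X Y : glattice F G) : giso X Y -> (\rank (gnorm X) <= \rank (gnorm Y))%N.
  by move=> e; apply/eqP; rewrite eqn_leq !h //; apply: giso_sym.
case=> [f [g [hf fg gf]]].
have -> : gnorm X = f *m gnorm Y *m g.
  rewrite /gnorm mulmx_sumr mulmx_suml; apply: eq_bigr => x Gx.
  by rewrite -hf // -mulmxA fg mulmx1.
by apply: leq_trans (mxrankM_maxl _ _) (mxrankM_maxr _ _).
Qed.

Let partial A B (U : 'M[F]_(gdeg A)) (f : 'M[F]_(gdeg A, gdeg B)) :=
  [/\ mxmodule (grep A) U, ghom f & (U :&: kermx f)%MS = 0].

(** Projective modules of a finite group are injective: with the identity of [B] written as the
    trace of [h], the trace of [f0 *m h] is equivariant and agrees with [f0] on [U]. *)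
Let extend_hom A B (U : 'M[F]_(gdeg A)) (f0 : 'M[F]_(gdeg A, gdeg B)) : higman B ->
    mxmodule (grep A) U ->
    (forall x m (v : 'M_(m, _)), x \in G -> (v <= U)%MS -> v *m A x *m f0 = v *m f0 *m B x) ->
  exists f, ghom f /\ forall m (v : 'M_(m, _)), (v <= U)%MS -> v *m f = v *m f0.
Proof.
move=> [h h1] modU hf0; exists (@trG _ _ _ A B (f0 *m h)); split; first exact: trG_hom.
move=> m v vU; rewrite -[RHS]mulmx1 -h1 /trG !mulmx_sumr; apply: eq_bigr => x Gx.
by rewrite !mulmxA hf0 ?groupV.
Qed.

(** Here [W0] is simple. Some [g : W0 -> B] does not map into [U f]: otherwise Hom(W0, B) would
    embed into the maps from [W0] to [U], a proper subspace of Hom(W0, A) because it misses the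
    inclusion, against the equality of dimensions. By simplicity [g] is injective and its image
    meets [U f] trivially, so [f] on [U] and [g] on [W0] combine into an injection of [U + W0],
    which extends to [A] by injectivity of [B]. *)
Let partial_extend A B (U W0 : 'M[F]_(gdeg A)) (f : 'M[F]_(gdeg A, gdeg B)) :
    higman A -> higman B ->
    (forall W, hom_dim W A = hom_dim W B) ->
    partial U f -> mxmodule (grep A) W0 -> (U :&: W0)%MS = 0 -> W0 != 0 ->
    (forall V : 'M_(gdeg A), mxmodule (grep A) V -> (V <= W0)%MS -> V != 0 ->
       (\rank W0 <= \rank V)%N) ->
  exists U' f', @partial A B U' f' /\ (\rank U < \rank U')%N.
Proof.
move=> HA HB dimE [modU hf Uf0] modW UW W0n minW.
pose Wl : glattice F G := Glattice (submod_repr modW).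
pose i : 'M_(gdeg Wl, gdeg A) := val_submod 1%:M.
have hi : @ghom _ _ _ Wl A i.
  by move=> x Gx; rewrite /i -val_submodJ // -val_submodE mul1mx.
have iW : (i :=: W0)%MS := val_submod1 W0.
have [i' ii'] : exists i', i *m i' = 1%:M.
  by apply/row_freeP; rewrite /row_free iW.
have rUf : \rank (U *m f) = \rank U by apply/mxrank_injP; rewrite Uf0.
have [q hq] : exists q, U *m f *m q = U.
  have [u uU] : exists u : 'M_(\rank U, _), (u :=: U)%MS.
    by exists (row_base U); apply: eq_row_base.
  have : row_free (u *m f) by rewrite /row_free (eqmxMr f uU) rUf.
  case/row_freeP=> q' hq'; exists (q' *m u).
  have /submxP[c ec] : (U <= u)%MS by rewrite uU.
  have : c *m (u *m f *m q') *m u = c *m u by rewrite hq' mulmx1.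
  by rewrite !mulmxA -ec.
have qhom x m (v : 'M_(m, _)) : x \in G -> (v <= U *m f)%MS -> v *m B x *m q = v *m q *m A x.
  move=> Gx /submxP[c ->].
  have /submxP[d ed] := (mxmoduleP modU) x Gx.
  have e1 : U *m f *m B x = d *m U *m f by rewrite -mulmxA -hf // mulmxA ed.
  transitivity (c *m (d *m U)).
    by rewrite -(mulmxA c) e1 -!mulmxA (mulmxA U f q) hq.
  by rewrite -(mulmxA c) hq -mulmxA ed.
have [g [hg gUf]] : exists g, @ghom _ _ _ Wl B g /\ ~~ (g <= U *m f)%MS.
  case: (pselect (exists g, @ghom _ _ _ Wl B g /\ ~~ (g <= U *m f)%MS)) => // nog.
  have allg g : @ghom _ _ _ Wl B g -> (g <= U *m f)%MS.
    by move=> hg; apply/negPn/negP => gn; case: nog; exists g.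
  pose N := gnorm (ghomlat Wl B); pose L := lin_bimul (1%:M : 'M_(gdeg Wl)) q.
  have gq g : @ghom _ _ _ Wl B g -> g *m q *m f = g.
    by move=> /allg/submxP[c ->]; rewrite -!mulmxA (mulmxA U) (mulmxA _ q) hq mulmxA.
  have rN : \rank (N *m L) = \rank N.
    apply/eqP; rewrite eqn_leq mxrankM_maxl /=.
    have {1}-> : N = N *m L *m lin_bimul 1%:M f.
      apply/row_matrixP => k; rewrite -mulmxA lin_bimulM mul1mx row_mul.
      rewrite -[row k N]vec_mxK lin_bimulE mul1mx mulmxA gq //.
      by apply/(homP _ HB); rewrite vec_mxK row_sub.
    exact: mxrankM_maxl.
  have sN : (N *m L <= gnorm (ghomlat Wl A))%MS.
    apply/row_subP => k; rewrite row_mul -[row k N]vec_mxK lin_bimulE mul1mx.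
    have hg : @ghom _ _ _ Wl B (vec_mx (row k N)).
      by apply/(homP _ HB); rewrite vec_mxK row_sub.
    apply/(homP _ HA) => x Gx; rewrite mulmxA hg // -qhom //; exact: allg.
  have : (mxvec i <= N *m L)%MS.
    have : (mxvec i <= gnorm (ghomlat Wl A))%MS by apply/(homP _ HA).
    move/submx_trans; apply.
    by rewrite -(geq_leqif (mxrank_leqif_sup sN)) rN; have := dimE Wl; rewrite /hom_dim => ->.
  case/submxP=> c ec; pose g := vec_mx (c *m N).
  have hg : @ghom _ _ _ Wl B g by apply/(homP _ HB); rewrite vec_mxK submxMl.
  have ig : i = g *m q.
    by apply: (can_inj mxvecK); rewrite ec mulmxA -[c *m N]vec_mxK lin_bimulE mul1mx.
  have : (W0 <= U :&: W0)%MS.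
    rewrite sub_capmx submx_refl andbT -iW ig.
    by have /submxP[e ->] := allg g hg; rewrite -mulmxA hq submxMl.
  by rewrite UW submx0 (negPf W0n).
pose V0 := kermx (g *m cokermx (U *m f)).
have V0P m (z : 'M_(m, _)) : (z <= V0)%MS = (z *m g <= U *m f)%MS.
  by rewrite sub_kermx mulmxA -submxE.
have V00 : V0 = 0.
  pose V := <<V0 *m i>>%MS.
  have VW : (V <= W0)%MS by rewrite genmxE -iW submxMl.
  have modV : mxmodule (grep A) V.
    apply/mxmoduleP => x Gx; rewrite genmxE (eqmxMr _ (genmxE _)).
    rewrite -mulmxA -hi // mulmxA submxMr // V0P -mulmxA hg // mulmxA.
    have : (V0 *m g <= U *m f)%MS by rewrite -V0P.
    case/submxP=> c ->; rewrite -mulmxA -(mulmxA U) -hf // (mulmxA U).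
    by rewrite mulmx_sub // submxMr // (mxmoduleP modU).
  have rV : \rank V = \rank V0.
    rewrite genmxE; apply/eqP; rewrite eqn_leq mxrankM_maxl /=.
    by rewrite -{1}[V0]mulmx1 -ii' mulmxA mxrankM_maxl.
  apply/eqP; rewrite -mxrank_eq0 -rV mxrank_eq0; apply/negPn/negP => Vn.
  have := minW V modV VW Vn; rewrite rV => le.
  have : (1%:M <= V0)%MS by rewrite sub1mx /row_full eqn_leq rank_leq_col.
  by rewrite V0P mul1mx (negPf gUf).
pose f0 := proj_mx U W0 *m f + proj_mx W0 U *m (i' *m g).
have WU : (W0 :&: U)%MS = 0 by rewrite capmxC.
have f0U m (v : 'M_(m, _)) : (v <= U)%MS -> v *m f0 = v *m f.
  move=> vU; rewrite mulmxDr (mulmxA v) (mulmxA v) (proj_mx_id UW vU).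
  by rewrite (proj_mx_0 WU vU) mul0mx addr0.
have f0W m (z : 'M_(m, _)) : z *m i *m f0 = z *m g.
  have zW : (z *m i <= W0)%MS by rewrite -iW submxMl.
  rewrite mulmxDr (mulmxA (z *m i)) (mulmxA (z *m i)) (proj_mx_0 UW zW) mul0mx add0r.
  by rewrite (proj_mx_id WU zW) -mulmxA (mulmxA i) ii' mul1mx.
have modUW : mxmodule (grep A) (U + W0)%MS by apply: addsmx_module.
have [|f' [hf' ef']] := @extend_hom A B (U + W0)%MS f0 HB modUW.
  move=> x m v Gx /sub_addsmxP[[a b] /= ->]; have /submxP[c ec] : (b *m W0 <= i)%MS.
    by rewrite iW submxMl.
  rewrite ec !mulmxDl; congr (_ + _).
    have aU : (a *m U <= U)%MS by apply: submxMl.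
    by rewrite (f0U _ _ aU) (f0U _ _ (mxmodule_trans modU Gx aU)) -!mulmxA hf.
  have -> : c *m i *m A x = c *m Wl x *m i by rewrite -mulmxA -hi // mulmxA.
  rewrite !f0W -[RHS]mulmxA -hg //; apply/esym/mulmxA.
exists (U + W0)%MS, f'; split; last first.
  by rewrite -[X in (X < _)%N]addn0 (mxdirectP _) ?ltn_add2l ?lt0n ?mxrank_eq0 //=; apply/mxdirect_addsP.
split=> //; apply/eqP; rewrite -submx0; apply/rV_subP => v.
rewrite sub_capmx => /andP[vUW /sub_kermxP vf].
move: vf; rewrite ef' //; case/sub_addsmxP: vUW => [[a b] /= ->].
have /submxP[c ec] : (b *m W0 <= i)%MS by rewrite iW submxMl.
rewrite mulmxDl ec f0U ?submxMl // f0W => e0.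
have c0 : c = 0.
  apply/eqP; rewrite -submx0 -V00 V0P.
  have -> : c *m g = - a *m (U *m f).
    by apply/eqP; rewrite mulNmx mulmxA -addr_eq0 addrC e0.
  exact: submxMl.
move: e0; rewrite c0 !mul0mx !addr0 => e0.
by rewrite -Uf0 sub_capmx submxMl; apply/sub_kermxP.
Qed.

(** Take [f] injective on a submodule [U] of maximal rank. By [partial_extend], applied to a
    submodule of least rank among the nonzero ones meeting [U] trivially, there is none; so the
    kernel of [f], which meets [U] trivially, is zero, and the degrees agree. *)
Lemma hom_dim_giso A B : higman A -> higman B -> gdeg A = gdeg B ->
  (forall W, hom_dim W A = hom_dim W B) -> giso A B.
Proof.
move=> HA HB dAB dimE.
pose P r := `[< exists U f, @partial A B U f /\ \rank U = r >].
have P0 : exists r, P r.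
  exists 0%N; apply/asboolP; exists 0, 0; split; last by rewrite mxrank0.
  split; [exact: mxmodule0 | | by rewrite cap0mx].
  by move=> x Gx; rewrite mulmx0 mul0mx.
have Pub r : P r -> (r <= gdeg A)%N.
  by move=> /asboolP[U [f [_ <-]]]; apply: rank_leq_col.
case: (ex_maxnP P0 Pub) => r /asboolP[U [f [[modU hf Uf0] rU]]] maxr.
pose Q k := `[< exists W0 : 'M_(gdeg A), [/\ mxmodule (grep A) W0, (U :&: W0)%MS = 0, W0 != 0 & \rank W0 = k] >].
case: (pselect (exists k, Q k)) => [exQ|noQ].
  case: (ex_minnP exQ) => k /asboolP[W0 [modW UW W0n rW]] mink.
  have [|U' [f' [pf' lt]]] := partial_extend HA HB dimE (And3 modU hf Uf0) modW UW W0n.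
    move=> V modV VW Vn; rewrite rW; apply: mink; apply/asboolP; exists V; split=> //.
    by apply/eqP; rewrite -submx0 -UW capmxS.
  have : P (\rank U') by apply/asboolP; exists U', f'.
  by move/maxr; rewrite -rU leqNgt lt.
have kf : kermx f = 0.
  apply/eqP/negPn/negP => kn; case: noQ; exists (\rank (kermx f)).
  apply/asboolP; exists (kermx f); split=> //.
  apply/mxmoduleP => x Gx; apply/sub_kermxP.
  by rewrite -mulmxA hf // mulmxA mulmx_ker mul0mx.
have rf : row_free f by rewrite -kermx_eq0 kf.
have [g fg] : exists g, f *m g = 1%:M by apply/row_freeP.
have rff : row_full f by rewrite /row_full (eqP rf) dAB.
have [g' g'f] : exists g', g' *m f = 1%:M by apply/row_fullP.
exists f, g; split=> //.
by rewrite -[g]mul1mx -g'f -(mulmxA g') fg mulmx1.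
Qed.

End HomCount.

Section Uniqueness.
Variables (p : nat) (R : idomainType) (F : fieldType).
Variables (red : {rmorphism R -> F}) (t : R) (pmt : pmodular p red t).
Variable gT : finGroupType.

Lemma natr_inj_pm (m n : nat) : m%:R = n%:R :> R -> m = n.
Proof.
wlog le : m n / (m <= n)%N => [h|].
  by case: (leqP m n) => [/h|/ltnW/h h' e]; [apply | rewrite h'].
move=> e; apply/eqP; rewrite eqn_leq le -subn_eq0; apply/eqP/(pm_char0 pmt).
by rewrite natrB // e subrr.
Qed.

Lemma higman_p' (S : comUnitRingType) (G : {group gT}) (A : glattice S G) :
  #|G|%:R \is a @GRing.unit S -> higman A.
Proof.
move=> uG; exists ((#|G|%:R)^-1%:M).
transitivity (\sum_(x in G) (#|G|%:R)^-1%:M : 'M[S]_(gdeg A)).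
  apply: eq_bigr => x Gx; rewrite -scalemx1 -scalemxAr mulmx1 -scalemxAl.
  by rewrite -repr_mxM ?groupV // mulVg repr_mx1.
by rewrite sumr_const -[X in X *+ _]scalemx1 -scaler_nat scalerA mulrV // scale1r.
Qed.

Lemma p'group_unit (G : {group gT}) : p^'.-group G ->
  (#|G|%:R \is a @GRing.unit F) /\ (#|G|%:R \is a @GRing.unit R).
Proof.
move=> p'G; have pF := pm_charp pmt.
suff uF : #|G|%:R != 0 :> F by rewrite unitfE uF (red_unit pmt) rmorph_nat.
by rewrite -(dvdn_pcharf pF) -p'natE //; apply: pcharf_prime pF.
Qed.

Lemma hom_dim_trace (G : {group gT}) (W A B : glattice R G) :
    higman A -> higman B ->
    (forall x, x \in G -> \tr (A x) = \tr (B x)) ->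
  hom_dim (gmap red W) (gmap red A) = hom_dim (gmap red W) (gmap red B).
Proof.
move=> HA HB trAB.
have e C : higman C -> (hom_dim (gmap red W) (gmap red C) * #|G|)%:R =
     \sum_(x in G) \tr (W x^-1%g) * \tr (C x) :> R.
  move=> HC; rewrite /hom_dim -(gnorm_rank_iso (gmap_homlat red W C)).
  rewrite -(fix_rank pmt (higman_homlat W HC)).
  by apply: eq_bigr => x Gx; rewrite lin_bimul_trace.
apply/eqP; rewrite -(eqn_pmul2r (cardG_gt0 G)); apply/eqP/natr_inj_pm.
by rewrite !e //; apply: eq_bigr => x Gx; rewrite trAB.
Qed.

Lemma trace_deg (G : {group gT}) (A B : glattice R G) :
  \tr (A 1%g) = \tr (B 1%g) -> gdeg A = gdeg B.
Proof. by rewrite !repr_mx1 !mxtrace1 => /natr_inj_pm. Qed.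

(** Over a p'-group every lattice is projective and every modular [W] lifts, so [hom_dim_trace]
    covers all [W]. *)
Lemma p'trace_giso (C : {group gT}) (A B : glattice R C) : p^'.-group C ->
    (forall x, x \in C -> \tr (A x) = \tr (B x)) ->
  giso (gmap red A) (gmap red B).
Proof.
move=> p'C trAB; have [uF uR] := p'group_unit p'C.
have dAB := trace_deg (trAB _ (group1 C)).
apply: hom_dim_giso => // [||W]; [exact: higman_p' | exact: higman_p' |].
have HW : higman W by apply: higman_p'.
have [V HV VW] := lift_module pmt HW.
have HA : higman A by apply: higman_p'.
have HB : higman B by apply: higman_p'.
have e X : higman X -> hom_dim W (gmap red X) = hom_dim (gmap red V) (gmap red X).
  by move=> HX; apply/esym/gnorm_rank_iso/homlat_iso; [| apply: giso_refl].
by rewrite !e //; apply: hom_dim_trace.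
Qed.

Lemma gres_homlat (S : comUnitRingType) (G H : {group gT}) (sHG : H \subset G)
    (W A : glattice S G) :
  giso (gres sHG (ghomlat W A)) (ghomlat (gres sHG W) (gres sHG A)).
Proof.
apply: (@giso_eq _ _ _ (gres sHG (ghomlat W A)) (ghomlat (gres sHG W) (gres sHG A)) erefl).
by move=> x Hx; rewrite castmx_id.
Qed.

Lemma gres_iso (S : comUnitRingType) (G H : {group gT}) (sHG : H \subset G)
  (A B : glattice S G) : giso A B -> giso (gres sHG A) (gres sHG B).
Proof.
move=> [f [g [hf fg gf]]]; exists f, g; split=> // x Hx.
by apply: hf; apply: (subsetP sHG).
Qed.

Lemma giso_trace (S : comUnitRingType) (G : {group gT}) (A B : glattice S G) x :
  giso A B -> x \in G -> \tr (A x) = \tr (B x).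
Proof.
move=> [f [g [hf fg gf]]] Gx.
by rewrite -[A x]mulmx1 -fg mulmxA hf // -mulmxA mxtrace_mulC -mulmxA gf mulmx1.
Qed.

(** [MA] and [MB] replace the Hom lattices from a lift of [W], which may not exist. For p-regular
    [x], the restrictions of [A] and [B] to [<[x]>] have isomorphic reductions, hence so have those
    of [MA] and [MB], and the latter isomorphism lifts. *)
Lemma homlat_trace (G : {group gT}) (W : glattice F G) (A B MA MB : glattice R G) :
    higman A -> higman B -> higman MA -> higman MB ->
    giso (gmap red MA) (ghomlat W (gmap red A)) ->
    giso (gmap red MB) (ghomlat W (gmap red B)) ->
    (forall x, x \in G -> p^'.-elt x -> \tr (A x) = \tr (B x)) ->
  forall x, x \in G -> \tr (MA x) = \tr (MB x).
Proof.
move=> HA HB HMA HMB eA eB trAB x Gx.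
have [p'x|px] := boolP (p^'.-elt x); last by rewrite !(singular_trace pmt Gx).
have sxG : <[x]> \subset G by rewrite cycle_subG.
have [uF uR] := p'group_unit p'x.
have e1 : giso (gmap red (gres sxG A)) (gmap red (gres sxG B)).
  apply: p'trace_giso => // y /cycleP[i ->]; apply: trAB; first by rewrite groupX.
  exact: p_eltX.
suff : giso (gres sxG MA) (gres sxG MB).
  by move/giso_trace/(_ (cycle_id x)).
apply: (lift_iso pmt); [exact: higman_p' | exact: higman_p' |].
apply: (giso_trans (gres_iso sxG eA)); apply: giso_trans (giso_sym (gres_iso sxG eB)).
apply: (giso_trans (gres_homlat _ _ _)); apply: giso_trans (giso_sym (gres_homlat _ _ _)).
exact: homlat_iso (giso_refl _) e1.
Qed.

Theorem projective_trace_giso (G : {group gT}) (A B : glattice R G) :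
    higman A -> higman B ->
    (forall x, x \in G -> p^'.-elt x -> \tr (A x) = \tr (B x)) ->
  giso A B.
Proof.
move=> HA HB trAB; apply: (lift_iso pmt) => //.
have dAB := trace_deg (trAB _ (group1 G) (p_elt1 _ _)).
apply: hom_dim_giso => // [||W]; [exact: higman_map | exact: higman_map |].
have [MA HMA eA] := lift_module pmt (higman_homlat W (higman_map red HA)).
have [MB HMB eB] := lift_module pmt (higman_homlat W (higman_map red HB)).
have trM := homlat_trace HA HB HMA HMB eA eB trAB.
rewrite /hom_dim -(gnorm_rank_iso eA) -(gnorm_rank_iso eB).
apply/eqP; rewrite -(eqn_pmul2r (cardG_gt0 G)); apply/eqP/natr_inj_pm.
rewrite -!(fix_rank pmt) //; exact: eq_bigr.
Qed.

End Uniqueness.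

(** * Virtual projective lattices *)

Section GreenBasics.
Variables (R : comUnitRingType) (gT : finGroupType) (G : {group gT}).
Implicit Types (A B : glattice R G) (x y : green R G).

Lemma gclass_iso A B : giso A B -> gclass A = gclass B.
Proof. by move=> AB; congr groth_in; apply/isoclass_piP. Qed.

Lemma gclass0 : gclass (gzero R G) = 0.
Proof.
have := gclassD (gzero R G) (gzero R G); rewrite (gclass_iso (gsum0 _)).
by move/eqP; rewrite -subr_eq subrr eq_sym => /eqP.
Qed.

Definition gchar x (g : gT) : R :=
  let a := generic_quotient.repr x in
  \tr ((generic_quotient.repr a.1 : glattice R G) g) -
  \tr ((generic_quotient.repr a.2 : glattice R G) g).

Lemma gsum_trace A B g : \tr (gsum A B g) = \tr (A g) + \tr (B g).
Proof. exact: mxtrace_block. Qed.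

Lemma giso_tr A B g : giso A B -> g \in G -> \tr (A g) = \tr (B g).
Proof.
move=> [f [h [hf fh hfK]]] Gg.
by rewrite -[A g]mulmx1 -fh mulmxA hf // -mulmxA mxtrace_mulC -mulmxA hfK mulmx1.
Qed.

Lemma gcharE A B g : g \in G -> gchar (gclass A - gclass B) g = \tr (A g) - \tr (B g).
Proof.
move=> Gg; rewrite /gchar; set x := gclass A - gclass B.
set a := generic_quotient.repr x.
set C := generic_quotient.repr a.1; set D := generic_quotient.repr a.2.
have ex : x = gclass C - gclass D by rewrite -[x]reprK groth_piE /gclass !reprK.
have : gclass (gsum A D) = gclass (gsum C B).
  rewrite !gclassD; move: ex; rewrite /x => /eqP.
  by rewrite subr_eq addrAC eq_sym subr_eq => /eqP ->.
case/gclass_eq=> E /giso_tr/(_ Gg); rewrite !gsum_trace => /addIr e.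
by apply/eqP; rewrite subr_eq addrAC eq_sym subr_eq e.
Qed.

Lemma gchar_class A g : g \in G -> gchar (gclass A) g = \tr (A g).
Proof.
by move=> Gg; rewrite -[gclass A]subr0 -gclass0 gcharE // [\tr (gzero R G g)]big_ord0 subr0.
Qed.

Lemma gcharB x y g : g \in G -> gchar (x - y) g = gchar x g - gchar y g.
Proof.
move=> Gg; have [A [B ->]] := gclassP x; have [C [D ->]] := gclassP y.
have -> : gclass A - gclass B - (gclass C - gclass D) =
    gclass (gsum A D) - gclass (gsum C B) :> green R G.
  by rewrite !gclassD opprB opprD !addrA [LHS](AC 4 (1*3*4*2)).
rewrite !gcharE // !gsum_trace; ring.
Qed.

Lemma gchar0 g : g \in G -> gchar 0 g = 0.
Proof. by move=> Gg; rewrite -(subrr 0) gcharB // subrr. Qed.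

Lemma gcharN x g : g \in G -> gchar (- x) g = - gchar x g.
Proof. by move=> Gg; rewrite -sub0r gcharB // gchar0 // sub0r. Qed.

Lemma gcharD x y g : g \in G -> gchar (x + y) g = gchar x g + gchar y g.
Proof. by move=> Gg; rewrite -{1}[y]opprK gcharB // gcharN // opprK. Qed.

Lemma gchar_sum (I : Type) (r : seq I) (P : pred I) (f : I -> green R G) g : g \in G ->
  gchar (\sum_(i <- r | P i) f i) g = \sum_(i <- r | P i) gchar (f i) g.
Proof.
move=> Gg; elim/big_rec2: _ => [|i a b _ <-]; first exact: gchar0.
exact: gcharD.
Qed.

Definition vproj x :=
  exists A B, [/\ projective A, projective B & x = gclass A - gclass B].

Lemma projective_sum A B : projective A -> projective B -> projective (gsum A B).
Proof.
by move=> /projective_higman HA /projective_higman HB; apply/higman_projective/higman_sum.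
Qed.

Lemma vproj_class A : projective A -> vproj (gclass A).
Proof.
move=> PA; exists A, (gzero R G); rewrite gclass0 subr0; split=> //.
exact/higman_projective/higman_zero.
Qed.

Lemma vprojB x y : vproj x -> vproj y -> vproj (x - y).
Proof.
move=> [A [B [PA PB ->]]] [C [D [PC PD ->]]].
exists (gsum A D), (gsum C B); split; try exact: projective_sum.
by rewrite !gclassD opprB opprD !addrA [LHS](AC 4 (1*3*4*2)).
Qed.

Lemma vproj0 : vproj 0.
Proof. by rewrite -gclass0; apply/vproj_class/higman_projective/higman_zero. Qed.

Lemma vprojD x y : vproj x -> vproj y -> vproj (x + y).
Proof.
move=> hx hy; rewrite -[y]opprK; apply: vprojB => //.
by rewrite -sub0r; apply: vprojB => //; apply: vproj0.
Qed.

Lemma vproj_sum (I : finType) (P : pred I) (f : I -> green R G) :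
  (forall i, P i -> vproj (f i)) -> vproj (\sum_(i | P i) f i).
Proof. by move=> hf; elim/big_ind: _ => //; [apply: vproj0 | apply: vprojD]. Qed.

End GreenBasics.

Section VprojUnique.
Variables (p : nat) (R : idomainType) (F : fieldType).
Variables (red : {rmorphism R -> F}) (t : R) (pmt : pmodular p red t).
Variables (gT : finGroupType) (G : {group gT}).

Lemma vproj_eq (x y : green R G) : vproj x -> vproj y ->
  (forall g, g \in G -> p^'.-elt g -> gchar x g = gchar y g) -> x = y.
Proof.
move=> [A [B [PA PB ->]]] [C [D [PC PD ->]]] eq_xy.
suff : gclass (gsum A D) = gclass (gsum C B) :> green R G.
  rewrite !gclassD => e; apply/eqP; rewrite subr_eq addrAC eq_sym subr_eq e //.
apply/gclass_iso/(projective_trace_giso pmt).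
- exact: higman_sum (projective_higman PA) (projective_higman PD).
- exact: higman_sum (projective_higman PC) (projective_higman PB).
move=> g Gg p'g; have := eq_xy g Gg p'g; rewrite !gcharE // !gsum_trace => e.
by apply/eqP; rewrite eq_sym -subr_eq addrAC -e subrK.
Qed.

Lemma vproj_singular (x : green R G) g : vproj x -> g \in G -> ~~ p^'.-elt g -> gchar x g = 0.
Proof.
move=> [A [B [PA PB ->]]] Gg pg.
by rewrite gcharE // !(singular_trace pmt Gg) ?subrr //; apply: projective_higman.
Qed.

End VprojUnique.

Section Glift.
Variables (R : comUnitRingType) (gT hT : finGroupType).
Variables (G : {group gT}) (H : {group hT}) (f : glattice R G -> glattice R H).
Hypothesis fiso : forall A B, giso A B -> giso (f A) (f B).
Hypothesis fsum : forall A B, giso (f (gsum A B)) (gsum (f A) (f B)).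

Lemma glift_gclass A : glift f (gclass A) = gclass (f A).
Proof.
have -> : gclass A = gclass (gsum A A) - gclass A by rewrite gclassD addrK.
by rewrite glift_class // (gclass_iso (fsum _ _)) gclassD addrK.
Qed.

Lemma gliftB x y : glift f (x - y) = glift f x - glift f y.
Proof.
have [A [B ->]] := gclassP x; have [C [D ->]] := gclassP y.
have -> : gclass A - gclass B - (gclass C - gclass D) =
    gclass (gsum A D) - gclass (gsum C B) :> green R G.
  by rewrite !gclassD opprB opprD !addrA [LHS](AC 4 (1*3*4*2)).
rewrite !glift_class // !(gclass_iso (fsum _ _)) !gclassD.
by rewrite opprB opprD !addrA [RHS](AC 4 (1*3*4*2)).
Qed.

End Glift.

Section IndBasics.
Variables (R : comUnitRingType) (gT : finGroupType) (G H : {group gT}).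
Hypothesis sHG : H \subset G.

Lemma Ind_gclass (A : glattice R H) : Ind sHG (gclass A) = gclass (gind sHG A).
Proof. by apply: glift_gclass; [apply: gind_iso | apply: gind_sum]. Qed.

Lemma IndB (x y : green R H) : Ind sHG (x - y) = Ind sHG x - Ind sHG y.
Proof. by apply: gliftB; [apply: gind_iso | apply: gind_sum]. Qed.

Lemma higman_ind (A : glattice R H) : higman A -> higman (gind sHG A).
Proof.
move=> [f f1]; have [i0 _] := ind_repE H (group1 G).
(* A single block suffices: its conjugates reach every diagonal position, where they add up to the
   trace of [f] over [H]. *)
pose Phi : 'M[R]_(\sum_(i < #|rcosets H G|) gdeg A) :=
  \mxblock_(i, j) (if (i == i0) && (j == i0) then f else 0).
exists Phi; rewrite /trG /=.
transitivity (\sum_(x in G)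
    (\mxblock_(j, k) (ind_block A x^-1 j i0 *m f *m ind_block A x i0 k)
       : 'M[R]_(\sum_(i < #|rcosets H G|) gdeg A))).
  apply: eq_bigr => x Gx; rewrite /ind_mx /Phi.
  have -> : \mxblock_(i, j) ind_block A x^-1 i j *m
      \mxblock_(i, j) (if (i == i0) && (j == i0) then f else 0) =
      \mxblock_(i, j) (if j == i0 then ind_block A x^-1 i i0 *m f else 0).
    rewrite mul_mxblock; apply/eq_mxblockP => j l.
    rewrite (bigD1 i0) //= big1 ?addr0 => [|m /negPf mi].
      by rewrite eqxx; case: eqP; rewrite ?mulmx0.
    by rewrite mi mulmx0.
  rewrite mul_mxblock; apply/eq_mxblockP => j k.
  by rewrite (bigD1 i0) //= big1 ?addr0 ?eqxx => // l /negPf ->; rewrite mul0mx.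
rewrite -mxblock_sum -[RHS](mxdiagZ (p_ := fun _ : 'I_#|rcosets H G| => gdeg A)) /mxdiag.
apply/eq_mxblockP => j k; have [<-{k}|jk] := eqVneq j k; last first.
  rewrite big1 // => x Gx; rewrite /ind_block.
  case: ifP => h1; last by rewrite !mul0mx.
  case: ifP => h2; last by rewrite mulmx0.
  case/negP: jk; rewrite -(ind_rep_eq); move: (groupM h1 h2).
  by rewrite !mulgA !mulgKV.
rewrite conform_mx_id -f1 /trG.
have [Gi Gj] := (ind_rep_in sHG i0, ind_rep_in sHG j).
rewrite (reindex_inj (mulgI (ind_rep i0)^-1%g)) (reindex_inj (mulIg (ind_rep j))) /=.
rewrite (bigID (mem H)) /= [X in _ + X]big1 ?addr0 => [|x /andP[_ /negPf Hx]]; last first.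
  by rewrite [X in _ *m X]/ind_block !mulgA mulgV mul1g mulgK Hx mulmx0.
apply: eq_big => [x|x /andP[_ Hx]].
  case Hx: (x \in H); last by rewrite andbF.
  by rewrite andbT groupMl ?groupV // groupMr // (subsetP sHG).
rewrite /ind_block !invMg invgK !mulgA mulgV !mul1g !mulgK groupV.
by rewrite Hx mulgV mul1g Hx.
Qed.

Lemma gind_trace (A : glattice R H) y :
  \tr (gind sHG A y) = \sum_(i < #|rcosets H G|)
    let h := (ind_rep i * y * (ind_rep i)^-1)%g in if h \in H then \tr (A h) else 0.
Proof.
rewrite [LHS]mxtrace_mxblock; apply: eq_bigr => i _; rewrite /ind_block /=.
by case: ifP => // _; rewrite mxtrace0.
Qed.

Lemma gchar_Ind (x : green R H) y : y \in G ->
  gchar (Ind sHG x) y = \sum_(i < #|rcosets H G|)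
    let h := (ind_rep i * y * (ind_rep i)^-1)%g in if h \in H then gchar x h else 0.
Proof.
move=> Gy; have [A [B ->]] := gclassP x; rewrite IndE gcharE // !gind_trace -sumrB.
by apply: eq_bigr => i _ /=; case: ifP => [Hh|_]; rewrite ?gcharE // subr0.
Qed.

Lemma vproj_Ind (x : green R H) : vproj x -> vproj (Ind sHG x).
Proof.
move=> [A [B [/projective_higman HA /projective_higman HB ->]]].
exists (gind sHG A), (gind sHG B).
by split; [exact/higman_projective/higman_ind.. | exact: IndE].
Qed.

Lemma gchar_Ind_eq p (x x' : green R H) :
    (forall h, h \in H -> p^'.-elt h -> gchar x h = gchar x' h) ->
  forall y, y \in G -> p^'.-elt y -> gchar (Ind sHG x) y = gchar (Ind sHG x') y.
Proof.
move=> e y Gy p'y; rewrite !gchar_Ind //; apply: eq_bigr => i _ /=.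
case: ifP => // Hh; apply: e => //.
have -> : (ind_rep i * y * (ind_rep i)^-1 = y ^ (ind_rep i)^-1)%g.
  by rewrite conjgE invgK mulgA.
by rewrite p_eltJ.
Qed.

End IndBasics.

(** * Projective covers of inflated lattices *)

Section Nakayama.
Variables (p : nat) (F : fieldType) (gT : finGroupType) (Q : {group gT}) (n : nat).
Variable (rQ : mx_representation F Q n).
Hypotheses (pF : p \in [pchar F]) (pQ : p.-group Q).

(** By duality: if the annihilator [V] of [U] in the dual module is nonzero, it contains a nonzero
    vector fixed by the p-group [Q]. This vector kills the augmentation part as well as [U], hence
    everything. *)
Lemma pgroup_nakayama (U : 'M[F]_n) : mxmodule rQ U ->
  (1%:M <= U + \sum_(q in Q) (rQ q - 1%:M))%MS -> (1%:M <= U)%MS.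
Proof.
move=> modU full.
have hdual : mx_repr Q (fun q => (rQ q^-1%g)^T).
  split=> [|x y Qx Qy]; first by rewrite invg1 repr_mx1 trmx1.
  by rewrite invMg repr_mxM ?groupV // trmx_mul.
pose rD := MxRepresentation hdual; pose V := kermx U^T.
have VP m (w : 'M_(m, n)) : (w <= V)%MS = (U *m w^T == 0).
  rewrite sub_kermx; apply/eqP/eqP => [e|e].
    by rewrite -[U]trmxK -trmx_mul e trmx0.
  by apply: trmx_inj; rewrite trmx_mul trmxK trmx0.
have modV : mxmodule rD V.
  apply/mxmoduleP => q Qq; rewrite VP trmx_mul trmxK mulmxA.
  have /submxP[D ->] := mxmoduleP modU _ (groupVr Qq).
  have : (V <= V)%MS by []; rewrite VP => /eqP e.
  by rewrite -mulmxA e mulmx0.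
have [V0|Vn] := eqVneq V 0.
  by rewrite sub1mx /row_full -mxrank_tr -/(row_free _) -kermx_eq0 -/V V0.
have fixn : rfix_mx (submod_repr modV) Q != 0.
  by apply: (rfix_pgroup_pchar pF) => //; rewrite lt0n mxrank_eq0.
pose W := val_submod (rfix_mx (submod_repr modV) Q).
have Wn : W != 0 by rewrite val_submod_eq0.
have WV : (W <= V)%MS := val_submodP _.
have Wfix q : q \in Q -> W *m rD q = W.
  by move=> Qq; rewrite /W -val_submodJ // rfix_mx_id.
case/negP: Wn; rewrite -(inj_eq trmx_inj) trmx0 -[W^T]mul1mx.
case/sub_addsmxP: full => [[a b] ->]; rewrite mulmxDl -!mulmxA.
move: WV; rewrite VP => /eqP->; rewrite mulmx0 add0r.
set s := (\sum_(q in Q) _)%MS; have /sub_sumsmxP[u ->] : (s <= s)%MS by [].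
rewrite mulmx_suml mulmx_sumr big1 // => q Qq.
rewrite -(mulmxA (u q)) mulmxBl mul1mx.
have -> : rQ q *m W^T = W^T.
  by have := congr1 trmx (Wfix _ (groupVr Qq)); rewrite trmx_mul {1}/rD /= invgK trmxK.
by rewrite subrr !mulmx0.
Qed.

End Nakayama.

(** This is [pgroup_nakayama] for the zero submodule of the module [U]. *)
Lemma pgroup_stable_eq0 (p : nat) (F : fieldType) (gT : finGroupType) (Q : {group gT})
    (n : nat) (rQ : mx_representation F Q n) (U : 'M[F]_n) :
    p \in [pchar F] -> p.-group Q -> mxmodule rQ U ->
    (U <= \sum_(q in Q) <<U *m (rQ q - 1%:M)>>)%MS -> U = 0.
Proof.
move=> pF pQ modU sU; pose rU := submod_repr modU.
have full : (1%:M <= (0 : 'M_(\rank U)) + \sum_(q in Q) (rU q - 1%:M))%MS.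
  apply: submx_trans (addsmxSr _ _).
  have BU : (val_submod 1%:M :=: U)%MS := val_submod1 U.
  have : (val_submod (1%:M : 'M_(\rank U)) <= \sum_(q in Q) <<U *m (rQ q - 1%:M)>>)%MS.
    by rewrite BU.
  case/sub_sumsmxP => u eu.
  apply/sub_sumsmxP.
  have h q : exists K : 'M_(\rank U), q \in Q ->
      u q *m <<U *m (rQ q - 1%:M)>>%MS = val_submod (K *m (rU q - 1%:M)).
    case Qq : (q \in Q); last by exists 0.
    have : (u q *m <<U *m (rQ q - 1%:M)>>%MS <=
        val_submod (1%:M : 'M_(\rank U)) *m (rQ q - 1%:M))%MS.
      have uG := submxMl (u q) <<U *m (rQ q - 1%:M)>>%MS.
      by apply: (submx_trans uG); rewrite genmxE submxMr // BU.
    case/submxP=> K ->; exists K => _.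
    rewrite mulmxBr mulmx1 -val_submodJ // mul1mx -linearB /=.
    by rewrite [RHS]val_submodE -mulmxA -val_submodE.
  exists (fun q => sval (cid (h q))); apply: (val_submod_inj (U := U)).
  by rewrite eu linear_sum; apply: eq_bigr => q Qq; case: cid => K /= ->.
have := pgroup_nakayama pF pQ (mxmodule0 _ _) full.
by rewrite submx0 => /eqP/(congr1 (@mxrank _ _ _)); rewrite mxrank1 mxrank0 => /eqP; rewrite mxrank_eq0 => /eqP.
Qed.

(* [L] stands for a module [Lbar] of [N / Q] blown up to [N]: [pi] is reduction
   modulo the augmentation ideal of [Q], [sg] a section of it. *)
Definition blowup (R : comUnitRingType) (gT : finGroupType) (N Q : {group gT})
    (nQN : N \subset 'N(Q)) (L : glattice R N) (L' : glattice R (N / Q)%G) : Prop :=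
  exists (pi : 'M[R]_(gdeg L, gdeg L')) (tau sg : 'M[R]_(gdeg L', gdeg L))
         (M : gT -> 'M[R]_(gdeg L)),
  [/\ @ghom _ _ _ L (ginf nQN L') pi, pi *m tau = \sum_(q in Q) L q,
      tau *m pi = #|Q|%:R%:M, sg *m pi = 1%:M &
      1%:M - pi *m sg = \sum_(q in Q) M q *m (L q - 1%:M)].

Section Blowup.
Variables (R : comUnitRingType) (gT : finGroupType) (N Q : {group gT}).
Hypotheses (nQN : N \subset 'N(Q)) (sQN : Q \subset N).

Lemma blowup_zero : blowup nQN (gzero R N) (gzero R (N / Q)%G).
Proof. by exists 0, 0, 0, (fun=> 0); split=> [x Nx||||]; apply/matrixP=> -[]. Qed.

Lemma blowup_sum (A B : glattice R N) (A' B' : glattice R (N / Q)%G) :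
  blowup nQN A A' -> blowup nQN B B' -> blowup nQN (gsum A B) (gsum A' B').
Proof.
move=> [pA [tA [sA [MA [hA ptA tpA spA kA]]]]] [pB [tB [sB [MB [hB ptB tpB spB kB]]]]].
have sumE (I : finType) (P : pred I) m n m' n' (f : I -> 'M[R]_(m, n)) (g : I -> 'M[R]_(m', n')) :
    \sum_(i | P i) block_mx (f i) 0 0 (g i) = block_mx (\sum_(i | P i) f i) 0 0 (\sum_(i | P i) g i).
  elim/big_rec3: _ => [|i M1 M2 M3 _ ->]; first by rewrite block_mx0.
  by rewrite add_block_mx !addr0.
exists (block_mx pA 0 0 pB), (block_mx tA 0 0 tB), (block_mx sA 0 0 sB),
  (fun q => block_mx (MA q) 0 0 (MB q)).
split=> [x Nx||||].
- have -> : gsum A B x = block_mx (A x) 0 0 (B x) by [].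
  have -> : ginf nQN (gsum A' B') x = block_mx (ginf nQN A' x) 0 0 (ginf nQN B' x) by [].
  by rewrite !mulmx_block ?(mulmx0, mul0mx, addr0, add0r) hA // hB.
- by rewrite mulmx_block ?(mulmx0, mul0mx, addr0, add0r) ptA ptB -sumE.
- by rewrite mulmx_block ?(mulmx0, mul0mx, addr0, add0r) tpA tpB -scalar_mx_block.
- by rewrite mulmx_block ?(mulmx0, mul0mx, addr0, add0r) spA spB -scalar_mx_block.
rewrite mulmx_block ?(mulmx0, mul0mx, addr0, add0r).
have e1 : (1%:M : 'M[R]_(gdeg (gsum A B))) = block_mx 1%:M 0 0 1%:M.
  exact: scalar_mx_block.
rewrite e1 opp_block_mx add_block_mx !oppr0 !addr0 kA kB -sumE.
apply: eq_bigr => q Qq; have -> : gsum A B q = block_mx (A q) 0 0 (B q) by [].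
rewrite opp_block_mx add_block_mx !oppr0 !addr0 mulmx_block.
by rewrite ?(mulmx0, mul0mx, addr0, add0r).
Qed.

(** [pi] is the map of group rings from [N] to [N / Q], its transpose sends a coset to the sum of
    its elements, and [sg] sends it to a representative. If [k] represents the coset of [x = k q],
    then [x - k = k (q - 1)]; so [M q] sends such an [x] to [k]. *)
Lemma blowup_regular : blowup nQN (gregular R N) (gregular R (N / Q)%G).
Proof.
pose e (i : 'I_#|N|) : coset_of Q := coset Q (enum_val i).
pose r (j : 'I_#|(N / Q)%G|) : gT := fingroup.repr (enum_val j : coset_of Q).
have nQ x : x \in N -> x \in 'N(Q) by apply: (subsetP nQN).
have eN i : e i \in (N / Q)%g by apply: mem_quotient; apply: enum_valP.
have rP j : r j \in N /\ coset Q (r j) = enum_val j.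
  have /morphimP[x Qx Nx ej] := enum_valP j; rewrite /r ej.
  split; last by rewrite coset_reprK.
  have : fingroup.repr (coset Q x) \in (Q :* x)%g.
    by rewrite -val_coset // mem_repr_coset.
  by case/rcosetP => q Qq ->; rewrite groupM // (subsetP sQN).
have gi x : x \in N -> enum_val (gring_index N x) = x by apply: gring_indexK.
have gi' (x : coset_of Q) : x \in (N / Q)%g -> enum_val (gring_index (N / Q)%G x) = x.
  by apply: (gring_indexK (G := (N / Q)%G)).
have cosetQ x y : x \in N -> y \in N -> (coset Q x == coset Q y) = ((x^-1 * y)%g \in Q).
  move=> Nx Ny; apply/eqP/idP => [exy|Qxy].
    by apply: coset_idr; rewrite ?morphM ?morphV ?groupM ?groupV ?nQ //= exy mulVg.
  have -> : y = (x * (x^-1 * y))%g by rewrite mulKVg.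
  by rewrite morphM ?nQ ?groupM ?groupV //= (coset_id Qxy) mulg1.
pose pi : 'M[R]_(#|N|, #|(N / Q)%G|) := \matrix_(i, j) (e i == enum_val j)%:R.
pose sg : 'M[R]_(#|(N / Q)%G|, #|N|) := \matrix_(j, i) (enum_val i == r j)%:R.
pose k (i : 'I_#|N|) : gT := r (gring_index (N / Q)%G (e i)).
have kN i : k i \in N by case: (rP (gring_index (N / Q)%G (e i))).
have kE i : coset Q (k i) = e i by case: (rP (gring_index (N / Q)%G (e i))) => _; rewrite gi'.
have kQ i : ((k i)^-1 * enum_val i)%g \in Q.
  by rewrite -cosetQ ?enum_valP // kE.
pose M q : 'M[R]_#|N| := \matrix_(i, l) ((enum_val l == k i) && (enum_val i == k i * q)%g)%:R.
have regE (x : gT) i l : x \in N -> gregular R N x i l = (enum_val i * x == enum_val l)%g%:R.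
  move=> Nx; rewrite /= !mxE /= eq_sym -(inj_eq (can_inj (@gring_valK _ N))) gi //.
  by rewrite groupM ?enum_valP.
have regE' (x : coset_of Q) i l : x \in (N / Q)%g ->
    gregular R (N / Q)%G x i l = (enum_val i * x == enum_val l)%g%:R.
  move=> Nx; rewrite /= !mxE /= eq_sym -(inj_eq (can_inj (@gring_valK _ (N / Q)%G))) gi' //.
  by rewrite groupM ?enum_valP.
have QN q : q \in Q -> q \in N by apply: (subsetP sQN).
exists pi, pi^T, sg, M; split.
- move=> x Nx; apply/matrixP => i j; rewrite [LHS]mxE [RHS]mxE.
  have Nix : (enum_val i * x)%g \in N by rewrite groupM ?enum_valP.
  rewrite (bigD1 (gring_index N (enum_val i * x)%g)) //= big1 ?addr0 => [|l li]; last first.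
    rewrite [X in X * _](regE x) //; case: eqP => [il|]; last by rewrite mul0r.
    by case/eqP: li; rewrite il gring_valK.
  rewrite [X in X * _](regE x) // gi // eqxx mul1r mxE /e gi //.
  rewrite (bigD1 (gring_index (N / Q)%G (e i))) //= big1 ?addr0 => [|l li]; last first.
    rewrite !mxE; case: eqP => [il|]; last by rewrite mul0r.
    by case/eqP: li; rewrite il gring_valK.
  rewrite !mxE gi' // eqxx mul1r.
  rewrite -(inj_eq (can_inj (@gring_valK _ (N / Q)%G))) gi' // ?groupM ?mem_quotient ?enum_valP //.
  by rewrite morphM ?nQ ?enum_valP //= eq_sym.
- apply/matrixP => i l; rewrite [LHS]mxE summxE.
  transitivity ((e i == e l)%:R : R).
    rewrite (bigD1 (gring_index (N / Q)%G (e i))) //= big1 ?addr0 => [|j ji]; last first.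
      rewrite !mxE; case: eqP => [ij|]; last by rewrite mul0r.
      by case/eqP: ji; rewrite ij gring_valK.
    by rewrite !mxE gi' // eqxx mul1r eq_sym.
  rewrite cosetQ ?enum_valP //.
  under eq_bigr => q Qq do rewrite (regE q _ _ (QN q Qq)).
  case Qil: (_ \in Q).
    rewrite (bigD1 _ Qil) /= mulKVg eqxx big1 ?addr0 // => q /andP[_ qil].
    by case: eqP => // ql; case/eqP: qil; rewrite -ql mulKg.
  by rewrite big1 // => q Qq; case: eqP => // ql; rewrite -ql mulKg Qq in Qil.
- apply/matrixP => j j'; rewrite [LHS]mxE [RHS]mxE.
  under eq_bigr => i _ do rewrite !mxE.
  have [<-|jj'] := eqVneq j j'; last first.
    rewrite mulr0n; apply: big1 => i _.
    case: eqP => [ei|]; last by rewrite mul0r.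
    by rewrite ei (inj_eq enum_val_inj) (negPf jj') mulr0.
  rewrite mulr1n -sumr_const.
  transitivity (\sum_(i < #|N|) (e i == enum_val j)%:R : R).
    by apply: eq_bigr => i _; case: eqP; rewrite ?mulr1 ?mulr0.
  have [rN rE] := rP j.
  have rx x : x \in N -> (coset Q (r j * x)%g == enum_val j) = (x \in Q).
    by move=> Nx; rewrite -[X in _ == X]rE eq_sym cosetQ ?mulKg // groupM.
  rewrite -(big_enum_val (fun x => (coset Q x == enum_val j)%:R)).
  rewrite (reindex_inj (mulgI (r j))) /= (bigID (mem Q)) /= [X in _ + X]big1 ?addr0; last first.
    by move=> x /andP[]; rewrite groupMl // => Nx Qx; rewrite rx // (negPf Qx).
  apply: eq_big => [x|x /andP[_ Qx]].
    by rewrite groupMl //; case Qx: (x \in Q); rewrite ?andbF // QN.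
  by rewrite rx ?QN // Qx.
- apply/matrixP => j j'; rewrite [LHS]mxE; have [rN rE] := rP j.
  rewrite (bigD1 (gring_index N (r j))) //= big1 ?addr0 => [|l lj]; last first.
    rewrite !mxE; case: eqP => [ij|]; last by rewrite mul0r.
    by case/eqP: lj; rewrite -ij gring_valK.
  by rewrite !mxE gi // eqxx mul1r /e gi // rE (inj_eq enum_val_inj).
apply/matrixP => i l; rewrite summxE.
have -> : (1%:M - pi *m sg) i l = (enum_val i == enum_val l)%:R - (enum_val l == k i)%:R.
  rewrite [LHS]mxE [X in X + _]mxE [X in _ + X]mxE [X in _ - X = _]mxE.
  rewrite (inj_eq enum_val_inj); congr (_ - _).
    rewrite (bigD1 (gring_index (N / Q)%G (e i))) //= big1 ?addr0 => [|j ji]; last first.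
      rewrite !mxE; case: eqP => [ij|]; last by rewrite mul0r.
      by case/eqP: ji; rewrite ij gring_valK.
    by rewrite !mxE gi' // eqxx mul1r.
rewrite (bigD1 _ (kQ i)) /= big1 ?addr0 => [|q /andP[Qq qi]]; last first.
  rewrite mxE big1 // => a _; rewrite mxE; case: andP => [[_ /eqP iq]|]; last by rewrite mul0r.
  by case/eqP: qi; rewrite iq mulKg.
rewrite mxE (bigD1 (gring_index N (k i))) //= big1 ?addr0 => [|a ai]; last first.
  rewrite mxE; case: eqP => [ij|]; last by rewrite mul0r.
  by case/eqP: ai; rewrite -ij gring_valK.
rewrite [X in X * _]mxE gi // eqxx mulKVg eqxx mul1r.
rewrite [RHS]mxE [X in _ = X + _]regE ?QN // gi // mulKVg.
rewrite [X in _ = _ + X]mxE [X in _ = _ - X]mxE -(inj_eq enum_val_inj) gi //.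
by rewrite (eq_sym (k i)).
Qed.

Lemma blowup_free n : blowup nQN (gfree R N n) (gfree R (N / Q)%G n).
Proof.
elim: n => [|n IHn]; first exact: blowup_zero.
exact: blowup_sum blowup_regular IHn.
Qed.

End Blowup.

Lemma rank_stable (F : fieldType) n (D : 'M[F]_n) :
  exists k, (iter k (mulmx D) 1%:M <= iter k.+1 (mulmx D) 1%:M)%MS.
Proof.
pose U k := iter k (mulmx D) 1%:M.
have UD k : U k.+1 = U k *m D.
  elim: k => [|k IH]; first by rewrite /U /= mulmx1 mul1mx.
  by change (D *m U k.+1 = D *m U k *m D); rewrite IH mulmxA.
case: (pselect (exists k, (U k <= U k.+1)%MS)) => // no; exfalso.
have lt k : (\rank (U k.+1) < \rank (U k))%N.
  have sub : (U k.+1 <= U k)%MS.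
    by elim: k {no} => [|k IH]; [rewrite submx1 | rewrite (UD k.+1) {2}(UD k) submxMr].
  rewrite ltn_neqAle mxrankS // andbT; apply/negP => /eqP e.
  by apply: no; exists k; rewrite -(geq_leqif (mxrank_leqif_sup sub)) e.
have h k : (\rank (U k) + k <= n)%N.
  elim: k => [|k IH]; first by rewrite addn0 rank_leq_col.
  by rewrite addnS -addSn; apply: leq_trans IH; rewrite leq_add2r.
by have := h n.+1; rewrite addnS ltnNge leq_addl.
Qed.

Section PregularCoset.
Variables (p : nat) (gT : finGroupType) (Q : {group gT}) (y : gT).
Hypotheses (pQ : p.-group Q) (nQy : y \in 'N(Q)) (p'y : p^'.-elt y).

(** In [Q <[y]>] both [<[z]>] and [<[y]>] are complements of [Q], so Schur-Zassenhaus makes them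
    conjugate under [Q]. The conjugate of [z] in [<[y]>] is still in the coset of [y], and [Q] meets
    [<[y]>] trivially. *)
Lemma pregular_coset z : ((z * y^-1)%g \in Q) && p^'.-elt z = (z \in y ^: Q).
Proof.
apply/andP/imsetP => [[Qzy p'z]|[q Qq ->]]; last first.
  rewrite p_eltJ; split=> //.
  have -> : (y ^ q * y^-1 = q^-1 * q ^ y^-1)%g by rewrite !conjgE invgK !mulgA.
  by rewrite groupM ?groupV // memJ_norm ?groupV.
have nQz : z \in 'N(Q) by rewrite -(mulgKV y z) groupM // (subsetP (normG Q)).
have sz : <[z]> \subset (Q * <[y]>)%g.
  rewrite -norm_joinEr ?cycle_subG // -(mulgKV y z) groupM //=.
    by rewrite mem_gen // inE Qzy.
  by rewrite mem_gen // inE cycle_id orbT.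
have cosetE : coset Q z = coset Q y.
  apply/eqP; rewrite eq_mulgV1; apply/eqP.
  by rewrite -(coset_id Qzy) morphM ?groupV // morphV.
have ordE (w : gT) : w \in 'N(Q) -> p^'.-elt w -> #[w] = #[coset Q w].
  move=> nQw p'w; rewrite !orderE -morphim_cycle //.
  rewrite card_quotient ?cycle_subG // -divgI setIC coprime_TIg ?cards1 ?divn1 //.
  by rewrite (pnat_coprime pQ).
have oz : #|<[z]>| = #|<[y]>| by rewrite -!orderE (ordE z) // (ordE y) // cosetE.
have [|||q Qq e] := @SchurZassenhaus_trans_sol _ Q <[y]>%G <[z]>%G _ _ sz _ oz.
- exact: nilpotent_sol (pgroup_nil pQ).
- by rewrite cycle_subG.
- exact: pnat_coprime pQ p'y.
exists q => //; apply: (canRL (conjgKV q)).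
have yw : (z ^ q^-1)%g \in <[y]> by rewrite -mem_conjg -e cycle_id.
have Qw : (z ^ q^-1 * y^-1)%g \in Q.
  have -> : (z ^ q^-1 * y^-1 = q * (z * y^-1) * (y * q^-1 * y^-1))%g.
    by rewrite conjgE invgK !mulgA mulgKV.
  have -> : (y * q^-1 * y^-1 = q^-1 ^ y^-1)%g by rewrite conjgE invgK mulgA.
  by rewrite (groupM (groupM Qq Qzy)) // memJ_norm groupV.
have /setP/(_ (z ^ q^-1 * y^-1)%g) := coprime_TIg (pnat_coprime pQ p'y).
rewrite inE Qw groupM ?groupV ?cycle_id // !inE => /esym/eqP e1.
by apply/eqP; rewrite eq_mulgV1 e1.
Qed.

End PregularCoset.

Section Covers.
Variables (p : nat) (R : idomainType) (F : fieldType).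
Variables (red : {rmorphism R -> F}) (t : R) (pmt : pmodular p red t).
Variables (gT : finGroupType) (N Q : {group gT}).
Hypotheses (nQN : N \subset 'N(Q)) (sQN : Q \subset N) (pQ : p.-group Q).

(* Endomorphisms of [L] vanishing on the quotient by the augmentation ideal of [Q]
   are nilpotent modulo the maximal ideal. *)
Lemma augmentation_nilpotent (L : glattice R N) (K : gT -> 'M[R]_(gdeg L)) D :
    @ghom _ _ _ L L D -> D = \sum_(q in Q) K q *m (L q - 1%:M) ->
  exists k C, iter k (mulmx D) 1%:M = t *: C.
Proof.
move=> hD eD; pose D' := map_mx red D; have [k sk] := rank_stable D'.
have iterE l : map_mx red (iter l (mulmx D) 1%:M) = iter l (mulmx D') 1%:M.
  by elim: l => [|l IH]; rewrite /= ?map_mx1 // map_mxM IH.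
exists k; apply: (red_mx0 pmt); rewrite iterE; set U := iter k _ _ in sk *.
pose rQ := subg_repr (grep (gmap red L)) sQN.
have hU x : x \in N -> gmap red L x *m U = U *m gmap red L x.
  move=> Nx; rewrite /U; elim: (k) => [|l IH]; first by rewrite mulmx1 mul1mx.
  by rewrite iterS mulmxA (ghom_map red hD Nx) -[LHS]mulmxA IH mulmxA.
apply: (@pgroup_stable_eq0 p F gT Q _ rQ U (pm_charp pmt) pQ).
  apply/mxmoduleP => q Qq; have := hU q (subsetP sQN _ Qq); rewrite /= => <-.
  exact: submxMl.
apply: (submx_trans sk); rewrite /= -/U /D' eD map_mx_sum mulmx_suml.
apply: summx_sub_sums => q Qq; rewrite genmxE map_mxM map_mxB map_mx1 -mulmxA.
rewrite [X in _ *m X]mulmxBl mul1mx.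
have := hU q (subsetP sQN _ Qq); rewrite !gmapE => ->.
by rewrite -{2}[U]mulmx1 -mulmxBr submxMl.
Qed.

(** The hypothesis puts the kernel of [f] into the augmentation part of [Q]. If [V] and this kernel
    generate [P], then modulo [t] the [Q]-span of [V] is everything by [pgroup_nakayama]; so [V]
    contains the rows of a matrix [W] that reduces to the identity, and [W] is invertible. *)
Lemma superfluous_augmentation (P : glattice R N) n (f : 'M[R]_(gdeg P, n))
    (K : gT -> 'M[R]_(gdeg P) -> 'M[R]_(gdeg P)) :
    (forall M : 'M_(gdeg P), M *m f = 0 -> M = \sum_(q in Q) K q M *m (P q - 1%:M)) ->
  @superfluous _ _ N P (fun u => u *m f = 0).
Proof.
move=> hK V [V0 Vlin Vact] full.
have rowV m (a : 'rV_m) (M : 'M[R]_(m, gdeg P)) : (forall i, V (row i M)) -> V (a *m M).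
  move=> hM; rewrite mulmx_sum_row; elim/big_rec: _ => // i w _ Vw; exact: Vlin.
(* [V] is only a predicate; [Vm] collects one element of [V] for each basis vector, congruent to it
   modulo the kernel of [f]. *)
have [Vm hV eV] : exists2 Vm : 'M[R]_(gdeg P), (forall i, V (row i Vm)) & (1%:M - Vm) *m f = 0.
  pose v i := sval (cid (full (row i 1%:M))).
  have hv i : exists v', [/\ (v i) *m f = 0, V v' & row i 1%:M = v i + v'].
    by rewrite /v; case: cid.
  exists (\matrix_i sval (cid (hv i))).
    by move=> i; rewrite rowK; case: cid => w [].
  apply/row_matrixP => i; rewrite row_mul linearB /= rowK row0.
  by have [vf _ e] := svalP (cid (hv i)); rewrite {1}e addrK.
pose rQ := subg_repr (grep (gmap red P)) sQN.
pose Vb := map_mx red Vm.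
pose U := (\sum_(x in Q) <<Vb *m rQ x>>)%MS.
have modU : mxmodule rQ U.
  apply/mxmoduleP => x Qx; rewrite /U sumsmxMr; apply/sumsmx_subP => z Qz.
  rewrite (eqmxMr _ (genmxE _)) -mulmxA -repr_mxM //.
  by rewrite (sumsmx_sup (z * x)%g) ?groupM // genmxE.
have : (1%:M <= U)%MS.
  apply: (pgroup_nakayama (pm_charp pmt) pQ modU).
  rewrite -[1%:M in X in (X <= _)%MS](subrK Vb) addrC addmx_sub_adds //.
    by rewrite (sumsmx_sup 1%g) // genmxE repr_mx1 mulmx1.
  have -> : 1%:M - Vb = map_mx red (1%:M - Vm) by rewrite map_mxB map_mx1.
  rewrite (hK _ eV) map_mx_sum; apply: summx_sub_sums => q Qq.
  by rewrite map_mxM map_mxB map_mx1 submxMl.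
case/sub_sumsmxP => u eu.
have hc x : exists c : 'M[R]_(gdeg P), u x *m <<Vb *m rQ x>>%MS = map_mx red c *m (Vb *m rQ x).
  have /submxP[c' ec'] : (<<Vb *m rQ x>> <= Vb *m rQ x)%MS by rewrite genmxE.
  by have [c ec] := lift_mx pmt (u x *m c'); exists c; rewrite ec -mulmxA -ec'.
pose W := \sum_(x in Q) sval (cid (hc x)) *m (Vm *m P x).
have redW : map_mx red W = 1%:M.
  rewrite eu map_mx_sum; apply: eq_bigr => x Qx; rewrite !map_mxM.
  exact: esym (svalP (cid (hc x))).
have uW : W \in unitmx by rewrite (red_mx_unit pmt) // redW unitmx1.
move=> w; rewrite -[w]mulmx1 -(mulVmx uW) mulmxA; apply: (rowV) => i.
rewrite linear_sum /=; elim/big_rec: _ => // x a Qx Va.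
rewrite -[row i _]scale1r; apply: Vlin => //; rewrite row_mul mulmxA.
by apply: Vact; [apply: (subsetP sQN) | apply: rowV].
Qed.

(** [A] is the image of an idempotent [e] of a free lattice [L'] of [N / Q]. Projectivity gives an
    endomorphism [X] above [e] of the free lattice [L] of [N]. Its defect [X^2 - X] vanishes in
    [L'], so it is nilpotent modulo [t], and the cover is the image of the resulting idempotent
    [E]. *)
Theorem cover_exists (A : glattice R (N / Q)%G) : projective A ->
  exists P : glattice R N, projective_cover P (ginf nQN A) /\
    forall y, y \in N -> p^'.-elt y ->
      \tr (P y) = #|'C_Q[y]|%:R * \tr (A (coset Q y)).
Proof.
move=> [n [i [s [hi hs is1]]]].
have [pi [tau [sg [M [hpi pt tp sp kpi]]]]] := blowup_free R nQN sQN n.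
set L' := gfree R (N / Q)%G n in i s hi hs is1 pi tau sg hpi tp sp kpi pt *.
set L := gfree R N n in pi tau sg M hpi tp sp kpi pt *.
have [phi phi1] : higman L := higman_free _ _ _.
have [e eE] : exists e, e = s *m i by eexists.
have he : @ghom _ _ _ L' L' e by rewrite eE; apply: ghomM hs hi.
have he' : @ghom _ _ _ (ginf nQN L') (ginf nQN L') e.
  by move=> x Nx; apply: he; apply: mem_quotient.
pose X := @trG _ _ _ L L (phi *m (pi *m e *m sg)).
have hX : @ghom _ _ _ L L X by apply: trG_hom.
have Xpi : X *m pi = pi *m e.
  have hpe : @ghom _ _ _ L (ginf nQN L') (pi *m e) := ghomM hpi he'.
  transitivity (@trG _ _ _ L (ginf nQN L') (phi *m (pi *m e *m sg) *m pi)).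
    exact: (@trG_mulr _ _ _ L L (ginf nQN L')).
  rewrite -!mulmxA sp mulmx1 -(@trG_mulr _ _ _ L L (ginf nQN L')) //.
  by rewrite phi1 mul1mx.
have ee : e *m e = e by rewrite eE mulmxA -(mulmxA s) is1 mulmx1.
pose D := X *m X - X.
have hD : @ghom _ _ _ L L D := ghomB (ghomM hX hX) hX.
have Dpi : D *m pi = 0.
  by rewrite /D mulmxBl -mulmxA Xpi mulmxA Xpi -mulmxA ee subrr.
have augm m (B : 'M_(m, gdeg L)) : B *m pi = 0 -> B = \sum_(q in Q) (B *m M q) *m (L q - 1%:M).
  move=> Bp; transitivity (B *m (1%:M - pi *m sg)).
    by rewrite mulmxBr mulmx1 mulmxA Bp mul0mx subr0.
  by rewrite kpi mulmx_sumr; apply: eq_bigr => q Qq; rewrite mulmxA.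
have [k [C hC]] := augmentation_nilpotent hD (augm _ D Dpi).
have [W [cW EE]] := idem_lift pmt hC.
set E := X + _ in EE.
have hW : @ghom _ _ _ L L W by move=> x Nx; apply: cW; apply: hX.
have hE : @ghom _ _ _ L L E := ghomD hX (ghomM hD hW).
have Epi : E *m pi = pi *m e.
  rewrite /E -/D (mulmxDl X (D *m W) pi) Xpi.
  have DW : D *m W = W *m D by apply: cW; rewrite /D mulmxBl mulmxBr mulmxA.
  by rewrite DW -mulmxA Dpi mulmx0 addr0.
have [I [S [IS SI]]] := idem_factor pmt EE.
move: (\rank _) I S IS SI => r I S IS SI.
have [|rP [hI hS]] := @retract_lattice _ _ _ L r I S IS; first by rewrite SI.
pose P := Glattice rP; exists P.
have HL : higman L by exists phi.
pose f := I *m pi *m s.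
have hf : @ghom _ _ _ P (ginf nQN A) f.
  apply: (@ghomM _ _ _ P (ginf nQN L') (ginf nQN A)); first exact: ghomM hI hpi.
  by move=> x Nx; apply: hs; apply: mem_quotient.
split.
  split; first exact/higman_projective/(higman_retract hI hS IS HL).
  exists f; split=> // [v|].
    exists (v *m i *m sg *m S); rewrite /f !mulmxA -(mulmxA _ S I) SI.
    rewrite -(mulmxA _ E) Epi !mulmxA -(mulmxA _ sg) sp mulmx1 eE ?mulmxA.
    by rewrite -(mulmxA v i s) is1 mulmx1 -mulmxA is1 mulmx1.
  apply: (@superfluous_augmentation P _ f (fun q B => B *m I *m M q *m S)) => B Bf.
  have BIp : B *m I *m pi = 0.
    have IE : I = I *m E by rewrite -SI mulmxA IS mul1mx.
    rewrite {1}IE -!mulmxA Epi eE ?mulmxA.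
    by move: Bf; rewrite /f !mulmxA => ->; rewrite mul0mx.
  transitivity (B *m I *m S); first by rewrite -mulmxA IS mulmx1.
  rewrite {1}(augm _ _ BIp) mulmx_suml; apply: eq_bigr => q Qq.
  rewrite -!mulmxA; do 3!congr (_ *m _); rewrite mulmxBl mulmxBr mul1mx mulmx1.
  by rewrite (hS q) ?(subsetP sQN).
move=> y Ny p'y; have nQy := subsetP nQN y Ny.
have trP z : z \in N -> \tr (P z) = \tr (E *m L z).
  move=> Nz; rewrite -SI -mulmxA mxtrace_mulC -(hI z Nz).
  by rewrite -mulmxA IS mulmx1.
(* [tau *m pi] is multiplication by [|Q|] while [pi *m tau] is the sum of the [L q]; exchanging them
   under the trace passes from [A] to [P]. *)
have trA : #|Q|%:R * \tr (A (coset Q y)) = \sum_(q in Q) \tr (P (q * y)%g).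
  have Ay : coset Q y \in (N / Q)%G by apply: mem_quotient.
  transitivity (\tr (L' (coset Q y) *m e *m tau *m pi)).
    rewrite -mulmxA tp -scalemx1 -scalemxAr mulmx1 mxtraceZ eE mulmxA hs //.
    by rewrite -mulmxA [X in _ = _ * X]mxtrace_mulC -mulmxA is1 mulmx1.
  rewrite mxtrace_mulC !mulmxA -(hpi y Ny) -!mulmxA (mulmxA pi) -Epi -!mulmxA pt.
  rewrite !mulmx_sumr raddf_sum /=; apply: eq_bigr => q Qq.
  have Nq := subsetP sQN _ Qq.
  transitivity (\tr (E *m L (q * y)%g)); last by rewrite -trP ?groupM.
  by rewrite repr_mxM // mxtrace_mulC mulmxA.
have HP : higman P by apply: higman_retract hI hS IS HL.
have sum_reg : \sum_(q in Q) \tr (P (q * y)%g) = \tr (P y) *+ #|y ^: Q|.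
  rewrite (bigID (fun q => p^'.-elt (q * y)%g)) /= [X in _ + X]big1 ?addr0; last first.
    by move=> q /andP[Qq py]; rewrite (singular_trace pmt _ HP) // groupM // (subsetP sQN).
  rewrite (reindex_inj (mulIg y^-1%g)) /= -sumr_const.
  apply: eq_big => z; first by rewrite mulgKV (pregular_coset pQ).
  rewrite mulgKV (pregular_coset pQ) // => /imsetP[q Qq ->].
  have Nq := subsetP sQN _ Qq.
  have -> : P (y ^ q)%g = P q^-1%g *m (P y *m P q).
    by rewrite conjgE !repr_mxM ?groupM ?groupV.
  by rewrite mxtrace_mulC -mulmxA -repr_mxM ?groupV // mulgV repr_mx1 mulmx1.
have orbit : (#|'C_Q[y]| * #|y ^: Q| = #|Q|)%N.
  by rewrite -(Lagrange (subsetIl Q 'C[y])) index_cent1.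
apply: (@mulfI _ (#|y ^: Q|%:R : R)).
  apply/eqP => /(pm_char0 pmt)/eqP; rewrite -leqn0 leqNgt.
  by rewrite (cardD1 y) class_refl.
by rewrite mulrA -natrM mulnC orbit trA sum_reg mulr_natl.
Qed.

End Covers.

Section CoverLift.
Variables (R : comUnitRingType) (gT : finGroupType) (N : {group gT}).
Implicit Types P B : glattice R N.

Lemma cover_factor P P' B (f : 'M[R]_(gdeg P, gdeg B)) : projective P ->
    projective_cover P' B -> ghom f ->
    (forall v : 'rV_(gdeg B), exists u, u *m f = v) ->
  exists (h : 'M[R]_(gdeg P, gdeg P')) (g : 'M[R]_(gdeg P', gdeg P)),
    ghom h /\ g *m h = 1%:M.
Proof.
move=> /projective_higman[phi phi1] [_ [f' [hf' surj' sup']]] hf surj.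
pose h0 := \matrix_i sval (cid (surj' (row i f))).
have h0f : h0 *m f' = f.
  by apply/row_matrixP => i; rewrite row_mul rowK; case: cid.
pose h := trG (phi *m h0); exists h.
have hh : ghom h by apply: trG_hom.
have hf0 : h *m f' = f by rewrite /h trG_mulr // -mulmxA h0f -trG_mulr // phi1 mul1mx.
have full w : exists u : 'rV_(gdeg P), u *m h = w.
  move: w; apply: (sup' (fun w => exists u : 'rV_(gdeg P), u *m h = w)).
    split=> [|a u v [u' <-] [v' <-]|x u Nx [u' <-]].
    - by exists 0; rewrite mul0mx.
    - by exists (a *: u' + v'); rewrite mulmxDl scalemxAl.
    - by exists (u' *m P x); rewrite -!mulmxA hh.
  move=> w; have [u uf] := surj (w *m f'); exists (w - u *m h), (u *m h).
  split; [|by exists u|by rewrite subrK].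
  by rewrite mulmxBl -mulmxA hf0 uf subrr.
exists (\matrix_i sval (cid (full (row i 1%:M)))); split=> //.
by apply/row_matrixP => i; rewrite row_mul rowK; case: cid.
Qed.

(** Each cover maps onto the other; the composite is a surjective endomorphism of a free [R]-module
    of finite rank, hence invertible. *)
Lemma cover_unique P P' B : projective_cover P B -> projective_cover P' B -> giso P P'.
Proof.
move=> cP cP'; have [PP [f [hf sf _]]] := cP; have [PP' [f' [hf' sf' _]]] := cP'.
have [h [g [hh gh]]] := cover_factor PP cP' hf sf.
have [k [l [_ lk]]] := cover_factor PP' cP hf' sf'.
have hk : l *m g *m (h *m k) = 1%:M by rewrite mulmxA -(mulmxA l) gh mulmx1.
have kh := mulmx1C hk; rewrite -mulmxA in kh.
have gE : g = k *m (l *m g) by rewrite -[g in LHS]mulmx1 -kh !mulmxA gh mul1mx.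
by exists h, g; split=> //; rewrite gE.
Qed.

End CoverLift.

Section CoverLiftSpec.
Variables (p : nat) (R : idomainType) (F : fieldType).
Variables (red : {rmorphism R -> F}) (t : R) (pmt : pmodular p red t).
Variables (gT : finGroupType) (N Q : {group gT}).
Hypotheses (nQN : N \subset 'N(Q)) (sQN : Q \subset N) (pQ : p.-group Q).

Lemma cover_trace (A : glattice R (N / Q)%G) (P : glattice R N) y :
    projective A -> projective_cover P (ginf nQN A) ->
    y \in N -> p^'.-elt y ->
  \tr (P y) = #|'C_Q[y]|%:R * \tr (A (coset Q y)).
Proof.
move=> PA cP Ny p'y; have [P' [cP' trP']] := cover_exists pmt nQN sQN pQ PA.
by rewrite (giso_tr (cover_unique cP cP')) // trP'.
Qed.

(** Whichever [A], [B] and covers [the_elt] picks, [cover_trace] expresses the character by that of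
    [M]. *)
Lemma cover_lift_spec (M : green R (N / Q)%G) : vproj M ->
  vproj (cover_lift nQN M) /\ forall y, y \in N -> p^'.-elt y ->
    gchar (cover_lift nQN M) y = #|'C_Q[y]|%:R * gchar M (coset Q y).
Proof.
move=> [A [B [PA PB eM]]]; rewrite /cover_lift /the_elt; case: pselect => [h|[]]; last first.
  have [CA [cA _]] := cover_exists pmt nQN sQN pQ PA.
  have [CB [cB _]] := cover_exists pmt nQN sQN pQ PB.
  by exists (gclass CA - gclass CB), A, B, CA, CB.
case: cid => V /= {h} [A' [B' [CA [CB [[PA' PB' eM'] [cA cB ->]]]]]].
split; first by exists CA, CB; split=> //; [case: cA | case: cB].
move=> y Ny p'y; have Cy : coset Q y \in (N / Q)%G by apply: mem_quotient.
by rewrite eM' !gcharE // (cover_trace PA' cA) // (cover_trace PB' cB) // -mulrBr.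
Qed.

End CoverLiftSpec.

(** * Signed permutation lattices *)

Section PermBasis.
Variables (R : comUnitRingType) (gT : finGroupType) (G : {group gT}).
Variables (U : eqType) (act : U -> gT -> U).

Definition perm_basis (A : glattice R G) (a : 'I_(gdeg A) -> U) : Prop :=
  injective a /\ forall x i j, x \in G -> A x i j = (act (a i) x == a j)%:R.

Lemma sum_delta n (a : 'I_n -> U) (f : U -> R) u k : injective a -> a k = u ->
  \sum_i (a i == u)%:R * f (a i) = f u.
Proof.
move=> ainj <-; rewrite (bigD1 k) //= eqxx mul1r big1 ?addr0 // => i ik.
by rewrite (inj_eq ainj) (negPf ik) mul0r.
Qed.

Lemma perm_basis_iso A B a b : @perm_basis A a -> @perm_basis B b ->
  (forall i, exists j, a i = b j) -> (forall j, exists i, a i = b j) -> giso A B.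
Proof.
move=> [ainj hA] [binj hB] ab ba.
exists (\matrix_(i, j) (a i == b j)%:R), (\matrix_(i, j) (b i == a j)%:R); split.
- move=> x Gx; apply/matrixP => i j; rewrite !mxE.
  transitivity ((act (a i) x == b j)%:R : R).
    have [k hk] := ba j; rewrite -(sum_delta (fun u => (act (a i) x == u)%:R) ainj hk).
    by apply: eq_bigr => l _; rewrite mxE hA // mulrC.
  have [k hk] := ab i.
  rewrite -(sum_delta (fun u => (act u x == b j)%:R) binj (esym hk)).
  by apply: eq_bigr => l _; rewrite mxE hB // eq_sym.
- apply/matrixP => i j; rewrite !mxE -(inj_eq ainj).
  have [k hk] := ab j; rewrite -(sum_delta (fun u => (a i == u)%:R) binj (esym hk)).
  by apply: eq_bigr => l _; rewrite !mxE mulrC.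
apply/matrixP => i j; rewrite !mxE -(inj_eq binj).
have [k hk] := ba j; rewrite -(sum_delta (fun u => (b i == u)%:R) ainj hk).
by apply: eq_bigr => l _; rewrite !mxE mulrC.
Qed.

End PermBasis.

Section PermLattice.
Variables (R : comUnitRingType) (gT : finGroupType) (T : finType).
Variable to : {action gT &-> T}.
Implicit Types (G : {group gT}) (Z : {set T}).

Definition gperm_mx Z (x : gT) : 'M[R]_#|Z| :=
  \matrix_(i, j) (to (enum_val i) x == enum_val j)%:R.

Lemma gperm_repr G Z : [acts G, on Z | to] -> mx_repr G (gperm_mx Z).
Proof.
move=> sZ; split=> [|x y Gx Gy].
  by apply/matrixP => i j; rewrite !mxE act1 (inj_eq enum_val_inj).
apply/matrixP => i j; rewrite !mxE.
have Zx : to (enum_val i) x \in Z by rewrite (acts_act sZ) ?enum_valP.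
rewrite (bigD1 (enum_rank_in Zx (to (enum_val i) x))) //= big1 ?addr0 => [|k ki].
  by rewrite !mxE enum_rankK_in // eqxx mul1r actM.
rewrite !mxE; case: eqP => [e|]; last by rewrite mul0r.
by case/eqP: ki; apply: enum_val_inj; rewrite enum_rankK_in.
Qed.
Definition gperm G Z (sZ : [acts G, on Z | to]) : glattice R G :=
  Glattice (MxRepresentation (gperm_repr sZ)).

(** Stability of [Z] is decided inside, with default 0, so that [Z] can be rewritten without
    transporting a proof. *)
Definition pcl G Z : green R G :=
  if @idP [acts G, on Z | to] is ReflectT sZ then gclass (gperm sZ) else 0.

Lemma pclE G Z (sZ : [acts G, on Z | to]) : pcl G Z = gclass (gperm sZ).
Proof. by rewrite /pcl; case: {-}_ / idP => // s; rewrite (bool_irrelevance s sZ). Qed.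

Lemma gperm_basis G Z (sZ : [acts G, on Z | to]) :
  perm_basis to (A := gperm sZ) enum_val.
Proof. by split=> [|x i j Gx]; [apply: enum_val_inj | rewrite mxE]. Qed.

Lemma gperm_trace G Z (sZ : [acts G, on Z | to]) x :
  \tr (gperm sZ x) = #|[set z in Z | to z x == z]|%:R.
Proof.
rewrite /mxtrace -sum1_card natr_sum.
transitivity (\sum_(i < #|Z|) (to (enum_val i) x == enum_val i)%:R : R).
  by apply: eq_bigr => i _; rewrite mxE.
rewrite -(big_enum_val (fun z => (to z x == z)%:R)) big_mkcond [RHS]big_mkcond /=.
by apply: eq_bigr => z _; rewrite inE; case: (z \in Z); case: eqP.
Qed.

Lemma gchar_pcl G Z x : [acts G, on Z | to] -> x \in G ->
  gchar (pcl G Z) x = #|[set z in Z | to z x == z]|%:R.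
Proof. by move=> sZ Gx; rewrite (pclE sZ) gchar_class // gperm_trace. Qed.

Lemma acts_set0 G : [acts G, on (set0 : {set T}) | to].
Proof. by apply/actsP => x _ z; rewrite !inE. Qed.

Lemma pcl_set0 G : pcl G set0 = 0.
Proof.
rewrite (pclE (acts_set0 G)) -(gclass0 R G); apply: gclass_iso.
have e : gdeg (gperm (acts_set0 G)) = 0%N by rewrite /= cards0.
apply: (@giso_eq _ _ _ (gperm (acts_set0 G)) (gzero R G) e) => x _.
by apply/matrixP=> -[].
Qed.

Lemma actsU G Z Z' : [acts G, on Z | to] -> [acts G, on Z' | to] ->
  [acts G, on Z :|: Z' | to].
Proof.
move=> sZ sZ'; apply/actsP => x Gx z.
by rewrite !inE (acts_act sZ) // (acts_act sZ').
Qed.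

Lemma pclU G Z Z' : [acts G, on Z | to] -> [acts G, on Z' | to] -> [disjoint Z & Z'] ->
  pcl G (Z :|: Z') = pcl G Z + pcl G Z'.
Proof.
move=> sZ sZ' dZ; rewrite (pclE (actsU sZ sZ')) (pclE sZ) (pclE sZ') -gclassD.
apply: gclass_iso.
pose b (i : 'I_(#|Z| + #|Z'|)) : T :=
  match split i with inl j => enum_val j | inr j => enum_val j end.
apply: (@perm_basis_iso _ _ _ _ to (gperm (actsU sZ sZ')) (gsum (gperm sZ) (gperm sZ')) enum_val b).
- exact: gperm_basis.
- have nZ (i : 'I_#|Z|) (j : 'I_#|Z'|) : enum_val i != enum_val j.
    apply: contraTneq (enum_valP j) => <-.
    by rewrite (disjointFr dZ) // enum_valP.
  split=> [i j|x i j Gx].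
    rewrite /b -{2}(splitK i) -{2}(splitK j).
    case: (split i) => u; case: (split j) => v /= e.
    + by rewrite (enum_val_inj e).
    + by case/eqP: (nZ u v).
    + by case/eqP: (nZ v u).
    + by rewrite (enum_val_inj e).
  have nZx (u : 'I_#|Z|) (v : 'I_#|Z'|) : to (enum_val u) x != enum_val v.
    apply: contraTneq (enum_valP v) => <-.
    by rewrite (disjointFr dZ) // (acts_act sZ) // enum_valP.
  have nZx' (u : 'I_#|Z|) (v : 'I_#|Z'|) : to (enum_val v) x != enum_val u.
    apply: contraTneq (enum_valP u) => <-.
    by rewrite (disjointFl dZ) // (acts_act sZ') // enum_valP.
  rewrite /b -{1}(splitK i) -{1}(splitK j) /=.
  case: (split i) => u; case: (split j) => v /=; rewrite /gsum_mx.
  + by rewrite block_mxEul mxE.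
  + by rewrite block_mxEur mxE (negPf (nZx u v)).
  + by rewrite block_mxEdl mxE (negPf (nZx' v u)).
  by rewrite block_mxEdr mxE.
- move=> i; have := enum_valP i; rewrite inE => /orP[zi|zi].
    exists (lshift _ (enum_rank_in zi (enum_val i))).
    by rewrite /b (unsplitK (inl _)) enum_rankK_in.
  exists (rshift _ (enum_rank_in zi (enum_val i))).
  by rewrite /b (unsplitK (inr _)) enum_rankK_in.
move=> j; have bZ : b j \in Z :|: Z'.
  by rewrite inE /b; case: (split j) => u; rewrite enum_valP ?orbT.
by exists (enum_rank_in bZ (b j)); rewrite enum_rankK_in.
Qed.

Lemma pcl_partition G Z (I : finType) (S : {set I}) (A : I -> {set T}) :
    (forall i, i \in S -> [acts G, on A i | to]) ->
    (forall z, z \in Z <-> exists2 i, i \in S & z \in A i) ->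
    (forall z i j, i \in S -> j \in S -> z \in A i -> z \in A j -> i = j) ->
  pcl G Z = \sum_(i in S) pcl G (A i).
Proof.
move=> sA ZA dA.
have memU z (s : seq I) : (z \in \bigcup_(i <- s) A i) = has (fun i => z \in A i) s.
  by elim: s => [|i s IH]; rewrite ?big_nil ?big_cons ?inE // IH.
suff h (s : seq I) : uniq s -> {subset s <= S} ->
    [acts G, on \bigcup_(i <- s) A i | to] /\
    pcl G (\bigcup_(i <- s) A i) = \sum_(i <- s) pcl G (A i).
  have sub : {subset enum S <= S} by move=> i; rewrite mem_enum.
  have [_] := h _ (enum_uniq _) sub; rewrite [X in _ = X -> _]big_enum /= => <-.
  congr (pcl G _); apply/setP => z.
  rewrite memU; apply/idP/hasP => [/ZA[i Si zi]|[i]]; first by exists i; rewrite ?mem_enum.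
  by rewrite mem_enum => Si zi; apply/ZA; exists i.
elim: s => [_ _|i s IH /= /andP[i_s us] sS].
  by rewrite !big_nil pcl_set0; split=> //; apply: acts_set0.
have Si : i \in S by apply: sS; rewrite inE eqxx.
have sS' : {subset s <= S} by move=> j js; apply: sS; rewrite inE js orbT.
have [a e] := IH us sS'; rewrite !big_cons; split; first exact: actsU (sA i Si) a.
rewrite pclU ?e //; first exact: sA.
rewrite -setI_eq0; apply/eqP/setP => z; rewrite !inE memU; apply/negP => /andP[zi].
case/hasP=> j js zj; case/negP: i_s.
by rewrite (dA z i j Si (sS' j js) zi zj).
Qed.

End PermLattice.

Lemma pcl_bij (R : comUnitRingType) (gT : finGroupType) (G : {group gT})
    (T T' : finType) (to : {action gT &-> T}) (to' : {action gT &-> T'})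
    (Z : {set T}) (Z' : {set T'}) (f : T -> T') :
    [acts G, on Z | to] -> {in Z &, injective f} -> f @: Z = Z' ->
    (forall z x, z \in Z -> x \in G -> f (to z x) = to' (f z) x) ->
  [acts G, on Z' | to'] /\ pcl R to G Z = pcl R to' G Z'.
Proof.
move=> sZ finj fZ fact.
have sZ' : [acts G, on Z' | to'].
  apply/subsetP => x Gx; rewrite !inE; apply/subsetP => z'.
  rewrite -fZ => /imsetP[z Zz ->]; rewrite inE -fact // imset_f //.
  by rewrite (acts_act sZ).
split=> //; rewrite (pclE _ sZ) (pclE _ sZ'); apply: gclass_iso.
apply: (@perm_basis_iso _ _ _ _ to' (gperm R sZ) (gperm R sZ') (f \o enum_val) enum_val).
- split=> [i j /= e|x i j Gx]; first by apply/enum_val_inj/finj; rewrite ?enum_valP.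
  rewrite mxE /= -fact ?enum_valP // (inj_in_eq finj) ?enum_valP //.
  by rewrite (acts_act sZ) ?enum_valP.
- exact: gperm_basis.
- move=> i /=; have zi : f (enum_val i) \in Z' by rewrite -fZ imset_f ?enum_valP.
  by exists (enum_rank_in zi (f (enum_val i))); rewrite enum_rankK_in.
move=> j; have : enum_val j \in f @: Z by rewrite fZ enum_valP.
case/imsetP=> z Zz ->.
by exists (enum_rank_in Zz z); rewrite /= enum_rankK_in.
Qed.

Lemma Inf_pcl (R : comUnitRingType) (gT : finGroupType) (N Q : {group gT})
    (nQN : N \subset 'N(Q)) (T T' : finType)
    (to : {action (coset_of Q) &-> T}) (to' : {action gT &-> T'})
    (Z : {set T}) (Z' : {set T'}) (f : T -> T') :
    [acts (N / Q)%G, on Z | to] -> {in Z &, injective f} -> f @: Z = Z' ->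
    (forall z x, z \in Z -> x \in N -> f (to z (coset Q x)) = to' (f z) x) ->
  [acts N, on Z' | to'] /\ Inf nQN (pcl R to (N / Q)%G Z) = pcl R to' N Z'.
Proof.
move=> sZ finj fZ fact.
have sZx z x : z \in Z -> x \in N -> to z (coset Q x) \in Z.
  by move=> Zz Nx; rewrite (acts_act sZ) // mem_quotient.
have sZ' : [acts N, on Z' | to'].
  apply/subsetP => x Gx; rewrite !inE; apply/subsetP => z'.
  by rewrite -fZ => /imsetP[z Zz ->]; rewrite inE -fact // imset_f // sZx.
split=> //; rewrite (pclE _ sZ) (pclE _ sZ') /Inf glift_gclass; first last.
- exact: ginf_sum.
- exact: ginf_iso.
apply: gclass_iso.
apply: (@perm_basis_iso _ _ _ _ to' (ginf nQN (gperm R sZ)) (gperm R sZ') (f \o enum_val) enum_val).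
- split=> [i j /= e|x i j Nx]; first by apply/enum_val_inj/finj; rewrite ?enum_valP.
  rewrite [LHS]mxE /= -fact ?enum_valP // (inj_in_eq finj) ?enum_valP //.
  by rewrite sZx ?enum_valP.
- exact: gperm_basis.
- move=> i /=; have zi : f (enum_val i) \in Z' by rewrite -fZ imset_f ?enum_valP.
  by exists (enum_rank_in zi (f (enum_val i))); rewrite enum_rankK_in.
move=> j; have : enum_val j \in f @: Z by rewrite fZ enum_valP.
case/imsetP=> z Zz ->.
by exists (enum_rank_in Zz z); rewrite /= enum_rankK_in.
Qed.

Section Fibers.
Variables (R : comUnitRingType) (gT : finGroupType) (G : {group gT}).
Variables (T Y : finType) (to : {action gT &-> T}) (toY : {action gT &-> Y}).
Variables (Z : {set T}) (b : T -> Y).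
Hypothesis sZ : [acts G, on Z | to].
Hypothesis bZ : forall z x, z \in Z -> x \in G -> b (to z x) = toY (b z) x.

(** The basis of the induced lattice is indexed by a coset of [H] and a point of the fibre over [w];
    it is labelled by the translate of this point by the representative of the coset. *)
Lemma pcl_Ind (H : {group gT}) (sHG : H \subset G) (w : Y) :
    (forall x, x \in G -> (x \in H) = (toY w x == w)) ->
  [acts H, on [set z in Z | b z == w] | to] /\
  [acts G, on [set z in Z | b z \in orbit toY G w] | to] /\
  Ind sHG (pcl R to H [set z in Z | b z == w]) =
    pcl R to G [set z in Z | b z \in orbit toY G w].
Proof.
move=> Hw; set Z0 := [set z in Z | b z == w]; set Z1 := [set z in Z | b z \in _].
have sZ0 : [acts H, on Z0 | to].
  apply/subsetP => x Hx; have Gx := subsetP sHG x Hx; rewrite !inE.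
  apply/subsetP => z; rewrite !inE => /andP[Zz /eqP bz].
  by rewrite (acts_act sZ) // Zz bZ // bz -Hw.
have sZ1 : [acts G, on Z1 | to].
  apply/subsetP => x Gx; rewrite !inE; apply/subsetP => z; rewrite !inE => /andP[Zz bz].
  by rewrite (acts_act sZ) // Zz bZ // orbit_actr // (mem_orbit _ _ Gx).
split=> //; split=> //.
rewrite (pclE _ sZ0) (pclE _ sZ1) Ind_gclass; apply: gclass_iso.
have HwJ x y : x \in G -> y \in G -> (toY w x == toY w y) = ((x * y^-1)%g \in H).
  move=> Gx Gy; rewrite Hw ?groupM ?groupV // actM.
  by rewrite -(inj_eq (act_inj toY y^-1%g)) actK.
have bw (i : 'I_#|Z0|) : enum_val i \in Z /\ b (enum_val i) = w.
  by have := enum_valP i; rewrite inE => /andP[? /eqP].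
pose n := #|Z0|; pose k := #|rcosets H G|.
pose pt (i1 : 'I_k) (i2 : 'I_n) : T := to (enum_val i2) (ind_rep i1).
have bpt i1 i2 : b (pt i1 i2) = toY w (ind_rep i1).
  by have [Zi bi] := bw i2; rewrite /pt bZ ?bi // (ind_rep_in sHG).
have ptinj i1 i2 j1 j2 : pt i1 i2 = pt j1 j2 -> i1 = j1 /\ i2 = j2.
  move=> e; have eb : toY w (ind_rep i1) = toY w (ind_rep j1) by rewrite -(bpt i1 i2) -(bpt j1 j2) e.
  have e1 : i1 = j1.
    by apply/eqP; rewrite -ind_rep_eq -HwJ ?(ind_rep_in sHG) // eb.
  by split=> //; move: e; rewrite /pt e1 => /act_inj/enum_val_inj.
pose a (i : 'I_(\sum_(i < k) n)) : T := pt (tagnat.sig1 i) (tagnat.sig2 i).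
apply: (@perm_basis_iso _ _ _ _ to (gind sHG (gperm R sZ0)) (gperm R sZ1) a enum_val).
- split=> [i j /ptinj[e1 e2]|x i j Gx].
    rewrite -[i]tagnat.sig2K -[j]tagnat.sig2K.
    move: (tagnat.sig1 i) (tagnat.sig2 i) e1 e2 => i1 i2 /= e1 e2.
    by rewrite /tagnat.Rank e1 e2.
  rewrite [LHS]mxE /ind_block /a.
  move: (tagnat.sig1 i) (tagnat.sig2 i) (tagnat.sig1 j) (tagnat.sig2 j) => i1 i2 j1 j2.
  have [Gi Gj] := (ind_rep_in sHG i1, ind_rep_in sHG j1).
  case: ifP => Hh.
    by rewrite mxE /pt -(inj_eq (act_inj to (ind_rep j1))) -!actM mulgKV.
  rewrite mxE; case: eqP => // e; move: Hh; rewrite -HwJ ?groupM //.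
  have := congr1 b e; rewrite bpt bZ ?bpt ?(acts_act sZ) //; last first.
    by have [] := bw i2.
  by rewrite -actM => ->; rewrite eqxx.
- exact: gperm_basis.
- move=> i; have zi : a i \in Z1.
    have [Zi bi] := bw (tagnat.sig2 i).
    rewrite inE (acts_act sZ) ?(ind_rep_in sHG) // Zi bpt.
    by rewrite mem_orbit ?(ind_rep_in sHG).
  by exists (enum_rank_in zi (a i)); rewrite enum_rankK_in.
move=> j; have := enum_valP j; rewrite inE => /andP[Zj /orbitP[g Gg gw]].
have [i1 Hi] := ind_repE H Gg; have Gi := ind_rep_in sHG i1.
set z := enum_val j in Zj gw *; pose z0 := to z (ind_rep i1)^-1%g.
have Zz0 : z0 \in Z0.
  by rewrite inE (acts_act sZ) ?groupV // Zj bZ ?groupV // -gw -actM -Hw // groupM ?groupV.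
pose i2 : 'I_n := enum_rank_in Zz0 z0.
have ptE j1 j2 : j1 = i1 -> j2 = i2 -> pt j1 j2 = z.
  by move=> -> ->; rewrite /pt enum_rankK_in // actKV.
exists (@tagnat.Rank k (fun _ => n) i1 i2); apply: ptE; first exact: tagnat.Rank1K.
by apply: val_inj; rewrite tagnat.Rank2K.
Qed.

Lemma pcl_fibers (S : {set Y}) (H : Y -> {group gT}) (sHG : forall w, H w \subset G) :
    (forall z, z \in Z -> exists2 w, w \in S & b z \in orbit toY G w) ->
    (forall w w', w \in S -> w' \in S -> w' \in orbit toY G w -> w = w') ->
    (forall w x, w \in S -> x \in G -> (x \in H w) = (toY w x == w)) ->
  pcl R to G Z = \sum_(w in S) Ind (sHG w) (pcl R to (H w) [set z in Z | b z == w]).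
Proof.
move=> covS injS HS.
rewrite (@pcl_partition _ _ _ _ _ _ _ S (fun w => [set z in Z | b z \in orbit toY G w])).
- by apply: eq_bigr => w Sw; have [_ [_ ->]] := pcl_Ind (sHG w) (fun x => HS w x Sw).
- by move=> w Sw; have [_ []] := pcl_Ind (sHG w) (fun x => HS w x Sw).
- move=> z; split=> [Zz|[w Sw]]; last by rewrite inE => /andP[].
  by have [w Sw bw] := covS z Zz; exists w; rewrite // inE Zz.
move=> z w w' Sw Sw'; rewrite !inE => /andP[_ bw] /andP[_ bw'].
by apply: injS => //; rewrite -(orbit_transl _ bw') orbit_sym -(orbit_transl _ bw) orbit_refl.
Qed.

End Fibers.

Section Signed.
Variables (R : comUnitRingType) (gT : finGroupType) (G : {group gT}).
Variables (T : finType) (to : {action gT &-> T}) (par : pred T).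

Definition spcl (H : {group gT}) (Z : {set T}) : green R H :=
  pcl R to H [set z in Z | ~~ par z] - pcl R to H [set z in Z | par z].

Definition par_inv (H : {group gT}) (Z : {set T}) :=
  [acts H, on Z | to] /\ forall z x, z \in Z -> x \in H -> par (to z x) = par z.

Lemma par_invP Z (q : pred bool) : par_inv G Z ->
  [acts G, on [set z in Z | q (par z)] | to].
Proof.
move=> [sZ hp]; apply/subsetP => x Gx; rewrite !inE; apply/subsetP => z.
by rewrite !inE => /andP[Zz qz]; rewrite (acts_act sZ) // Zz hp.
Qed.

Lemma par_inv_even Z : par_inv G Z -> [acts G, on [set z in Z | ~~ par z] | to].
Proof. exact: (par_invP negb). Qed.

Lemma par_inv_odd Z : par_inv G Z -> [acts G, on [set z in Z | par z] | to].
Proof. exact: (par_invP id). Qed.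

Lemma spclU Z Z' : par_inv G Z -> par_inv G Z' -> [disjoint Z & Z'] ->
  spcl G (Z :|: Z') = spcl G Z + spcl G Z'.
Proof.
move=> iZ iZ' dZ; rewrite /spcl.
have e (q : pred bool) : pcl R to G [set z in Z :|: Z' | q (par z)] =
    pcl R to G [set z in Z | q (par z)] + pcl R to G [set z in Z' | q (par z)].
  rewrite -pclU; [|exact: par_invP..|].
    by congr pcl; apply/setP => z; rewrite !inE andb_orl.
  rewrite -setI_eq0 -subset0; apply: subset_trans (_ : Z :&: Z' \subset _).
    by apply: setISS; apply/subsetP => z; rewrite inE => /andP[].
  by rewrite subset0 setI_eq0.
by rewrite (e negb) (e id) opprD !addrA [LHS](AC 4 (1*3*2*4)).
Qed.

(** [f] identifies the permutation lattices on the even and on the odd points. *)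
Lemma spcl_flip Z (f : T -> T) : par_inv G Z ->
    {in Z, forall z, [/\ f z \in Z, f (f z) = z & par (f z) = ~~ par z]} ->
    (forall z x, z \in Z -> x \in G -> f (to z x) = to (f z) x) ->
  spcl G Z = 0.
Proof.
move=> iZ hf fact; apply/eqP; rewrite subr_eq0; apply/eqP.
have [] // := @pcl_bij R gT G T T to to [set z in Z | ~~ par z] [set z in Z | par z] f.
- exact: par_inv_even.
- move=> z z'; rewrite !inE => /andP[Zz _] /andP[Zz' _] e.
  by have [_ <- _] := hf z Zz; rewrite e; have [] := hf z' Zz'.
- apply/setP => z; rewrite inE; apply/imsetP/andP => [[z' + ->]|[Zz pz]].
    by rewrite inE => /andP[Zz' pz']; have [-> _ ->] := hf z' Zz'.
  have [Zf ff pf] := hf z Zz; exists (f z); last by rewrite ff.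
  by rewrite inE Zf pf pz.
by move=> z x; rewrite inE => /andP[Zz _]; apply: fact.
Qed.

End Signed.

Lemma Inf_spcl (R : comUnitRingType) (gT : finGroupType) (N Q : {group gT})
    (nQN : N \subset 'N(Q)) (T T' : finType)
    (to : {action (coset_of Q) &-> T}) (to' : {action gT &-> T'})
    (par : pred T) (par' : pred T') (Z : {set T}) (Z' : {set T'}) (f : T -> T') :
    par_inv to par (N / Q)%G Z -> {in Z &, injective f} -> f @: Z = Z' ->
    {in Z, forall z, par' (f z) = par z} ->
    (forall z x, z \in Z -> x \in N -> f (to z (coset Q x)) = to' (f z) x) ->
  Inf nQN (spcl R to par (N / Q)%G Z) = spcl R to' par' N Z'.
Proof.
move=> iZ finj fZ fpar fact.
have e (q : pred bool) : Inf nQN (pcl R to (N / Q)%G [set z in Z | q (par z)]) =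
    pcl R to' N [set z in Z' | q (par' z)].
  apply: (proj2 (Inf_pcl R (f := f) _ (par_invP q iZ) _ _ _)).
  - by move=> z z'; rewrite !inE => /andP[Zz _] /andP[Zz' _]; apply: finj.
  - rewrite -fZ; apply/setP => z'; rewrite inE; apply/imsetP/andP => [[z + ->]|[/imsetP[z Zz ->]]].
      by rewrite inE => /andP[Zz qz]; rewrite imset_f // fpar.
    by rewrite fpar // => qz; exists z; rewrite // inE Zz.
  by move=> z x; rewrite inE => /andP[Zz _]; apply: fact.
rewrite /spcl -(e negb) -(e id) /Inf gliftB //; [exact: ginf_iso | exact: ginf_sum].
Qed.

Lemma spcl_fibers (R : comUnitRingType) (gT : finGroupType) (G : {group gT})
    (T Y : finType) (to : {action gT &-> T}) (toY : {action gT &-> Y})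
    (par : pred T) (Z : {set T}) (b : T -> Y) (S : {set Y}) (H : Y -> {group gT})
    (sHG : forall w, H w \subset G) :
    par_inv to par G Z ->
    (forall z x, z \in Z -> x \in G -> b (to z x) = toY (b z) x) ->
    (forall z, z \in Z -> exists2 w, w \in S & b z \in orbit toY G w) ->
    (forall w w', w \in S -> w' \in S -> w' \in orbit toY G w -> w = w') ->
    (forall w x, w \in S -> x \in G -> (x \in H w) = (toY w x == w)) ->
  spcl R to par G Z =
  \sum_(w in S) Ind (sHG w) (spcl R to par (H w) [set z in Z | b z == w]).
Proof.
move=> iZ bZ covS injS HS.
have e (q : pred bool) : pcl R to G [set z in Z | q (par z)] =
    \sum_(w in S) Ind (sHG w) (pcl R to (H w) [set z in [set z in Z | b z == w] | q (par z)]).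
  rewrite (@pcl_fibers R gT G T Y to toY _ b (par_invP q iZ) _ S H sHG) //.
  - apply: eq_bigr => w _; congr (Ind _ (pcl _ _ _ _)).
    by apply/setP => z; rewrite !inE andbAC.
  - by move=> z x; rewrite inE => /andP[Zz _]; apply: bZ.
  by move=> z; rewrite inE => /andP[Zz _]; apply: covS.
rewrite /spcl (e negb) (e id) -sumrB; apply: eq_bigr => w _.
by rewrite IndB.
Qed.

Lemma pcl_set1 (R : comUnitRingType) (gT : finGroupType) (G : {group gT})
    (T : finType) (to : {action gT &-> T}) (z : T) :
  (forall x, x \in G -> to z x = z) -> pcl R to G [set z] = gclass (gtriv R G).
Proof.
move=> fz; have sz : [acts G, on [set z] | to].
  apply/subsetP => x Gx; rewrite !inE; apply/subsetP => z'; rewrite !inE => /eqP->.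
  by rewrite fz.
rewrite (pclE _ sz); apply: gclass_iso.
have e : gdeg (gperm R sz) = 1%N by rewrite /= cards1.
apply: (@perm_basis_iso _ _ _ _ to (gperm R sz) (gtriv R G) enum_val (fun=> z)).
- exact: gperm_basis.
- by split=> [i j _|x i j Gx]; rewrite ?ord1 ?[j]ord1 // mxE !eqxx fz // eqxx.
- by move=> i; exists 0; have := enum_valP i; rewrite inE => /eqP.
by move=> _; exists (cast_ord (esym e) 0); have := enum_valP (cast_ord (esym e) 0); rewrite inE => /eqP.
Qed.

Section SteinbergSigned.
Variables (R : comUnitRingType) (p : nat) (gT : finGroupType) (X : {group gT}).

Definition odd_chain (s : {set {group gT}}) := odd #|s|.

Lemma pchains_inv : par_inv 'JG^*%act odd_chain X (pchains p X).
Proof.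
have actE (s : {set {group gT}}) x : ('JG^* s x)%act = (fun Q => 'JG Q x)%act @: s by [].
have cardJ (s : {set {group gT}}) x : #|('JG^* s x)%act| = #|s|.
  by rewrite actE card_imset //; apply: act_inj.
split; last by move=> s x _ _; rewrite /odd_chain cardJ.
apply/subsetP => x Xx; rewrite !inE; apply/subsetP => s.
rewrite !inE => /andP[sub /forall_inP tot]; apply/andP; split.
  rewrite actE; apply/subsetP => _ /imsetP[P sP ->].
  have := subsetP sub P sP; rewrite !inE /= => /and3P[PX pP P1].
  by rewrite conj_subG // pgroupJ pP conjsg_eq1.
rewrite actE; apply/forall_inP => _ /imsetP[P sP ->]; apply/forall_inP => _ /imsetP[Q sQ ->].
by rewrite /= !conjSg; have /forall_inP := tot P sP; apply.
Qed.

(** [spcl_fibers] for the identity map: an orbit of chains gives the trivial lattice induced from a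
    stabilizer, with the sign of the chain. *)
Lemma steinbergE : steinberg R p X = spcl R 'JG^*%act odd_chain X (pchains p X).
Proof.
have [sX _] := pchains_inv.
have [trX subX injX covX] := orbit_transversalP sX.
rewrite (@spcl_fibers R gT X _ _ _ 'JG^*%act odd_chain (pchains p X) id
  (orbit_transversal 'JG^*%act X (pchains p X)) (fun s => 'C_X[s | 'JG^*]%G)
  (fun s => subsetIl X 'C[s | 'JG^*])); first last.
- by move=> s x _ Xx; rewrite inE Xx; apply/idP/eqP => [/astab1P|e] //; apply/astab1P.
- by move=> s s' Ss Ss' /=; rewrite injX // => /eqP.
- move=> s /covX[x Xx Sx]; exists ('JG^* s x)%act => //.
  by rewrite orbit_sym mem_orbit.
- by [].
- exact: pchains_inv.
apply: eq_bigr => s Ss; set H := 'C_X[s | 'JG^*]%G.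
have Hs x : x \in H -> 'JG^*%act s x = s by case/setIP=> _ /astab1P.
have e : Ind (subsetIl X 'C[s | 'JG^*]) (spcl R 'JG^* odd_chain H [set s]) =
   gclass (gind (subsetIl X 'C[s | 'JG^*]) (gtriv R H)) *~ (-1) ^+ #|s|.
  have -> : spcl R 'JG^* odd_chain H [set s] = gclass (gtriv R H) *~ (-1) ^+ #|s|.
    rewrite /spcl -signr_odd -/(odd_chain s); case oS: (odd_chain s).
      have -> : [set z in [set s] | ~~ odd_chain z] = set0.
        by apply/setP => z; rewrite !inE; case: eqP => // ->; rewrite oS.
      have -> : [set z in [set s] | odd_chain z] = [set s].
        by apply/setP => z; rewrite !inE; case: eqP => // ->; rewrite oS.
      by rewrite pcl_set0 (pcl_set1 _ Hs) expr1 sub0r mulrNz.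
    have -> : [set z in [set s] | odd_chain z] = set0.
      by apply/setP => z; rewrite !inE; case: eqP => // ->; rewrite oS.
    have -> : [set z in [set s] | ~~ odd_chain z] = [set s].
      by apply/setP => z; rewrite !inE; case: eqP => // ->; rewrite oS.
    by rewrite pcl_set0 (pcl_set1 _ Hs) expr0 subr0.
  rewrite -signr_odd; case: odd; rewrite ?expr1 ?expr0 ?mulrNz ?mulr1z.
    by rewrite -sub0r IndB -(subrr 0) IndB subrr Ind_gclass sub0r.
  by rewrite Ind_gclass.
rewrite -e; congr (Ind _ (spcl _ _ _ _ _)).
apply/setP => z; rewrite in_set in_set1 /=; case: eqP => [->|_]; last by rewrite andbF.
by rewrite andbT (subsetP subX).
Qed.

End SteinbergSigned.

(** * Webb's theorem *)

Section StableIso.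
Variables (p : nat) (R : idomainType) (F : fieldType).
Variables (red : {rmorphism R -> F}) (t : R) (pmt : pmodular p red t).
Variables (gT : finGroupType) (G : {group gT}).

Lemma trG_block (A B : glattice R G) (a : 'M[R]_(gdeg A)) (b : 'M[R]_(gdeg A, gdeg B))
    (c : 'M[R]_(gdeg B, gdeg A)) (d : 'M[R]_(gdeg B)) :
  @trG _ _ _ (gsum A B) (gsum A B) (block_mx a b c d) =
  block_mx (trG a) (trG b) (trG c) (trG d).
Proof.
rewrite /trG /=.
transitivity (\sum_(x in G) block_mx (A (x^-1)%g *m a *m A x) (A (x^-1)%g *m b *m B x)
                      (B (x^-1)%g *m c *m A x) (B (x^-1)%g *m d *m B x)).
  apply: eq_bigr => x _; rewrite /gsum_mx !mulmx_block.
  by rewrite !(mul0mx, mulmx0, addr0, add0r).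
elim: (index_enum _) => [|x s IH]; first by rewrite !big_nil block_mx0.
rewrite !big_cons; case: (x \in G); last exact: IH.
by rewrite IH add_block_mx.
Qed.

(** With [Q] free and [a *m b = trG phi1], the map [(f, a)] from [A] to the sum of [B] and [Q] is
    split by [(g, b)]. The projection onto the complement [K] is a relative trace, so [K] is
    projective, and [A - B = Q - K] in the Green ring. *)
Lemma stable_iso_vproj (A B : glattice R G) (f : 'M[R]_(gdeg A, gdeg B))
    (g g' : 'M[R]_(gdeg B, gdeg A)) phi1 phi2 :
    ghom f -> ghom g -> ghom g' ->
    f *m g = 1%:M - @trG _ _ _ A A phi1 -> g' *m f = 1%:M - @trG _ _ _ B B phi2 ->
  vproj (gclass A - gclass B).
Proof.
move=> hf hg hg' fg g'f.
(* A left and a right inverse modulo relative traces agree modulo relative traces, so [g] is inverse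
   to [f] on both sides. *)
have [phi3 gf] : exists phi3, g *m f = 1%:M - @trG _ _ _ B B phi3.
  exists (phi2 - phi2 *m g *m f + g' *m phi1 *m f).
  have e : g - g' = trG phi2 *m g - g' *m trG phi1.
    have : g' *m (f *m g) = g' *m f *m g by rewrite mulmxA.
    rewrite fg g'f mulmxBr mulmxBl mulmx1 mul1mx => e.
    have eg : g = g' - g' *m trG phi1 + trG phi2 *m g by rewrite e subrK.
    by rewrite {1}eg; apply/matrixP => i j; rewrite !mxE; ring.
  have -> : g *m f = g' *m f + (g - g') *m f by rewrite mulmxBl addrC subrK.
  rewrite e g'f mulmxBl trGD trGD trGN.
  rewrite -(trG_mulr (phi2 *m g) hf) -(trG_mulr phi2 hg).
  rewrite -(trG_mulr (g' *m phi1) hf) -(trG_mull phi1 hg').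
  by apply/matrixP => i j; rewrite !mxE; ring.
have [n [a [b [ha hb ab]]]] := trG_free phi1.
set Q := gfree R G n in a b ha hb ab.
have HQ : higman Q := higman_free _ _ _.
have [phi phiQ] := HQ.
pose L := gsum B Q.
pose Fm : 'M[R]_(gdeg A, gdeg L) := row_mx f a.
pose Gm : 'M[R]_(gdeg L, gdeg A) := col_mx g b.
have hFm : @ghom _ _ _ A L Fm.
  move=> x Gx; change (A x *m row_mx f a = row_mx f a *m block_mx (B x) 0 0 (Q x)).
  rewrite mul_mx_row mul_row_block.
  by rewrite !mulmx0 addr0 add0r hf // ha.
have hGm : @ghom _ _ _ L A Gm.
  move=> x Gx; change (block_mx (B x) 0 0 (Q x) *m col_mx g b = col_mx g b *m A x).
  rewrite mul_block_col mul_col_mx.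
  by rewrite !mul0mx addr0 add0r hg // hb.
have FG : Fm *m Gm = 1%:M by rewrite mul_row_col fg ab subrK.
pose ep : 'M[R]_(gdeg L) := 1%:M - Gm *m Fm.
have hep : @ghom _ _ _ L L ep := ghomB (ghom1 L) (ghomM hGm hFm).
have Fep : Fm *m ep = 0 by rewrite mulmxBr mulmx1 mulmxA FG mul1mx subrr.
have epG : ep *m Gm = 0 by rewrite mulmxBl mul1mx -mulmxA FG mulmx1 subrr.
have epep : ep *m ep = ep by rewrite {1}/ep mulmxBl mul1mx -mulmxA Fep mulmx0 subr0.
have [I [S [IS SI]]] := idem_factor pmt epep.
move: (\rank _) I S IS SI => r I S IS SI.
have [|rK [hI hS]] := @retract_lattice _ _ _ L r I S IS; first by rewrite SI.
pose K := Glattice rK.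
have HK : higman K.
  (* Every block of [ep] is a relative trace: one is that of [phi3], and the others factor through
     [Q], whose identity is the trace of [phi]. *)
  pose psi : 'M[R]_(gdeg L) := block_mx phi3 (- (g *m a *m phi))
     (- (phi *m (b *m f))) (phi - phi *m (b *m a)).
  have eps : @trG _ _ _ L L psi = ep.
    rewrite trG_block /ep mul_col_row.
    have -> : (1%:M : 'M[R]_(gdeg L)) = block_mx 1%:M 0 0 1%:M by apply: scalar_mx_block.
    rewrite opp_block_mx add_block_mx !add0r gf; congr block_mx.
    - by rewrite opprB addrC subrK.
    - by rewrite trGN -(trG_mull phi (ghomM hg ha)) phiQ mulmx1.
    - by rewrite trGN -(trG_mulr phi (ghomM hb hf)) phiQ mul1mx.
    by rewrite trGD trGN -(trG_mulr phi (ghomM hb ha)) phiQ mul1mx.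
  exists (I *m psi *m S).
  rewrite -(@trG_mulr _ _ _ K L K _ S hS) -(@trG_mull _ _ _ K L L I psi hI) eps.
  by rewrite -SI mulmxA IS mul1mx.
have FS : Fm *m S = 0.
  have -> : S = ep *m S by rewrite -SI -mulmxA IS mulmx1.
  by rewrite mulmxA Fep mul0mx.
have IG : I *m Gm = 0.
  have -> : I = I *m ep by rewrite -SI mulmxA IS mul1mx.
  by rewrite -mulmxA epG mulmx0.
have e : giso L (gsum A K).
  exists (row_mx Gm S), (col_mx Fm I); split.
  - move=> x Gx.
    change (L x *m row_mx Gm S = row_mx Gm S *m block_mx (A x) 0 0 (K x)).
    rewrite mul_mx_row mul_row_block.
    by rewrite !mulmx0 addr0 add0r hGm // hS.
  - by rewrite mul_row_col SI /ep addrC subrK.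
  rewrite mul_col_row FG FS IG IS; apply/esym; exact: scalar_mx_block.
have : gclass L = gclass (gsum A K) by apply: gclass_iso.
rewrite !gclassD => e2.
exists Q, K; split; [exact: higman_projective | exact: higman_projective |].
by apply/eqP; rewrite subr_eq addrAC eq_sym subr_eq addrC e2 addrC.
Qed.

End StableIso.

(** * The augmented chain complex of the p-subgroups *)

Section FreeOn.
Variables (R : comUnitRingType) (T : finType).
Local Notation n := #|{: T}|.

Definition vec (s : T) : 'rV[R]_n := delta_mx 0 (enum_rank s).
Definition mxf (f : T -> 'rV[R]_n) : 'M[R]_n := \matrix_i f (enum_val i).

Lemma vec_mxf f s : vec s *m mxf f = f s.
Proof. by rewrite -rowE rowK enum_rankK. Qed.

Lemma vec_ext m (M N : 'M[R]_(n, m)) : (forall s, vec s *m M = vec s *m N) -> M = N.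
Proof.
by move=> h; apply/row_matrixP => i; rewrite !rowE -(enum_valK i) -/(vec _) h.
Qed.

(** All maps of the complex are endomorphisms of one free module, on all sets of subgroups. Supports
    keep track of degrees and parities, and of the sets that are chains. *)
Definition supp (L : {set T}) (v : 'rV[R]_n) := forall s, s \notin L -> v 0 (enum_rank s) = 0.

Lemma supp_expand L v : supp L v -> v = \sum_(s in L) v 0 (enum_rank s) *: vec s.
Proof.
move=> hv; rewrite [LHS]row_sum_delta (reindex_onto enum_rank enum_val) /=; last first.
  by move=> i _; rewrite enum_valK.
rewrite [RHS]big_mkcond /=; apply: eq_big => s; first by rewrite enum_rankK eqxx.
by case: ifP => // /negbT/hv->; rewrite scale0r.
Qed.

Lemma supp0 L : supp L 0. Proof. by move=> s _; rewrite mxE. Qed.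

Lemma suppD L u v : supp L u -> supp L v -> supp L (u + v).
Proof. by move=> hu hv s Ls; rewrite mxE hu // hv // addr0. Qed.

Lemma suppZ L a v : supp L v -> supp L (a *: v).
Proof. by move=> hv s Ls; rewrite mxE hv // mulr0. Qed.

Lemma suppB L u v : supp L u -> supp L v -> supp L (u - v).
Proof. by move=> hu hv s Ls; rewrite !mxE hu // hv // subr0. Qed.

Lemma supp_sum L (I : finType) (P : pred I) (f : I -> 'rV[R]_n) :
  (forall i, P i -> supp L (f i)) -> supp L (\sum_(i | P i) f i).
Proof. by move=> hf; elim/big_ind: _ => //; [apply: supp0 | apply: suppD]. Qed.

Lemma supp_vec (L : {set T}) s : s \in L -> supp L (vec s).
Proof.
move=> Ls s' Ls'; rewrite mxE eqxx (inj_eq enum_rank_inj) /=.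
by case: eqP => // e; rewrite e Ls in Ls'.
Qed.

Lemma suppS (L L' : {set T}) v : L \subset L' -> supp L v -> supp L' v.
Proof. by move=> /subsetP sL hv s Ls; apply: hv; apply: contra Ls; apply: sL. Qed.

Lemma supp_mul (L L' : {set T}) v M : supp L v ->
  (forall s, s \in L -> supp L' (vec s *m M)) -> supp L' (v *m M).
Proof.
move=> hv hM; rewrite (supp_expand hv) mulmx_suml; apply: supp_sum => s Ls.
by rewrite -scalemxAl; apply/suppZ/hM.
Qed.

Lemma supp_ext (L : {set T}) v m (M N : 'M[R]_(n, m)) : supp L v ->
  (forall s, s \in L -> vec s *m M = vec s *m N) -> v *m M = v *m N.
Proof.
move=> hv hM; rewrite (supp_expand hv) !mulmx_suml; apply: eq_bigr => s Ls.
by rewrite -!scalemxAl hM.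
Qed.

End FreeOn.
Arguments vec {R T} s.

Section ChainComplex.
Variables (R : idomainType) (p : nat) (gT : finGroupType) (X : {group gT}).
Hypothesis char0 : forall n : nat, n%:R = 0 :> R -> n = 0%N.
Local Notation T := {set {group gT}}.
Local Notation n := #|{: T}|.
Local Notation Z := (pchains p X).
Local Notation J x s := ('JG^*%act s x).
Implicit Types (s : T) (P Q S : {group gT}).

Lemma pchain_tot s P Q : s \in Z -> P \in s -> Q \in s -> (P \subset Q) || (Q \subset P).
Proof. by rewrite inE => /andP[_ /forall_inP tot] /tot/forall_inP; apply. Qed.

Lemma pchain_mem s Q : s \in Z -> Q \in s -> [/\ Q \subset X, p.-group Q & Q :!=: 1%g].
Proof.
by rewrite inE => /andP[/subsetP sub _] /sub; rewrite inE => /and3P.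
Qed.

Lemma pchainP s : (forall Q, Q \in s -> [/\ Q \subset X, p.-group Q & Q :!=: 1%g]) ->
  (forall P Q, P \in s -> Q \in s -> (P \subset Q) || (Q \subset P)) -> s \in Z.
Proof.
move=> mem tot; rewrite inE; apply/andP; split.
  by apply/subsetP => Q /mem[] *; rewrite inE; apply/and3P.
by apply/forall_inP => P sP; apply/forall_inP => Q sQ; apply: tot.
Qed.

Lemma pchain_sub s s' : s \in Z -> s' \subset s -> s' \in Z.
Proof.
move=> Zs /subsetP sub; apply: pchainP => [Q /sub|P Q /sub Ps /sub Qs].
  exact: pchain_mem.
exact: pchain_tot Zs Ps Qs.
Qed.

Lemma pchain_proper s P Q : s \in Z -> P \in s -> Q \in s -> P != Q ->
  ((P \proper Q) + (Q \proper P) = 1)%N.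
Proof.
move=> Zs sP sQ PQ; rewrite !properE; have := pchain_tot Zs sP sQ.
have : ~~ ((P \subset Q) && (Q \subset P)).
  by apply: contra PQ => /andP[a b]; apply/eqP/val_inj/eqP; rewrite /= eqEsubset a.
by do 2!case: (_ \subset _).
Qed.

Definition below Q s := #|[set P in s | P \proper Q]|.

Lemma below_D1 Q P s : below Q s = ((P \in s) && (P \proper Q) + below Q (s :\ P))%N.
Proof.
rewrite /below (cardsD1 P) inE; congr (_ + #|pred_of_set _|)%N.
by apply/setP => U; rewrite !inE andbA.
Qed.

(* [(-1) ^+ i] if [Q] is the member number [i] of the chain [s], counted from 0. *)
Definition sgn Q s : R := (-1) ^+ below Q s.

Lemma sgn_sqr Q s : sgn Q s * sgn Q s = 1.
Proof. by rewrite -expr2 sqrr_sign. Qed.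

(** The empty chain is a basis element and the boundary of every one-member chain, so the complex is
    augmented. *)
Definition boundary s : 'rV[R]_n := \sum_(Q in s) sgn Q s *: vec (s :\ Q).
Local Notation bd := boundary.
Definition boundary_mx : 'M[R]_n := mxf (fun s => if s \in Z then bd s else 0).
Local Notation D := boundary_mx.

Lemma vec_D s : s \in Z -> vec s *m D = bd s.
Proof. by move=> Zs; rewrite vec_mxf Zs. Qed.

Lemma bd_mul s m (M : 'M[R]_(n, m)) : bd s *m M = \sum_(Q in s) sgn Q s *: (vec (s :\ Q) *m M).
Proof. by rewrite mulmx_suml; apply: eq_bigr => Q _; rewrite scalemxAl. Qed.

Lemma bd_bd s : s \in Z -> bd s *m D = 0.
Proof.
move=> Zs; pose f Q P : 'rV[R]_n := (sgn Q s * sgn P (s :\ Q)) *: vec (s :\ Q :\ P).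
have eD : bd s *m D = \sum_(Q in s) \sum_(P in s | P != Q) f Q P.
  rewrite bd_mul; apply: eq_bigr => Q sQ.
  rewrite vec_D ?(pchain_sub Zs) ?subD1set // /boundary scaler_sumr.
  by apply: eq_big => [P|P _]; rewrite ?scalerA // !inE andbC.
have fN Q P : Q \in s -> P \in s -> P != Q -> f Q P = - f P Q.
  move=> sQ sP PQ; rewrite /f -scaleNr; congr (_ *: vec _); last first.
    by apply/setP => U; rewrite !inE andbCA.
  rewrite /sgn (below_D1 Q P s) (below_D1 P Q s) sP sQ /=.
  have := pchain_proper Zs sP sQ PQ; rewrite !exprD.
  move: (_ ^+ below Q _) (_ ^+ below P _) => u v.
  by case: (P \proper Q); case: (Q \proper P) => //= _; rewrite ?expr0 ?expr1; ring.
(* Exchanging the two deleted members changes the sign, so the sum is its own opposite; it vanishes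
   because 2 is nonzero in the domain [R]. *)
have : bd s *m D = - (bd s *m D).
  rewrite {1}eD (exchange_big_dep (mem s)) /=; last by move=> Q P _ /andP[].
  rewrite eD -sumrN; apply: eq_bigr => P sP; rewrite -sumrN.
  apply: eq_big => [Q|Q /and3P[sQ _ PQ]]; first by rewrite sP /= eq_sym.
  exact: fN.
move/eqP; rewrite -addr_eq0 => /eqP e; apply/matrixP => i j.
move/matrixP/(_ i j): e; rewrite !mxE -mulr2n -mulr_natl => /eqP.
by rewrite mulf_eq0 => /orP[/eqP/char0//|/eqP].
Qed.

Definition cone (a : {group gT}) s : 'rV[R]_n :=
  if (a \notin s) && (a |: s \in Z) then sgn a s *: vec (a |: s) else 0.

Lemma coneP a s : a |: s \in Z -> cone a s *m D + bd s *m mxf (cone a) = vec s.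
Proof.
move=> Zas; have Zs : s \in Z by apply: pchain_sub Zas (subsetUr _ _).
have bdE : bd s *m mxf (cone a) = \sum_(Q in s) sgn Q s *: cone a (s :\ Q).
  by rewrite bd_mul; apply: eq_bigr => Q _; rewrite vec_mxf.
rewrite bdE /cone; have [sa|sa] := boolP (a \in s) => /=.
  rewrite mul0mx add0r (bigD1 a) //= setD11 setD1K // Zs /= scalerA big1 ?addr0.
    by rewrite /sgn {1}(below_D1 a a) properxx andbF add0n sgn_sqr scale1r.
  by move=> Q /andP[sQ Qa]; rewrite in_setD1 sa eq_sym Qa scaler0.
rewrite Zas -scalemxAl vec_D // /boundary big_setU1 //= scalerDr setU1K //.
rewrite scalerA {2}/sgn (below_D1 a a) properxx andbF add0n setU1K // sgn_sqr scale1r.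
rewrite -addrA -[RHS]addr0; congr (_ + _); rewrite scaler_sumr -big_split /=.
apply: big1 => Q sQ; have aQ : a != Q by apply: contraNneq sa => ->.
have e : (a |: s) :\ Q = a |: (s :\ Q).
  by apply/setP => U; rewrite !inE; case: (U =P a) => [->|]; rewrite ?aQ.
rewrite in_setD1 (negPf sa) andbF -e (pchain_sub Zas) ?subD1set //= !scalerA -scalerDl.
rewrite [X in X *: _](_ : _ = 0) ?scale0r //.
rewrite /sgn (below_D1 Q a (a |: s)) setU11 setU1K // (below_D1 a Q s) sQ /=.
have := pchain_proper Zas (setU11 _ _) (setU1r a sQ) aQ; rewrite !exprD.
move: (_ ^+ below Q _) (_ ^+ below a _) => u v.
by case: (a \proper Q); case: (Q \proper a) => //= _; rewrite ?expr0 ?expr1; ring.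
Qed.

Definition act_mx (x : gT) : 'M[R]_n := mxf (fun s => vec (J x s)).

Lemma vec_act x s : vec s *m act_mx x = vec (J x s).
Proof. exact: vec_mxf. Qed.

Lemma act_mxM x y : act_mx x *m act_mx y = act_mx (x * y)%g.
Proof. by apply: vec_ext => s; rewrite mulmxA !vec_act actM. Qed.

Lemma act_mx1 : act_mx 1%g = 1%:M.
Proof. by apply: vec_ext => s; rewrite vec_act act1 mulmx1. Qed.

Lemma act_mxK x : act_mx x *m act_mx x^-1%g = 1%:M.
Proof. by rewrite act_mxM mulgV act_mx1. Qed.

Lemma memJ Q x s : ('JG%act Q x \in J x s) = (Q \in s).
Proof. by rewrite (mem_imset _ _ (act_inj 'JG x)). Qed.

Lemma J_setD1 x s Q : J x (s :\ Q) = J x s :\ 'JG%act Q x.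
Proof.
apply/setP => U; rewrite -[U](actKV 'JG x) memJ !inE memJ.
by rewrite (inj_eq (act_inj 'JG x)).
Qed.

Lemma J_setU1 x s Q : J x (Q |: s) = 'JG%act Q x |: J x s.
Proof.
apply/setP => U; rewrite -[U](actKV 'JG x) memJ !inE memJ.
by rewrite (inj_eq (act_inj 'JG x)).
Qed.

Lemma card_J x s : #|J x s| = #|s|.
Proof. by rewrite card_imset //; apply: act_inj. Qed.

Lemma below_J x Q s : below ('JG%act Q x) (J x s) = below Q s.
Proof.
rewrite /below -[RHS](card_J x); congr #|pred_of_set _|; apply/setP => U.
rewrite -[U](actKV 'JG x) memJ 2!in_set memJ; congr (_ && _).
exact: properJ.
Qed.

Lemma Z_J x s : x \in X -> (J x s \in Z) = (s \in Z).
Proof. by move=> Xx; rewrite (acts_act (proj1 (pchains_inv p X))). Qed.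

Lemma bd_J x s : bd (J x s) = bd s *m act_mx x.
Proof.
rewrite bd_mul [LHS](reindex_inj (act_inj 'JG x)) /=.
apply: eq_big => [Q|Q sQ]; first exact: memJ.
by rewrite /sgn below_J -J_setD1 vec_act.
Qed.

Lemma D_act x : x \in X -> act_mx x *m D = D *m act_mx x.
Proof.
move=> Xx; apply: vec_ext => s; rewrite !mulmxA vec_act !vec_mxf Z_J //.
by case: ifP => _; rewrite ?mul0mx // bd_J.
Qed.

Lemma cone_J x a s : x \in X -> cone ('JG%act a x) (J x s) = cone a s *m act_mx x.
Proof.
move=> Xx; rewrite /cone memJ -J_setU1 Z_J //; case: ifP => _; last by rewrite mul0mx.
by rewrite /sgn below_J -scalemxAl vec_act.
Qed.

End ChainComplex.

(** * Contractions by acyclic carriers *)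

Section Contraction.
Variables (R : idomainType) (p : nat) (gT : finGroupType) (X : {group gT}).
Hypothesis char0 : forall n : nat, n%:R = 0 :> R -> n = 0%N.
Local Notation T := {set {group gT}}.
Local Notation n := #|{: T}|.
Local Notation Z := (pchains p X).
Local Notation J x s := ('JG^*%act s x).
Local Notation D := (boundary_mx R p X).
Local Notation bd := (boundary R).
Implicit Types (s : T) (P Q S : {group gT}).

Section AcyclicCarrier.
Variable B : T -> 'M[R]_n.

(* Contraction built by induction on the dimension: [B s] fills the cycles of the
   carrier of [s]. *)
Fixpoint contr_rec m s : 'rV[R]_n :=
  if m is m'.+1 then
    (vec s - \sum_(Q in s) sgn R Q s *: contr_rec m' (s :\ Q)) *m B s
  else 0.
Definition contr s := contr_rec #|s|.+1 s.

Lemma contrE s : contr s = (vec s - bd s *m mxf contr) *m B s.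
Proof.
rewrite /contr /=; congr ((_ - _) *m _); rewrite bd_mul; apply: eq_bigr => Q sQ.
by rewrite vec_mxf [in LHS](cardsD1 Q) sQ.
Qed.

Variables (L : {set T}) (Car : T -> {set T}).
Hypotheses (LZ : L \subset Z) (LD1 : forall s Q, s \in L -> Q \in s -> s :\ Q \in L).
Hypothesis CarI : forall s, s \in L -> s \in Car s.
Hypothesis CarD1 : forall s Q, s \in L -> Q \in s -> Car (s :\ Q) \subset Car s.
Hypothesis CarB : forall s m v, s \in L -> supp [set u in Car s | #|u| == m] v ->
  v *m D = 0 -> supp [set u in Car s | #|u| == m.+1] (v *m B s) /\ v *m B s *m D = v.

Lemma contrP s : s \in L ->
  supp [set u in Car s | #|u| == #|s|.+1] (contr s) /\
  contr s *m D + bd s *m mxf contr = vec s.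
Proof.
have [m] := ubnP #|s|; elim: m s => // m IH s; rewrite ltnS => sm Ls.
have Zs := subsetP LZ _ Ls.
have sD1 Q : Q \in s -> #|s| = #|s :\ Q|.+1 by move=> sQ; rewrite (cardsD1 Q) sQ.
have IHf Q : Q \in s -> supp [set u in Car s | #|u| == #|s|] (contr (s :\ Q)) /\
    contr (s :\ Q) *m D = vec (s :\ Q) - bd (s :\ Q) *m mxf contr.
  move=> sQ; have [|a b] := IH (s :\ Q) _ (LD1 Ls sQ); first by rewrite -sD1.
  split; last by rewrite -b addrK.
  apply: suppS a; apply/subsetP => u; rewrite !in_set -(sD1 Q sQ) => /andP[cu ->].
  by rewrite (subsetP (CarD1 Ls sQ)).
pose z := vec s - bd s *m mxf contr.
have zsupp : supp [set u in Car s | #|u| == #|s|] z.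
  apply: suppB; first by apply: supp_vec; rewrite in_set CarI // eqxx.
  rewrite bd_mul; apply: supp_sum => Q sQ; apply: suppZ; rewrite vec_mxf.
  by have [] := IHf Q sQ.
have zD : z *m D = 0.
  rewrite mulmxBl vec_D //; apply/eqP; rewrite subr_eq0; apply/eqP.
  transitivity (bd s - bd s *m D *m mxf contr).
    by rewrite (bd_bd char0) // mul0mx subr0.
  rewrite -!mulmxA !bd_mul [X in X - _]/boundary -sumrB; apply: eq_bigr => Q sQ; rewrite -scalerBr.
  congr (_ *: _); rewrite !mulmxA (vec_mxf contr) vec_D ?(pchain_sub Zs) ?subD1set //.
  by have [_ ->] := IHf Q sQ.
have [a b] := CarB Ls zsupp zD.
by rewrite contrE -/z; split; [exact: a | rewrite b /z subrK].
Qed.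

End AcyclicCarrier.

(** The recursion makes no choices, so the contraction inherits the equivariance of the fillings. *)
Lemma contr_J (B B' : T -> 'M[R]_n) x :
    (forall s, B' (J x s) = act_mx R x^-1%g *m B s *m act_mx R x) ->
  forall s, contr B' (J x s) = contr B s *m act_mx R x.
Proof.
move=> hB s; have [m] := ubnP #|s|; elim: m s => // m IH s; rewrite ltnS => sm.
rewrite !contrE hB !mulmxA; congr (_ *m _ *m _).
rewrite bd_J -vec_act.
suff -> : bd s *m act_mx R x *m mxf (contr B') = bd s *m mxf (contr B) *m act_mx R x.
  by rewrite -mulmxBl -!mulmxA act_mxK mulmx1.
rewrite -!mulmxA !bd_mul; apply: eq_bigr => Q sQ; congr (_ *: _).
rewrite !mulmxA vec_act !vec_mxf IH //.
by apply: leq_trans sm; rewrite [X in (_ < X)%N](cardsD1 Q) sQ.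
Qed.

Section FixedByS.
Variable S : {group gT}.

Definition fixed_chains : {set T} := [set s in Z | [forall Q in s, S \subset 'N(Q)]].

(* [Q S] for the largest member [Q] of [s] not containing [S], and [S] if there is
   none; it is comparable to all members of [s], see [apex_comparable]. *)
Definition apex s : {group gT} :=
  <<S :|: \bigcup_(Q in s | ~~ (S \subset Q)) Q>>%G.

(** The vertices of the zigzag [Q <= Q S >= S] started from the members of [s]. *)
Definition below_apex s U : bool := [|| U \in s, U == S |
  [exists Q in s, ~~ (S \subset Q) && (U == (Q <*> S)%G)]].

Definition carrier s : {set T} :=
  [set u in fixed_chains | [forall U in u, below_apex s U]].

Hypotheses (sSX : S \subset X) (pS : p.-group S) (S1 : S :!=: 1%g).

Lemma fixed_chainsP s : reflect (s \in Z /\ forall Q, Q \in s -> S \subset 'N(Q))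
  (s \in fixed_chains).
Proof.
rewrite [X in reflect _ X]in_set.
by apply: (iffP andP) => -[Zs h]; split=> //; apply/forall_inP.
Qed.

Lemma fixed_chains_sub s s' : s \in fixed_chains -> s' \subset s -> s' \in fixed_chains.
Proof.
move=> /fixed_chainsP[Zs nS] sub; apply/fixed_chainsP; split; first exact: pchain_sub Zs sub.
by move=> Q /(subsetP sub); apply: nS.
Qed.

Lemma apex_sub s : S \subset apex s.
Proof. exact: subset_trans (subsetUl _ _) (subset_gen _). Qed.

Lemma apex_bigcup s Q : Q \in s -> ~~ (S \subset Q) -> Q \subset apex s.
Proof.
move=> sQ SQ; apply: subset_trans (subset_gen _); apply: subset_trans (subsetUr _ _).
by apply: (bigcup_sup Q); rewrite sQ.
Qed.

Lemma apex_comparable s U : s \in fixed_chains -> below_apex s U ->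
  (U \subset apex s) || (apex s \subset U).
Proof.
move=> /fixed_chainsP[Zs nS]; case/or3P => [sU|/eqP->|/exists_inP[Q sQ /andP[SQ /eqP->]]].
- have [SU|SU] := boolP (S \subset U); last first.
    by rewrite apex_bigcup.
  apply/orP; right; rewrite gen_subG subUset SU /=; apply/bigcupsP => Q /andP[sQ SQ].
  have /orP[//|UQ] := pchain_tot Zs sQ sU.
  by rewrite (subset_trans SU UQ) in SQ.
- by rewrite apex_sub.
by apply/orP; left; rewrite [_ \subset _]join_subG (apex_bigcup sQ SQ) apex_sub.
Qed.

Lemma apex_below s : s \in fixed_chains -> below_apex s (apex s).
Proof.
move=> /fixed_chainsP[Zs nS].
case: (pickP (fun Q : {group gT} => (Q \in s) && ~~ (S \subset Q))) => [Q0 /andP[sQ0 SQ0]|none]; last first.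
  apply/or3P/Or32/eqP/val_inj => /=; rewrite big_pred0 ?setU0 ?genGid //.
pose Q := [arg max_(Q > Q0 | (Q \in s) && ~~ (S \subset Q)) #|Q|].
have [sQ SQ maxQ] : [/\ Q \in s, ~~ (S \subset Q) &
    forall P, P \in s -> ~~ (S \subset P) -> (#|P| <= #|Q|)%N].
  rewrite /Q; case: arg_maxnP => [|U /andP[sU SU] maxU]; first by rewrite sQ0.
  by split=> // P sP SP; apply: maxU; rewrite sP.
apply/or3P/Or33/exists_inP; exists Q => //; rewrite SQ; apply/eqP/val_inj => /=.
have le : (Q <*> S)%g \subset apex s by rewrite join_subG apex_bigcup // apex_sub.
apply/eqP; rewrite eqEsubset; apply/andP; split; last exact: le.
rewrite gen_subG subUset joing_subr; apply/bigcupsP => P /andP[sP SP].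
apply: subset_trans (joing_subl _ _).
have /orP[//|QP] := pchain_tot Zs sP sQ.
suff -> : P :=: Q by [].
by apply/eqP; rewrite eq_sym eqEcard QP maxQ.
Qed.

Lemma below_apex_group s U : s \in fixed_chains -> below_apex s U ->
  [/\ U \subset X, p.-group U, U :!=: 1%g & S \subset 'N(U)].
Proof.
move=> /fixed_chainsP[Zs nS]; case/or3P => [sU|/eqP->|/exists_inP[Q sQ /andP[SQ /eqP->]]].
- by have [] := pchain_mem Zs sU; split=> //; apply: nS.
- by split=> //; apply: normG.
have [QX pQ Q1] := pchain_mem Zs sQ; split.
- by rewrite /= join_subG QX.
- by rewrite /= norm_joinEr ?nS // pgroupM pQ.
- by apply: contraNneq S1 => /= e; rewrite -subG1 -e joing_subr.
by apply: subset_trans (normG _); rewrite /= joing_subr.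
Qed.

Lemma apex_carrier s u : s \in fixed_chains -> u \in carrier s ->
  apex s |: u \in carrier s.
Proof.
move=> Ls; rewrite in_set => /andP[/fixed_chainsP[Zu nSu] /forall_inP bu].
have ba := apex_below Ls; have [aX pa a1 nSa] := below_apex_group Ls ba.
rewrite in_set; apply/andP; split.
  apply/fixed_chainsP; split; last by move=> Q /setU1P[->|/nSu].
  apply: pchainP => [Q /setU1P[->|/(pchain_mem Zu)]//|P Q].
  move=> /setU1P[->|uP] /setU1P[->|uQ]; first by rewrite subxx.
  - by rewrite orbC; apply: apex_comparable => //; apply: bu.
  - by apply: apex_comparable => //; apply: bu.
  exact: pchain_tot Zu uP uQ.
by apply/forall_inP => U /setU1P[->|/bu].
Qed.

Definition kS s : 'rV[R]_n := contr (fun s => mxf (cone R p X (apex s))) s.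
Definition KS : 'M[R]_n := mxf kS.

(** All vertices of [carrier s] are comparable to [apex s], itself one of them; so this carrier is a
    cone, and the cone homotopy fills its cycles. *)
Lemma kSP s : s \in fixed_chains ->
  supp [set u in carrier s | #|u| == #|s|.+1] (kS s) /\
  kS s *m D + bd s *m KS = vec s.
Proof.
apply: (@contrP _ fixed_chains carrier).
- by apply/subsetP => u /fixed_chainsP[].
- by move=> {}s Q Ls sQ; apply: fixed_chains_sub Ls (subD1set _ _).
- move=> {}s Ls; rewrite in_set Ls; apply/forall_inP => U sU.
  by rewrite /below_apex sU.
- move=> {}s Q Ls sQ; apply/subsetP => u; rewrite !in_set => /andP[-> /forall_inP bu].
  apply/forall_inP => U /bu; rewrite /below_apex !inE.
  case/or3P => [/andP[_ ->]//|->|/exists_inP[P]]; first by rewrite orbT.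
  rewrite !inE => /andP[_ sP] h; apply/or3P/Or33/exists_inP; by exists P.
move=> {}s m v Ls vs vD.
have inC u : u \in [set u in carrier s | #|u| == m] -> u \in carrier s /\ #|u| = m.
  by rewrite in_set => /andP[? /eqP].
split.
  apply: supp_mul vs _ => u /inC[cu um]; rewrite vec_mxf /cone.
  case: ifP => [/andP[au _]|_]; last exact: supp0.
  apply/suppZ/supp_vec; rewrite in_set apex_carrier //.
  by rewrite cardsU1 au um add1n eqxx.
set C := mxf _; transitivity (v *m (C *m D + D *m C)).
  by rewrite mulmxDr [v *m (D *m C)]mulmxA vD mul0mx addr0 mulmxA.
rewrite -[RHS]mulmx1; apply: supp_ext vs _ => u /inC[cu um].
have Zu : u \in Z by move: cu; rewrite in_set => /andP[/fixed_chainsP[]].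
rewrite mulmxDr !mulmxA vec_mxf vec_D // mulmx1; apply: coneP => //.
by have := apex_carrier Ls cu; rewrite in_set => /andP[/fixed_chainsP[]].
Qed.

Lemma KSP m v : supp [set u in fixed_chains | #|u| == m] v -> v *m D = 0 ->
  supp [set u in fixed_chains | #|u| == m.+1] (v *m KS) /\ v *m KS *m D = v.
Proof.
move=> vs vD.
have inC u : u \in [set u in fixed_chains | #|u| == m] -> u \in fixed_chains /\ #|u| = m.
  by rewrite in_set => /andP[? /eqP].
split.
  apply: supp_mul vs _ => u /inC[cu um]; rewrite vec_mxf.
  have [a _] := kSP cu; apply: suppS a; apply/subsetP => u'.
  rewrite in_set um => /andP[cu' cm].
  by have /setIdP[fu' _] := cu'; rewrite in_set fu' cm.
transitivity (v *m (KS *m D + D *m KS)).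
  by rewrite mulmxDr [v *m (D *m KS)]mulmxA vD mul0mx addr0 mulmxA.
rewrite -[RHS]mulmx1; apply: supp_ext vs _ => u /inC[cu um].
have [Zu _] := fixed_chainsP _ cu.
by rewrite mulmxDr !mulmxA vec_mxf vec_D // mulmx1; have [_ ->] := kSP cu.
Qed.

End FixedByS.

Lemma apex_J S x s : apex ('JG%act S x) (J x s) = 'JG%act (apex S s) x.
Proof.
apply/val_inj; rewrite /= -genJ; congr <<_>>; rewrite conjUg; congr (_ :|: _).
rewrite (reindex_inj (act_inj 'JG x)) /=.
apply/setP => y; rewrite mem_conjg; apply/bigcupP/bigcupP => -[Q].
  rewrite memJ conjSg => hQ; rewrite mem_conjg => yQ; by exists Q.
by move=> hQ yQ; exists Q; [rewrite memJ conjSg | rewrite mem_conjg].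
Qed.

Lemma KS_J S x : x \in X ->
  KS ('JG%act S x) = act_mx R x^-1%g *m KS S *m act_mx R x.
Proof.
move=> Xx; apply: vec_ext => s; rewrite !mulmxA vec_act !vec_mxf.
rewrite -[s in LHS](actKV 'JG^* x) /kS; apply: contr_J => {}s.
apply: vec_ext => u; rewrite apex_J !mulmxA vec_act !vec_mxf -cone_J //.
by rewrite actKV.
Qed.

End Contraction.

(** * An equivariant contraction up to a relative trace *)

Section Webb.
Variables (R : idomainType) (p : nat) (gT : finGroupType) (X P : {group gT}).
Hypothesis char0 : forall n : nat, n%:R = 0 :> R -> n = 0%N.
Hypotheses (sPX : P \subset X) (pP : p.-group P).
Local Notation T := {set {group gT}}.
Local Notation n := #|{: T}|.
Local Notation Z := (pchains p X).
Local Notation J x s := ('JG^*%act s x).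
Local Notation D := (boundary_mx R p X).
Local Notation bd := (boundary R).
Local Notation act_mx := (act_mx R).
Implicit Types (s : T) (Q S : {group gT}).

(** Two members of a chain with the same order are equal, so an element that stabilizes the chain
    fixes each member. *)
Lemma chain_stab_norm s x : s \in Z -> J x s = s -> forall Q, Q \in s -> x \in 'N(Q).
Proof.
move=> Zs sx Q sQ; have sQx : 'JG%act Q x \in s by rewrite -sx memJ.
have c : #|'JG%act Q x| = #|Q| by rewrite /= cardJg.
rewrite inE; case/orP: (pchain_tot Zs sQ sQx) => [h|//].
by have /eqP <- : Q :==: (Q :^ x)%g by rewrite eqEcard h -c leqnn.
Qed.

Definition st s : {group gT} := 'C_P[s | 'JG^*]%G.

Lemma stP s x : reflect (x \in P /\ J x s = s) (x \in st s).
Proof. by apply: (iffP setIP) => -[Px /astab1P]. Qed.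

Lemma stJ s x : x \in P -> st (J x s) = 'JG%act (st s) x.
Proof.
move=> Px; apply/val_inj/setP => y; rewrite [in RHS]mem_conjg; apply/stP/stP => -[].
  move=> Py e; split; first by rewrite groupJr ?groupV.
  by rewrite /conjg invgK !actM e actK.
move=> Py e; split; first by rewrite -(groupJr _ (groupVr Px)).
by rewrite -[y in LHS](conjgKV x) conjgE -actM mulKVg actM e.
Qed.

Lemma st_fixed s : s \in Z -> s \in fixed_chains p X (st s).
Proof.
move=> Zs; apply/fixed_chainsP; split=> // Q sQ; apply/subsetP => x /stP[_ sx].
exact: chain_stab_norm sx Q sQ.
Qed.

Lemma st_D1 s Q : s \in Z -> Q \in s -> st s \subset st (s :\ Q).
Proof.
move=> Zs sQ; apply/subsetP => x /stP[Px sx]; apply/stP; split=> //.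
rewrite J_setD1 sx; congr (_ :\ _); apply/val_inj => /=.
by apply: normP; apply: chain_stab_norm sx Q sQ.
Qed.

Definition nonfree : {set T} := [set s in Z | st s :!=: 1%g].

Lemma nonfree_D1 s Q : s \in nonfree -> Q \in s -> s :\ Q \in nonfree.
Proof.
case/setIdP=> Zs ss1 sQ; rewrite in_set (pchain_sub Zs) ?subD1set //=.
by apply: contra ss1 => /eqP e; rewrite -subG1 -e st_D1.
Qed.

(** A second acyclic carrier: that of [s] is the complex of the chains normalized by [st s], which
    [KS] contracts. It grows with [s], because deleting a member enlarges the stabilizer. *)
Definition webb_contr := contr (fun s => KS R p X (st s)).
Definition webb_mx : 'M[R]_n :=
  mxf (fun s => if s \in nonfree then webb_contr s else 0).

Lemma webb_contrP s : s \in nonfree ->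
  supp [set u in Z | #|u| == #|s|.+1] (webb_contr s) /\
  webb_contr s *m D + bd s *m mxf webb_contr = vec s.
Proof.
move=> Ls.
suff [a b] : supp [set u in fixed_chains p X (st s) | #|u| == #|s|.+1] (webb_contr s) /\
    webb_contr s *m D + bd s *m mxf webb_contr = vec s.
  split=> //; apply: suppS a; apply/subsetP => u /setIdP[/fixed_chainsP[Zu _] c].
  by rewrite in_set Zu c.
move: Ls; apply: (@contrP _ _ _ X char0 _ nonfree (fun s => fixed_chains p X (st s))).
- by apply/subsetP => u /setIdP[].
- exact: nonfree_D1.
- by move=> u /setIdP[Zu _]; apply: st_fixed.
- move=> u Q /setIdP[Zu _] uQ; apply/subsetP => c /fixed_chainsP[Zc h].
  apply/fixed_chainsP; split=> // S cS.
  exact: subset_trans (st_D1 Zu uQ) (h S cS).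
move=> u m v /setIdP[Zu u1]; apply: KSP => //.
  exact: subset_trans (subsetIl _ _) sPX.
exact: pgroupS (subsetIl _ _) pP.
Qed.

Lemma webb_supp s : supp [set u in Z | #|u| == #|s|.+1] (vec s *m webb_mx).
Proof.
rewrite vec_mxf; case: ifP => [Ls|_]; last exact: supp0.
by have [] := webb_contrP Ls.
Qed.

Lemma webb_out s : s \notin Z -> vec s *m webb_mx = 0.
Proof. by move=> Zs; rewrite vec_mxf inE /= (negPf Zs). Qed.

Lemma nonfree_J s x : x \in P -> (J x s \in nonfree) = (s \in nonfree).
Proof.
move=> Px; rewrite [LHS]in_set [RHS]in_set Z_J ?(subsetP sPX) // stJ //=.
by rewrite conjsg_eq1.
Qed.

Lemma webb_act x : x \in P -> act_mx x *m webb_mx = webb_mx *m act_mx x.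
Proof.
move=> Px; apply: vec_ext => s; rewrite !mulmxA vec_act !vec_mxf nonfree_J //.
case: (s \in nonfree); last exact: esym (mul0mx _ _).
have Xx := subsetP sPX _ Px.
apply: contr_J => u; rewrite stJ //; exact: KS_J.
Qed.

End Webb.
Arguments webb_supp {R p gT X P} _ _ _ s.

Section WebbLocal.
Variables (R : idomainType) (p : nat) (gT : finGroupType) (X P : {group gT}).
Hypothesis char0 : forall n : nat, n%:R = 0 :> R -> n = 0%N.
Hypotheses (sPX : P \subset X) (pP : p.-group P).
Local Notation T := {set {group gT}}.
Local Notation n := #|{: T}|.
Local Notation Z := (pchains p X).
Local Notation J x s := ('JG^*%act s x).
Local Notation D := (boundary_mx R p X).
Local Notation act_mx := (act_mx R).
Local Notation hP := (webb_mx R p X P).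
Implicit Types (s : T) (Q S : {group gT}).

Definition chain_proj : 'M[R]_n := mxf (fun s => if s \in Z then vec s else 0).
Local Notation Pi := chain_proj.

Lemma Pi_act x : x \in X -> act_mx x *m Pi = Pi *m act_mx x.
Proof.
move=> Xx; apply: vec_ext => s; rewrite !mulmxA vec_act !vec_mxf Z_J //.
by case: (s \in Z); rewrite ?vec_act ?mul0mx.
Qed.

Lemma D_out s : s \notin Z -> vec s *m D = 0.
Proof. by move=> /negPf Zs; rewrite vec_mxf Zs. Qed.

Lemma D_supp s : supp [set u in Z | #|u|.+1 == #|s|] (vec s *m D).
Proof.
rewrite vec_mxf; case: (boolP (s \in Z)) => Zs; last exact: supp0.
apply: supp_sum => Q sQ; apply/suppZ/supp_vec.
by rewrite in_set (pchain_sub Zs) ?subD1set //= [X in _ == X](cardsD1 Q) sQ.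
Qed.

Arguments D_supp s : clear implicits.

Definition contr_defect : 'M[R]_n := Pi - hP *m D - D *m hP.
Local Notation theta := contr_defect.

Lemma theta0 s : s \notin Z :\: nonfree p X P -> vec s *m theta = 0.
Proof.
rewrite in_setD negb_and negbK => /orP[Ls|Zs]; last first.
  by rewrite !mulmxBr !mulmxA D_out // webb_out // vec_mxf (negPf Zs) !mul0mx !subr0.
have [Zs _] := setIdP Ls; have [_ e] := webb_contrP char0 sPX pP Ls.
rewrite !mulmxBr !mulmxA vec_D // [vec s *m Pi]vec_mxf Zs [vec s *m hP]vec_mxf Ls.
suff -> : boundary R s *m hP = boundary R s *m mxf (webb_contr R p X P).
  by rewrite -addrA -opprD e subrr.
rewrite !bd_mul; apply: eq_bigr => Q sQ; congr (_ *: _).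
by rewrite !vec_mxf nonfree_D1.
Qed.

Lemma theta_act x : x \in P -> act_mx x *m theta = theta *m act_mx x.
Proof.
move=> Px; have Xx := subsetP sPX _ Px.
rewrite !mulmxBr !mulmxBl Pi_act // -!mulmxA -D_act // -webb_act //.
by rewrite !mulmxA webb_act // D_act.
Qed.

Lemma theta_supp s : supp [set u in Z | odd #|u| == odd #|s|] (vec s *m theta).
Proof.
have sub (A B : {set T}) v : supp A v -> (forall u, u \in A -> u \in B) -> supp B v.
  by move=> h AB; apply: suppS h; apply/subsetP.
rewrite !mulmxBr; apply: suppB; first apply: suppB.
- rewrite vec_mxf; case: (boolP (s \in Z)) => Zs; last exact: supp0.
  by apply: supp_vec; rewrite in_set Zs eqxx.
- rewrite mulmxA; apply: supp_mul (webb_supp char0 sPX pP s) _ => u /setIdP[Zu /eqP us].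
  apply: sub (D_supp u) _ => w /setIdP[Zw /eqP wu]; rewrite in_set Zw /=.
  by move: wu; rewrite us => -[->].
rewrite mulmxA; apply: supp_mul (D_supp s) _ => u /setIdP[Zu /eqP us].
apply: sub (webb_supp char0 sPX pP u) _ => w /setIdP[Zw /eqP wu]; rewrite in_set Zw /=.
by rewrite wu us.
Qed.

Definition free_reps : {set T} := orbit_transversal 'JG^*%act P (Z :\: nonfree p X P).

Definition free_part : 'M[R]_n := mxf (fun s => if s \in free_reps then vec s *m theta else 0).
Local Notation phi := free_part.

Lemma phi_supp s : supp [set u in Z | odd #|u| == odd #|s|] (vec s *m phi).
Proof.
rewrite vec_mxf; case: (s \in free_reps); [exact: theta_supp | exact: supp0].
Qed.

Arguments theta_supp s : clear implicits.

(** [theta] vanishes outside the chains on which [P] acts freely, so it is the relative trace of its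
    restriction to orbit representatives. *)
Lemma theta_free : theta = \sum_(x in P) act_mx x *m phi *m act_mx x^-1%g.
Proof.
apply: vec_ext => s; rewrite mulmx_sumr.
have term x : x \in P -> vec s *m (act_mx x *m phi *m act_mx x^-1%g) =
    if J x s \in free_reps then vec s *m theta else 0.
  move=> Px; rewrite !mulmxA vec_act vec_mxf.
  case: (J x s \in free_reps); last exact: mul0mx.
  by rewrite -vec_act -!mulmxA -theta_act ?groupV // [act_mx x *m (_ *m _)]mulmxA act_mxK mul1mx.
rewrite (eq_bigr _ term) -big_mkcondr /=.
have [Fs|Fs] := boolP (s \in Z :\: nonfree p X P); last first.
  by rewrite theta0 // big1.
have actF : [acts P, on Z :\: nonfree p X P | 'JG^*].
  apply/actsP => x Px u; rewrite !in_setD nonfree_J // Z_J //.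
  exact: (subsetP sPX).
have [_ _ injF covF] := orbit_transversalP actF.
have [x0 Px0 Fx0] := covF s Fs.
rewrite (big_pred1 x0) // => x; apply/andP/eqP => [[Px Fx]|-> //].
have := injF _ _ Fx0 Fx; rewrite orbit_sym orbit_actr // orbit_sym mem_orbit //.
move/esym/eqP => e.
have ss1 : (x * x0^-1)%g \in st P s.
  by apply/stP; split; [rewrite groupM ?groupV | exact: etrans (etrans (actM _ _ _ _) (congr1 (fun u => J x0^-1%g u) (esym e))) (actK _ _ _)].
move: Fs; rewrite in_setD => /andP[+ Zs]; rewrite in_set Zs /= negbK => /eqP st1.
have : (x * x0^-1)%g \in (1%g : {set gT}) by rewrite -st1.
move=> /set1P/eqP; by rewrite -eq_mulgV1 => /eqP.
Qed.

End WebbLocal.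
Arguments D_supp {R p gT X} s.
Arguments phi_supp {R p gT X P} _ _ _ s.

Section WebbGlobal.
Variables (p : nat) (R : idomainType) (F : fieldType).
Variables (red : {rmorphism R -> F}) (t : R) (pmt : pmodular p red t).
Variables (gT : finGroupType) (X : {group gT}).
Local Notation T := {set {group gT}}.
Local Notation n := #|{: T}|.
Local Notation Z := (pchains p X).
Local Notation D := (boundary_mx R p X).
Local Notation Pi := (chain_proj R p X).
Local Notation act_mx := (act_mx R).

(** The relative trace for the action on the whole free module; [blk_trG] turns it into [trG] on
    each parity. *)
Definition conj_sum (A : {set gT}) (M : 'M[R]_n) : 'M[R]_n :=
  \sum_(x in A) act_mx x *m M *m act_mx x^-1%g.

Lemma conj_sum_act M y : y \in X -> act_mx y *m conj_sum X M = conj_sum X M *m act_mx y.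
Proof.
move=> Xy; rewrite mulmx_sumr mulmx_suml [RHS](reindex_inj (mulgI y)) /=.
apply: eq_big => [x|x Xx]; first by rewrite groupMl.
have e : act_mx (y * x)^-1%g *m act_mx y = act_mx x^-1%g.
  by rewrite act_mxM invMg mulgKV.
by rewrite -[RHS]mulmxA e -(act_mxM R y x) !mulmxA.
Qed.

(** Add up the conjugates of [webb_mx] by coset representatives of a Sylow subgroup [P] and divide
    by the index, which is a unit of [R]. The defect, a relative trace from 1 to [P], becomes one
    from 1 to [X]. *)
Lemma webb_contraction : exists H phi0 : 'M[R]_n,
  [/\ forall x, x \in X -> act_mx x *m H = H *m act_mx x,
      forall s : T, supp [set u in Z | #|u| == #|s|.+1] (vec s *m H),
      forall s : T, s \notin Z -> vec s *m H = 0,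
      forall s : T, supp [set u in Z | odd #|u| == odd #|s|] (vec s *m phi0) &
      H *m D + D *m H = Pi - conj_sum X phi0].
Proof.
have char0 := pm_char0 pmt.
have [P] := Sylow_exists p X; rewrite pHallE => /andP[sPX /eqP oP].
have p_pr : prime p by have := pm_charp pmt; rewrite inE => /andP[].
have pP : p.-group P by rewrite /pgroup oP part_pnat.
pose w := webb_mx R p X P; pose k := #|X : P|.
pose c : R := k%:R^-1.
have ck : c * k%:R = 1.
  rewrite mulVr // (red_unit pmt) rmorph_nat -(dvdn_pcharf (pm_charp pmt)).
  by rewrite /k -divgS // oP -{1}(partnC p (cardG_gt0 X)) mulKn ?part_gt0 // -p'natE // part_pnat.
pose r (C : {set gT}) := act_mx (fingroup.repr C).
pose r' (C : {set gT}) := act_mx (fingroup.repr C)^-1%g.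
have rX C : C \in lcosets P X -> fingroup.repr C \in X.
  case/lcosetsP=> y Xy ->; have : fingroup.repr (y *: P)%g \in (y *: P)%g.
    by rewrite (mem_repr y) ?lcoset_refl.
  by case/lcosetP=> z Pz ->; rewrite groupM // (subsetP sPX).
pose Hs := \sum_(C in lcosets P X) r C *m w *m r' C.
have coset_sum M : conj_sum X M =
    \sum_(C in lcosets P X) r C *m conj_sum P M *m r' C.
  rewrite /conj_sum (big_lcosets _ sPX); apply: eq_bigr => C _.
  rewrite mulmx_sumr mulmx_suml; apply: eq_bigr => h _.
  by rewrite invMg -(act_mxM _ _ h) -(act_mxM _ h^-1%g) /r /r' !mulmxA.
have wP : conj_sum P w = #|P|%:R *: w.
  rewrite /conj_sum (eq_bigr (fun=> w)) ?sumr_const ?scaler_nat // => x Px.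
  by rewrite webb_act // -mulmxA act_mxK mulmx1.
(* Multiplication by [|P|] replaces the sum over cosets by one over [X], where equivariance is
   clear; [|P|] is then cancelled, not inverted. *)
have HsE : #|P|%:R *: Hs = conj_sum X w.
  rewrite coset_sum wP scaler_sumr; apply: eq_bigr => C _.
  by rewrite -scalemxAr -scalemxAl.
have Pinj (M N : 'M[R]_n) : #|P|%:R *: M = #|P|%:R *: N -> M = N.
  move=> /matrixP e; apply/matrixP => i j; have := e i j; rewrite !mxE.
  by apply: mulfI; apply/eqP => /char0/eqP; rewrite -leqn0 leqNgt cardG_gt0.
have HsA x : x \in X -> act_mx x *m Hs = Hs *m act_mx x.
  move=> Xx; apply: Pinj; rewrite scalemxAr HsE scalemxAl HsE.
  exact: conj_sum_act.
have wsupp C (s : T) : C \in lcosets P X ->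
    supp [set u in Z | #|u| == #|s|.+1] (vec s *m (r C *m w *m r' C)).
  move=> CX; rewrite !mulmxA vec_act; apply: supp_mul (webb_supp char0 sPX pP _) _.
  move=> u /setIdP[Zu /eqP us]; rewrite vec_act; apply: supp_vec.
  by rewrite in_set Z_J ?groupV ?rX // Zu card_J us card_J /=.
have kE : k%:R *: Pi - Hs *m D - D *m Hs = conj_sum X (free_part R p X P).
  rewrite coset_sum /conj_sum -theta_free //.
  have -> : k%:R *: Pi = \sum_(C in lcosets P X) r C *m Pi *m r' C.
    rewrite (eq_bigr (fun=> Pi)) ?sumr_const ?card_lcosets ?scaler_nat // => C CX.
    by rewrite Pi_act ?rX // -mulmxA act_mxK mulmx1.
  rewrite mulmx_suml mulmx_sumr -!sumrB; apply: eq_bigr => C CX.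
  have e1 : r C *m w *m r' C *m D = r C *m (w *m D) *m r' C.
    by rewrite -[LHS]mulmxA (D_act _ _ (groupVr (rX C CX))) !mulmxA.
  have e2 : D *m (r C *m w *m r' C) = r C *m (D *m w) *m r' C.
    by rewrite !mulmxA -(D_act _ _ (rX C CX)).
  by rewrite e1 e2 /contr_defect !mulmxBr !mulmxBl.
exists (c *: Hs), (c *: free_part R p X P); split.
- by move=> x Xx; rewrite -scalemxAr HsA // -scalemxAl.
- move=> s; rewrite -scalemxAr; apply: suppZ; rewrite mulmx_sumr.
  by apply: supp_sum => C CX; apply: wsupp.
- move=> s Zs; rewrite -scalemxAr mulmx_sumr big1 ?scaler0 // => C CX.
  by rewrite !mulmxA vec_act webb_out ?mul0mx // Z_J ?rX.
- by move=> s; rewrite -scalemxAr; apply: suppZ; apply: phi_supp.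
have -> : conj_sum X (c *: free_part R p X P) = c *: conj_sum X (free_part R p X P).
  rewrite /conj_sum scaler_sumr; apply: eq_bigr => x _.
  by rewrite -scalemxAr -scalemxAl.
rewrite -kE !scalerBr scalerA ck scale1r -scalemxAl -scalemxAr.
by apply/matrixP => i j; rewrite !mxE; ring.
Qed.

End WebbGlobal.

(** * From the contraction to the Steinberg module *)

Section ParityBlocks.
Variables (R : idomainType) (p : nat) (gT : finGroupType) (X : {group gT}).
Local Notation T := {set {group gT}}.
Local Notation n := #|{: T}|.
Local Notation Z := (pchains p X).
Local Notation act_mx := (act_mx R).
Local Notation J s x := ('JG^*%act s x).

Definition par_chains (b : bool) : {set T} := [set s in Z | odd_chain s == b].

Lemma par_chains_acts b : [acts X, on par_chains b | 'JG^*].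
Proof. exact: (par_invP (eq_op^~ b) (pchains_inv p X)). Qed.

Lemma steinberg_gperm : steinberg R p X =
  gclass (gperm R (par_chains_acts false)) - gclass (gperm R (par_chains_acts true)).
Proof.
rewrite steinbergE /spcl -(pclE R (par_chains_acts false)) -(pclE R (par_chains_acts true)).
congr (_ - _); congr (pcl R _ X _); apply/setP => s;
  by rewrite [LHS]in_set [RHS]in_set; case: odd_chain.
Qed.

Definition blk_in b : 'M[R]_(#|par_chains b|, n) := \matrix_i vec (enum_val i).
Definition blk_out b : 'M[R]_(n, #|par_chains b|) :=
  \matrix_(i, j) (enum_val i == enum_val j)%:R.

Lemma blk_inK b : blk_in b *m blk_out b = 1%:M.
Proof.
apply/row_matrixP => i; rewrite row_mul rowK -rowE; apply/rowP => j.
by rewrite !mxE enum_rankK (inj_eq enum_val_inj).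
Qed.

Lemma blk_outK b (v : 'rV[R]_n) : supp (par_chains b) v -> v *m blk_out b *m blk_in b = v.
Proof.
move=> hv; rewrite -mulmxA -[RHS]mulmx1; apply: supp_ext hv _ => s bs.
rewrite mulmx1 mulmxA; transitivity ((delta_mx 0 (enum_rank_in bs s) : 'rV[R]_#|par_chains b|) *m blk_in b); last first.
  by rewrite -rowE rowK enum_rankK_in.
congr (_ *m _); rewrite -rowE; apply/rowP => j; rewrite !mxE enum_rankK eqxx /=.
by rewrite eq_sym -(inj_eq enum_val_inj) enum_rankK_in.
Qed.

Lemma blk_in_act b x : x \in X ->
  gperm R (par_chains_acts b) x *m blk_in b = blk_in b *m act_mx x.
Proof.
move=> Xx; apply/row_matrixP => i; rewrite [LHS]row_mul [RHS]row_mul [in RHS]rowK vec_act.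
have bs : J (enum_val i) x \in par_chains b.
  by rewrite (acts_act (par_chains_acts b)) ?enum_valP.
transitivity ((delta_mx 0 (enum_rank_in bs (J (enum_val i) x)) : 'rV[R]_#|par_chains b|) *m blk_in b).
  congr (_ *m _); apply/rowP => j; rewrite !mxE eqxx /=.
  by rewrite [in RHS]eq_sym -(inj_eq enum_val_inj) enum_rankK_in.
by rewrite -rowE rowK enum_rankK_in.
Qed.

Lemma blk_out_act b x : x \in X ->
  act_mx x *m blk_out b = blk_out b *m gperm R (par_chains_acts b) x.
Proof.
move=> Xx; apply: vec_ext => s; rewrite !mulmxA vec_act.
have [bs|bs] := boolP (s \in par_chains b); last first.
  have out u : u \notin par_chains b -> vec u *m blk_out b = 0.
    move=> bu; rewrite -rowE; apply/rowP => j; rewrite !mxE enum_rankK.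
    by case: eqP => // e; rewrite e enum_valP in bu.
  by rewrite !out ?mul0mx // (acts_act (par_chains_acts b)).
have e u : u \in par_chains b -> u = enum_val (enum_rank_in bs u).
  by move=> bu; rewrite enum_rankK_in.
have ve i : vec (enum_val i) = (delta_mx 0 i : 'rV[R]_#|par_chains b|) *m blk_in b by rewrite -rowE rowK.
have bsx : J s x \in par_chains b by rewrite (acts_act (par_chains_acts b)).
rewrite -vec_act (e s bs) ve -[_ *m _ *m act_mx x]mulmxA -blk_in_act // -!mulmxA.
by rewrite blk_inK mulmx1 [blk_in b *m _]mulmxA blk_inK mul1mx.
Qed.

Definition par_mx c (M : 'M[R]_n) :=
  forall s : T, s \in Z -> supp (par_chains (odd_chain s (+) c)) (vec s *m M).

Lemma par_mx1 : par_mx false 1%:M.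
Proof. by move=> s Zs; rewrite mulmx1 addbF; apply: supp_vec; rewrite in_set Zs eqxx. Qed.

Lemma par_mxD c M N : par_mx c M -> par_mx c N -> par_mx c (M + N).
Proof. by move=> hM hN s Zs; rewrite mulmxDr; apply: suppD; [apply: hM | apply: hN]. Qed.

Lemma par_mxN c M : par_mx c M -> par_mx c (- M).
Proof. by move=> hM s Zs; rewrite -scaleN1r -scalemxAr; apply/suppZ/hM. Qed.

Lemma par_mxM c d M N : par_mx c M -> par_mx d N -> par_mx (c (+) d) (M *m N).
Proof.
move=> hM hN s Zs; rewrite mulmxA; apply: supp_mul (hM s Zs) _ => u /setIdP[Zu /eqP us].
by rewrite addbA -us; apply: hN.
Qed.

Lemma blk_in_par b c M : par_mx c M ->
  blk_in b *m M *m blk_out (b (+) c) *m blk_in (b (+) c) = blk_in b *m M.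
Proof.
move=> hM; apply/row_matrixP => i; rewrite -!mulmxA [LHS]row_mul [RHS]row_mul rowK.
rewrite !mulmxA blk_outK //.
have /setIdP[Zs /eqP e] := enum_valP i.
by have := hM _ Zs; rewrite e.
Qed.

Lemma blk_hom b c M : (forall x, x \in X -> act_mx x *m M = M *m act_mx x) ->
  @ghom _ _ _ (gperm R (par_chains_acts b)) (gperm R (par_chains_acts c))
    (blk_in b *m M *m blk_out c).
Proof.
move=> hM x Xx; rewrite !mulmxA blk_in_act // -!mulmxA -blk_out_act // !mulmxA.
by rewrite -[blk_in b *m _ *m M]mulmxA hM // mulmxA.
Qed.

Lemma blk_trG b M : blk_in b *m conj_sum X M *m blk_out b =
  @trG _ _ _ (gperm R (par_chains_acts b)) (gperm R (par_chains_acts b))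
    (blk_in b *m M *m blk_out b).
Proof.
rewrite /conj_sum mulmx_sumr mulmx_suml /trG (reindex_inj invg_inj) /=.
apply: eq_big => [x|x]; rewrite groupV // => Xx.
rewrite invgK !mulmxA -(blk_in_act b (groupVr Xx)) -!mulmxA; congr (_ *m _).
by rewrite blk_out_act.
Qed.

End ParityBlocks.

Section SteinbergProjective.
Variables (p : nat) (R : idomainType) (F : fieldType).
Variables (red : {rmorphism R -> F}) (t : R) (pmt : pmodular p red t).
Variables (gT : finGroupType) (X : {group gT}).
Local Notation T := {set {group gT}}.
Local Notation n := #|{: T}|.
Local Notation Z := (pchains p X).
Local Notation D := (boundary_mx R p X).
Local Notation Pi := (chain_proj R p X).
Local Notation act_mx := (act_mx R).

Lemma graded_nilpotent (A : 'M[R]_n) :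
    (forall s : T, supp [set u in Z | #|u| == #|s|.+2] (vec s *m A)) ->
    (forall s : T, s \notin Z -> vec s *m A = 0) ->
  exists N, A ^+ N = 0.
Proof.
move=> hA A0; exists #|{: {group gT}}|.+1.
have pow k (s : T) : s \in Z -> supp [set u in Z | (#|s| + k <= #|u|)%N] (vec s *m A ^+ k).
  move=> Zs; elim: k => [|k IH].
    by rewrite expr0 mulmx1; apply: supp_vec; rewrite in_set Zs addn0 leqnn.
  rewrite exprSr mulmxA; apply: supp_mul IH _ => u /setIdP[Zu us].
  apply: suppS (hA u); apply/subsetP => w /setIdP[Zw /eqP wu].
  by rewrite in_set Zw wu addnS ltnS (leq_trans us).
apply: vec_ext => s; rewrite mulmx0; case: (boolP (s \in Z)) => Zs; last first.
  by rewrite exprS mulmxA A0 ?mul0mx.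
apply/rowP => j; rewrite [RHS]mxE -(enum_valK j); apply: (pow _ s Zs).
rewrite in_set negb_and -ltnNge orbC (leq_ltn_trans (max_card _)) //.
by rewrite ltn_addl.
Qed.

(** [T1 = D + H] exchanges even and odd chains, and its square is [Pi - conj_sum X phi0 + H^2]
    because [D^2 = 0]. Raising the length by 2, [H^2] is nilpotent, so [1 + H^2] has an inverse [V].
    Then [T1 V] and [V T1] are inverses of [T1] on either side modulo relative traces, as
    [stable_iso_vproj] requires. *)
Lemma steinberg_vproj : vproj (steinberg R p X).
Proof.
have char0 := pm_char0 pmt.
have [H [phi0 [Hact Hsupp H0 phisupp HD]]] := webb_contraction pmt X.
rewrite steinberg_gperm; pose A := - (H *m H).
have Aact x : x \in X -> act_mx x *m A = A *m act_mx x.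
  by move=> Xx; rewrite mulmxN mulNmx mulmxA Hact // -!mulmxA Hact.
have Hpar : par_mx p X true H.
  move=> s Zs; apply: suppS (Hsupp s); apply/subsetP => u /setIdP[Zu /eqP us].
  by rewrite in_set Zu /odd_chain us addbT eqxx.
have Dpar : par_mx p X true D.
  move=> s Zs; apply: suppS (D_supp s); apply/subsetP => u /setIdP[Zu /eqP us].
  by rewrite in_set Zu /odd_chain -us addbT negbK eqxx.
have Apar : par_mx p X false A by apply: par_mxN; apply: (par_mxM Hpar Hpar).
have [N AN] : exists N, A ^+ N = 0.
  apply: graded_nilpotent => s; rewrite mulmxN mulmxA; last by move=> /H0->; rewrite mul0mx oppr0.
  rewrite -scaleN1r; apply: suppZ; apply: supp_mul (Hsupp s) _ => u /setIdP[_ /eqP us].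
  by rewrite -us; apply: Hsupp.
pose V := \sum_(i < N) A ^+ i.
have VA : (1%:M + H *m H) *m V = 1%:M.
  have := subrX1 A N; rewrite AN -/V => e.
  have -> : 1%:M + H *m H = - (A - 1%:M) by rewrite /A opprB opprK.
  by rewrite mulNmx; apply: (etrans (congr1 -%R (esym e))); rewrite sub0r opprK.
have AV := mulmx1C VA.
have Vact x : x \in X -> act_mx x *m V = V *m act_mx x.
  move=> Xx; rewrite mulmx_sumr mulmx_suml; apply: eq_bigr => i _.
  elim: (i : nat) => [|k IH]; first by rewrite expr0 mulmx1 mul1mx.
  by rewrite exprSr [LHS]mulmxA IH -[LHS]mulmxA Aact // mulmxA.
have Vpar : par_mx p X false V.
  move=> s Zs; rewrite mulmx_sumr; apply: supp_sum => i _.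
  elim: (i : nat) s Zs => [|k IH]; first exact: par_mx1.
  by rewrite exprSr; apply: (par_mxM (c := false) (d := false)).
pose T1 := D + H.
have T1act x : x \in X -> act_mx x *m T1 = T1 *m act_mx x.
  by move=> Xx; rewrite mulmxDr mulmxDl D_act // Hact.
have T1par : par_mx p X true T1 by apply: par_mxD.
have DD : D *m D = 0.
  apply: vec_ext => s; rewrite mulmxA mulmx0; case: (boolP (s \in Z)) => Zs.
    by rewrite vec_D // (bd_bd char0).
  by rewrite D_out // mul0mx.
have T1sq : T1 *m T1 = Pi - conj_sum X phi0 + H *m H.
  rewrite -HD mulmxDl !mulmxDr DD.
  by apply/matrixP => i j; rewrite !mxE; ring.
have inPi b : blk_in R p X b *m Pi = blk_in R p X b.
  apply/row_matrixP => i; rewrite row_mul rowK vec_mxf.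
  by have /setIdP[-> _] := enum_valP i.
have parPi b c M : par_mx p X c M -> blk_in R p X b *m M *m Pi = blk_in R p X b *m M.
  by move=> hM; rewrite -(blk_in_par b hM) -[LHS]mulmxA inPi.
have fg b : blk_in R p X b *m (T1 *m T1 *m V) *m blk_out R p X b =
    1%:M - blk_in R p X b *m conj_sum X (phi0 *m V) *m blk_out R p X b.
  have -> : conj_sum X (phi0 *m V) = conj_sum X phi0 *m V.
    rewrite [in RHS]/conj_sum mulmx_suml; apply: eq_bigr => x Xx.
    by rewrite mulmxA -[LHS]mulmxA -Vact ?groupV // mulmxA.
  rewrite -(blk_inK R p X b) -mulmxBl; congr (_ *m _).
  rewrite T1sq !mulmxDl !mulmxDr mulNmx mulmxN !mulmxA inPi.
  rewrite addrAC; congr (_ - _).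
  by rewrite -[RHS]mulmx1 -VA mulmxDl mul1mx mulmxDr !mulmxA.
have gf b : blk_in R p X b *m (V *m (T1 *m T1)) *m blk_out R p X b =
    1%:M - blk_in R p X b *m conj_sum X (V *m phi0) *m blk_out R p X b.
  have -> : conj_sum X (V *m phi0) = V *m conj_sum X phi0.
    rewrite [in RHS]/conj_sum mulmx_sumr; apply: eq_bigr => x Xx.
    by rewrite !mulmxA Vact.
  rewrite -(blk_inK R p X b) -mulmxBl; congr (_ *m _).
  rewrite T1sq !mulmxDr mulmxN !mulmxN !mulmxA (parPi _ _ _ Vpar).
  rewrite addrAC; congr (_ - _).
  by rewrite -[RHS]mulmx1 -AV mulmxDr mulmx1 mulmxDr !mulmxA.
apply: (@stable_iso_vproj p R F red t pmt gT X (gperm R (par_chains_acts p X false))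
  (gperm R (par_chains_acts p X true))
  (blk_in R p X false *m T1 *m blk_out R p X true)
  (blk_in R p X true *m (T1 *m V) *m blk_out R p X false)
  (blk_in R p X true *m (V *m T1) *m blk_out R p X false)
  (blk_in R p X false *m (phi0 *m V) *m blk_out R p X false)
  (blk_in R p X true *m (V *m phi0) *m blk_out R p X true)).
- exact: blk_hom.
- by apply: blk_hom => x Xx; rewrite mulmxA T1act // -!mulmxA Vact.
- by apply: blk_hom => x Xx; rewrite mulmxA Vact // -!mulmxA T1act.
- rewrite -blk_trG -fg !mulmxA; congr (_ *m _ *m _ *m _).
  exact: blk_in_par T1par.
have VT : par_mx p X true (V *m T1) by apply: (par_mxM Vpar T1par).
rewrite -blk_trG -gf !mulmxA; congr (_ *m _ *m _).
by have := blk_in_par true VT; rewrite !mulmxA.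
Qed.

End SteinbergProjective.

(** * Cancellation of pairs *)

Section Flags.
Variables (p : nat) (gT : finGroupType) (G : {group gT}).
Local Notation T := {set {group gT}}.
Local Notation J x s := ('JG^*%act s x).
Implicit Types (s : T) (Q S : {group gT}).

Definition flags : {set T} := [set s : T | [&& s != set0,
  [forall Q in s, (Q \subset G) && p.-group Q] &
  [forall P in s, forall Q in s, (P \subset Q) || (Q \subset P)]]].

Lemma flagsP s : reflect [/\ exists Q, Q \in s,
    forall Q, Q \in s -> Q \subset G /\ p.-group Q &
    forall P Q, P \in s -> Q \in s -> (P \subset Q) || (Q \subset P)] (s \in flags).
Proof.
rewrite inE; apply: (iffP and3P) => [[/set0Pn[Q sQ] /forall_inP mem /forall_inP tot]|].
  split=> [|P /mem/andP[]//|P P' sP]; first by exists Q.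
  by have /forall_inP := tot P sP; apply.
move=> [[Q sQ] mem tot]; split; first by apply/set0Pn; exists Q.
  by apply/forall_inP => P /mem[-> ->].
by apply/forall_inP => P sP; apply/forall_inP => P' sP'; apply: tot.
Qed.

Definition bot s : {group gT} := [group of \bigcap_(Q in s) Q].

Lemma bot_sub s Q : Q \in s -> bot s \subset Q.
Proof. by move=> sQ; apply: bigcap_inf. Qed.

Lemma bot_unique s Q : Q \in s -> (forall P, P \in s -> Q \subset P) -> bot s = Q.
Proof.
move=> sQ le; apply/val_inj/eqP; rewrite /= eqEsubset bigcap_inf //=.
exact/bigcapsP.
Qed.

Lemma flag_min s (A : pred {group gT}) Q0 : s \in flags -> Q0 \in s -> A Q0 ->
  exists Q, [/\ Q \in s, A Q & forall P, P \in s -> A P -> Q \subset P].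
Proof.
move=> /flagsP[_ _ tot] sQ0 AQ0.
pose Q := [arg min_(Q < Q0 | (Q \in s) && A Q) #|Q|].
have [sQ AQ minQ] : [/\ Q \in s, A Q & forall P, P \in s -> A P -> (#|Q| <= #|P|)%N].
  rewrite /Q; case: arg_minnP => [|U /andP[sU AU] minU]; first by rewrite sQ0.
  by split=> // P sP AP; apply: minU; rewrite sP.
exists Q; split=> // P sP AP; case/orP: (tot P Q sP sQ) => // PQ.
by have /eqP-> : Q :==: P by rewrite eq_sym eqEcard PQ minQ.
Qed.

Lemma flag_max s (A : pred {group gT}) Q0 : s \in flags -> Q0 \in s -> A Q0 ->
  exists Q, [/\ Q \in s, A Q & forall P, P \in s -> A P -> P \subset Q].
Proof.
move=> /flagsP[_ _ tot] sQ0 AQ0.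
pose Q := [arg max_(Q > Q0 | (Q \in s) && A Q) #|Q|].
have [sQ AQ maxQ] : [/\ Q \in s, A Q & forall P, P \in s -> A P -> (#|P| <= #|Q|)%N].
  rewrite /Q; case: arg_maxnP => [|U /andP[sU AU] maxU]; first by rewrite sQ0.
  by split=> // P sP AP; apply: maxU; rewrite sP.
exists Q; split=> // P sP AP; case/orP: (tot P Q sP sQ) => // QP.
by have /eqP-> : P :==: Q by rewrite eq_sym eqEcard QP maxQ.
Qed.

Lemma bot_mem s : s \in flags -> bot s \in s.
Proof.
move=> Fs; have /flagsP[[Q0 sQ0] _ _] := Fs.
have [Q [sQ _ minQ]] := @flag_min s predT Q0 Fs sQ0 isT.
by rewrite (bot_unique sQ) // => P sP; apply: minQ.
Qed.

Definition tog Q s : T := if Q \in s then s :\ Q else Q |: s.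

Lemma in_tog Q s P : (P \in tog Q s) = if P == Q then Q \notin s else P \in s.
Proof.
rewrite /tog; have [->|PQ] := eqVneq P Q.
  by case: (boolP (Q \in s)) => sQ; rewrite !inE eqxx.
by case: (Q \in s); rewrite !inE ?PQ // (negPf PQ).
Qed.

Lemma togK Q s : tog Q (tog Q s) = s.
Proof.
apply/setP => P; rewrite !in_tog eqxx negbK.
by case: eqP => // ->.
Qed.

Lemma odd_tog Q s : odd #|tog Q s| = ~~ odd #|s|.
Proof.
rewrite /tog; case: ifPn => sQ; last by rewrite cardsU1 sQ.
by rewrite [in RHS](cardsD1 Q) sQ /= negbK.
Qed.

Lemma togJ Q s x : J x (tog Q s) = tog ('JG%act Q x) (J x s).
Proof. by rewrite /tog memJ; case: ifP; rewrite ?J_setD1 ?J_setU1. Qed.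

Lemma flag_tog Q s : s \in flags -> Q \subset G -> p.-group Q ->
    (forall P, P \in s -> (P \subset Q) || (Q \subset P)) ->
    (exists2 P, P \in s & P != Q) ->
  tog Q s \in flags.
Proof.
move=> /flagsP[_ mem tot] QG pQ comp [P0 sP0 P0Q]; apply/flagsP; split.
- by exists P0; rewrite in_tog (negPf P0Q).
- by move=> P; rewrite in_tog; case: eqP => [->|_ /mem].
move=> P P'; rewrite !in_tog; case: eqP => [->|_]; case: eqP => [->|_] //.
- by rewrite subxx.
- by move=> _ sP'; rewrite orbC comp.
- by move=> sP _; apply: comp.
exact: tot.
Qed.

Lemma botJ s x : bot (J x s) = 'JG%act (bot s) x.
Proof.
apply/val_inj; rewrite /= (reindex_inj (act_inj 'JG x)) /=.
apply/setP => y; rewrite mem_conjg; apply/bigcapP/bigcapP => h Q.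
  by move=> sQ; rewrite -mem_conjg; apply: h; rewrite memJ.
by rewrite memJ => sQ; rewrite mem_conjg; apply: h.
Qed.

Lemma flagsJ s x : x \in G -> (J x s \in flags) = (s \in flags).
Proof.
move=> Gx; suff h s' y : y \in G -> s' \in flags -> J y s' \in flags.
  by apply/idP/idP => [/(h _ _ (groupVr Gx))|/(h _ _ Gx)//]; rewrite actK.
move=> Gy /flagsP[[Q sQ] mem tot]; apply/flagsP; split.
- by exists ('JG%act Q y); rewrite memJ.
- move=> P; rewrite -[P](actKV 'JG y) memJ => /mem[PG pP] /=.
  by rewrite pgroupJ conj_subG.
move=> P P'; rewrite -{1}[P](actKV 'JG y) -{1}[P'](actKV 'JG y) !memJ => sP sP'.
by have := tot _ _ sP sP'; rewrite /= !conjSg.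
Qed.

End Flags.
Arguments flagsP {p gT G s}.

Section Pairs.
Variables (gT : finGroupType).
Local Notation T := {set {group gT}}.

Definition pair_act (z : gT * T) (x : gT) : gT * T := (z.1 ^ x, 'JG^*%act z.2 x)%g.

Lemma pair_act_is_action : is_action [set: gT] pair_act.
Proof.
apply: is_total_action => [[u s]|[u s] x y]; rewrite /pair_act /=.
  by rewrite conjg1 act1.
by rewrite conjgM actM.
Qed.
Canonical pair_action := Action pair_act_is_action.

(* A chain [Q_0 < ... < Q_n] has sign [(-1) ^+ n], but [n.+1] members. *)
Definition par_pair (z : gT * T) := ~~ odd #|z.2|.

(** Toggling [q z] is an involution because the pivot is the same afterwards, and it changes the
    number of members by one. *)
Lemma spcl_toggle (R : comUnitRingType) (G : {group gT}) (Z : {set gT * T})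
    (q : gT * T -> {group gT}) :
    par_inv pair_action par_pair G Z ->
    (forall z, z \in Z -> (z.1, tog (q z) z.2) \in Z /\ q (z.1, tog (q z) z.2) = q z) ->
    (forall z x, x \in G -> q (pair_act z x) = 'JG%act (q z) x) ->
  spcl R pair_action par_pair G Z = 0.
Proof.
move=> iZ hq qJ; apply: (@spcl_flip _ _ _ _ _ _ Z (fun z => (z.1, tog (q z) z.2))) => //.
- move=> [u s] Zz; have [/= fZ e] := hq _ Zz; split=> //; first by rewrite e togK.
  by rewrite /par_pair /= odd_tog.
move=> z x Zz Gx; rewrite [in LHS]qJ //.
by congr (_, _); apply/esym/togJ.
Qed.

End Pairs.

Section PairSets.
Variables (R : comUnitRingType) (p : nat) (gT : finGroupType) (G : {group gT}).
Local Notation T := {set {group gT}}.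
Local Notation J x s := ('JG^*%act s x).
Local Notation Fl := (flags p G).
Local Notation to := (@pair_action gT).
Local Notation spclG := (spcl R to (@par_pair gT) G).
Implicit Types (s : T) (Q S : {group gT}) (z : gT * T).

Definition bnorm s := [forall Q in s, Q \subset 'N(bot s)].
Definition bpcore s : {group gT} := 'O_p('N_G(bot s))%G.
Definition brad s := (bot s :==: 1%g) || (bot s :==: bpcore s).

Lemma bnormJ s x : bnorm (J x s) = bnorm s.
Proof.
suff h s' y : bnorm s' -> bnorm (J y s').
  by apply/idP/idP => [/(h _ x^-1%g)|/h//]; rewrite actK.
move=> /forall_inP nB; apply/forall_inP => Q; rewrite -{1}[Q](actKV 'JG y) memJ => /nB.
by rewrite botJ /= normJ -(conjSg _ _ y) conjsgKV.
Qed.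

Lemma bpcoreJ s x : x \in G -> bpcore (J x s) = 'JG%act (bpcore s) x.
Proof.
move=> Gx; apply/val_inj; rewrite /= -pcoreJ conjIg -normJ; rewrite -[X in 'N(X)]/(val (bot (J x s))) botJ.
by rewrite (conjGid Gx).
Qed.

Lemma bradJ s x : x \in G -> brad (J x s) = brad s.
Proof.
move=> Gx; rewrite /brad bpcoreJ // botJ /= conjsg_eq1.
by rewrite (inj_eq (@conjsg_inj _ x)).
Qed.

Lemma pair_inv (Z : {set gT * T}) :
  (forall z x, x \in G -> (pair_act z x \in Z) = (z \in Z)) ->
  par_inv to (@par_pair gT) G Z.
Proof.
move=> h; split; first by apply/actsP => x Gx z; apply: h.
by move=> z x _ _; rewrite /par_pair /= card_J.
Qed.

Lemma spcl_sub (Z Z' : {set gT * T}) : Z' \subset Z ->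
    (forall z x, x \in G -> (pair_act z x \in Z) = (z \in Z)) ->
    (forall z x, x \in G -> (pair_act z x \in Z') = (z \in Z')) ->
  spclG (Z :\: Z') = 0 -> spclG Z = spclG Z'.
Proof.
move=> sub h h' e0; rewrite -[Z in LHS](setID Z Z') (setIidPr sub) spclU ?e0 ?addr0 //.
- exact: pair_inv.
- by apply: pair_inv => z x Gx; rewrite !in_setD h // h'.
rewrite -setI_eq0; apply/eqP/setP => z; rewrite in_set0 in_setI in_setD.
by case: (z \in Z').
Qed.

Variable U : {set gT}.
Hypothesis UJ : forall u x, x \in G -> (u ^ x \in U)%g = (u \in U).

(** [U] restricts the decoration u: it is [[set 1%g]] for the identity in the Green ring and the
    whole group type for the characters. *)
Definition flag_pairs := [set z : gT * T | [&& z.2 \in Fl, z.1 \in U & z.1 \in bot z.2]].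
Definition normal_pairs := [set z in flag_pairs | bnorm z.2].
Definition radical_pairs := [set z in normal_pairs | brad z.2].
Definition cyclic_pairs :=
  [set z : gT * T | [&& z.1 \in G, p.-elt z.1, z.1 \in U & z.2 == [set <[z.1]>%G]]].

Lemma flag_pairsJ z x : x \in G -> (pair_act z x \in flag_pairs) = (z \in flag_pairs).
Proof.
move=> Gx; rewrite [LHS]in_set [RHS]in_set; congr [&& _, _ & _]; [exact: flagsJ | exact: UJ |].
have -> : bot (pair_act z x).2 = 'JG%act (bot z.2) x := botJ _ _.
exact: memJ_conjg.
Qed.

Lemma normal_pairsJ z x : x \in G -> (pair_act z x \in normal_pairs) = (z \in normal_pairs).
Proof. by move=> Gx; rewrite [LHS]in_set [RHS]in_set flag_pairsJ // bnormJ. Qed.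

Lemma radical_pairsJ z x : x \in G -> (pair_act z x \in radical_pairs) = (z \in radical_pairs).
Proof. by move=> Gx; rewrite [LHS]in_set [RHS]in_set normal_pairsJ // bradJ. Qed.

Lemma cyclic_pairsJ z x : x \in G -> (pair_act z x \in cyclic_pairs) = (z \in cyclic_pairs).
Proof.
move=> Gx; rewrite [LHS]in_set [RHS]in_set /= UJ // groupJr // p_eltJ.
congr [&& _, _, _ & _].
have <- : J x [set <[z.1]>%G] = [set <[z.1 ^ x]>%G].
  by apply: etrans (imset_set1 _ _) _; congr [set _]; apply/val_inj; rewrite /= cycleJ.
exact: (inj_eq (act_inj 'JG^* x)).
Qed.

Lemma flag_pairsP z : reflect [/\ z.2 \in Fl, z.1 \in U & z.1 \in bot z.2] (z \in flag_pairs).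
Proof. by rewrite [X in reflect _ X]in_set; apply: and3P. Qed.

(** The pivot [<[u]>] lies in the bottom, hence in all members, so it can always be added or
    removed, unless it is the only member. *)
Lemma spcl_cyclic : spclG flag_pairs = spclG cyclic_pairs.
Proof.
apply: spcl_sub => [||z x Gx|].
- apply/subsetP => -[u s]; rewrite [(u, s) \in cyclic_pairs]in_set /= => /and4P[Gu pu Uu /eqP->].
  have Fs : [set <[u]>%G] \in Fl.
    apply/flagsP; split=> [|Q|Q P]; first by exists <[u]>%G; rewrite set11.
      by move=> /set1P->; rewrite cycle_subG.
    by move=> /set1P-> /set1P->; rewrite subxx.
  apply/flag_pairsP; split=> //=.
  by rewrite big_set1 cycle_id.
- exact: flag_pairsJ.
- exact: cyclic_pairsJ.
apply: (@spcl_toggle _ R G _ (fun z => <[z.1]>%G)).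
- by apply: pair_inv => z x Gx; rewrite !in_setD cyclic_pairsJ // flag_pairsJ.
- move=> [u s] /setDP[/flag_pairsP[/= Fs Uu bu] nc]; split=> //.
  set Q := <[u]>%G.
  have [_ mem tot] := flagsP Fs; have sb := bot_mem Fs; have [bG pb] := mem _ sb.
  have Qle P : P \in s -> Q \subset P.
    by move=> sP; rewrite cycle_subG (subsetP (bot_sub sP)).
  have [P0 sP0 P0Q] : exists2 P, P \in s & P != Q.
    apply/exists_inP; apply: contraR nc; rewrite negb_exists_in => /forall_inP e.
    have e' P : P \in s -> P = Q by move=> /e; rewrite negbK => /eqP.
    rewrite in_set /= (subsetP bG) // (mem_p_elt pb) // Uu /=; apply/eqP/setP => P.
    rewrite in_set1; apply/idP/eqP => [/e'//|->].
    by have := sb; rewrite (e' _ sb).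
  have tF : tog Q s \in Fl.
    apply: flag_tog => //; last by exists P0.
    - exact: subset_trans (Qle _ sb) bG.
    - exact: pgroupS (Qle _ sb) pb.
    by move=> P /Qle ->; rewrite orbT.
  apply/setDP; split.
    apply/flag_pairsP; split=> //; change (u \in bot (tog Q s)).
    have := bot_mem tF; rewrite in_tog; case: eqP => [-> _|_ sP]; first exact: cycle_id.
    by apply: (subsetP (Qle _ sP)); apply: cycle_id.
  rewrite in_set /=; apply/negP => /and4P[_ _ _ /eqP/setP/(_ P0)].
  by rewrite in_tog in_set1 (negPf P0Q) sP0.
by move=> z x Gx; apply/val_inj; rewrite /= cycleJ.
Qed.

Lemma flag_mem s Q : s \in Fl -> Q \in s -> Q \subset G /\ p.-group Q.
Proof. by case/flagsP=> _ mem _; apply: mem. Qed.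

Lemma flag_tot s P Q : s \in Fl -> P \in s -> Q \in s -> (P \subset Q) || (Q \subset P).
Proof. by case/flagsP=> _ _; apply. Qed.

(* The normalizer of the bottom [Q_0] in the smallest member of [s] which does not
   normalize [Q_0]. *)
Definition normalizer_pivot s : {group gT} :=
  [group of (\bigcap_(Q in s | ~~ (Q \subset 'N(bot s))) Q) :&: 'N(bot s)].

Lemma normalizer_pivotJ s x : normalizer_pivot (J x s) = 'JG%act (normalizer_pivot s) x.
Proof.
apply/val_inj/setP => y; rewrite [in RHS]mem_conjg !in_setI botJ.
congr (_ && _); last by rewrite -mem_conjg -normJ.
rewrite (reindex_inj (act_inj 'JG x)) /=; apply/bigcapP/bigcapP => h Q.
  move=> hQ; rewrite -mem_conjg; apply: h.
  by rewrite memJ normJ conjSg.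
by rewrite memJ normJ conjSg mem_conjg; apply: h.
Qed.

(** The pivot is [V = N_Q(B)], with [B] the bottom and [Q] the smallest member not normalizing it.
    As normalizers grow in p-groups, [B < V < Q]; so toggling [V] affects neither the bottom nor the
    members that do not normalize it, and the pivot is unchanged. *)
Lemma spcl_normal : spclG flag_pairs = spclG normal_pairs.
Proof.
apply: spcl_sub => [||z x Gx|].
- by apply/subsetP => z /setIdP[].
- exact: flag_pairsJ.
- exact: normal_pairsJ.
apply: (@spcl_toggle _ R G _ (fun z => normalizer_pivot z.2)).
- by apply: pair_inv => z x Gx; rewrite !in_setD normal_pairsJ // flag_pairsJ.
- move=> [u s] /setDP[Zz nz]; have [/= Fs Uu bu] := flag_pairsP _ Zz.
  have {nz} : ~~ bnorm s by apply: contra nz => bs; rewrite in_set Zz.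
  rewrite negb_forall_in => /exists_inP[Q0 sQ0 nQ0].
  have [Q [sQ nQ minQ]] := flag_min (A := fun Q => ~~ (Q \subset 'N(bot s))) Fs sQ0 nQ0.
  set B := bot s in nQ minQ nQ0 *; set V := normalizer_pivot s.
  have sB : B \in s := bot_mem Fs; have [QG pQ] := flag_mem Fs sQ.
  have VE : V :=: 'N_Q(B).
    rewrite /V /=; congr (_ :&: _); apply/eqP; rewrite eqEsubset bigcap_inf ?sQ //=.
    by apply/bigcapsP => P /andP[sP nP]; apply: minQ.
  have BQ : B \proper Q.
    rewrite properEneq (bot_sub sQ) andbT; apply: contraNneq nQ => <-; exact: normG.
  have BV : B \proper V.
    by rewrite VE; apply: nilpotent_proper_norm BQ; apply: pgroup_nil pQ.
  have nV : V \subset 'N(B) by rewrite VE subsetIr.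
  have VQ : V \subset Q by rewrite VE subsetIl.
  have neBV : B != V by apply: contraTneq BV => <-; rewrite properxx.
  have neQV : Q != V by apply: contraNneq nQ => ->.
  have tF : tog V s \in Fl.
    apply: flag_tog => //; last by exists B.
    - exact: subset_trans VQ QG.
    - exact: pgroupS VQ pQ.
    move=> P sP; have [nP|nP] := boolP (P \subset 'N(B)).
      rewrite VE subsetI nP andbT; case/orP: (flag_tot Fs sP sQ) => [->//|QP].
      by rewrite (subset_trans QP nP) in nQ.
    by rewrite (subset_trans VQ) ?orbT // minQ.
  have bE : bot (tog V s) = B.
    apply: bot_unique => [|P]; first by rewrite in_tog (negPf neBV).
    by rewrite in_tog; case: eqP => [->|_ /bot_sub//]; rewrite (proper_sub BV).
  split; last first.
    change (normalizer_pivot (tog V s) = normalizer_pivot s); apply/val_inj.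
    transitivity ((\bigcap_(P in s | ~~ (P \subset 'N(B))) P) :&: 'N(B))%g => //.
    transitivity ((\bigcap_(P in tog V s | ~~ (P \subset 'N(bot (tog V s)))) P)
      :&: 'N(bot (tog V s)))%g => //.
    rewrite bE; congr (_ :&: _); apply: eq_bigl => P.
    by rewrite in_tog; case: eqP => // ->; rewrite nV !andbF.
  apply/setDP; split; first by apply/flag_pairsP; split=> //; change (u \in bot (tog V s)); rewrite bE.
  apply/negP => /setIdP[_ /forall_inP nB].
  have tQ : Q \in tog V s by rewrite in_tog (negPf neQV).
  have := nB Q tQ; change (Q \subset 'N(bot (tog V s)) -> False); rewrite bE.
  exact/negP.
by move=> z x Gx; apply: normalizer_pivotJ.
Qed.

Definition pcore_pivot s := apex (bpcore s) s.

(** Here [S = O_p(N_G(B))] properly contains the bottom [B], and the pivot is [V = Q S] with [Q] the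
    largest member not containing [S]. Since [V] contains [S], toggling it affects neither the
    bottom nor the members that do not contain [S], and the pivot is unchanged. *)
Lemma spcl_radical : spclG normal_pairs = spclG radical_pairs.
Proof.
apply: spcl_sub => [||z x Gx|].
- by apply/subsetP => z /setIdP[].
- exact: normal_pairsJ.
- exact: radical_pairsJ.
apply: (@spcl_toggle _ R G _ (fun z => pcore_pivot z.2)).
- by apply: pair_inv => z x Gx; rewrite !in_setD radical_pairsJ // normal_pairsJ.
- move=> [u s] /setDP[Zz nz]; have /setIdP[/flag_pairsP[/= Fs Uu bu] /forall_inP/= nB] := Zz.
  have {nz Zz} : ~~ brad s by apply: contra nz => bs; rewrite in_set Zz.
  set B := bot s in nB *; rewrite negb_or => /andP[B1 BS].
  have sB : B \in s := bot_mem Fs; have [BG pB] := flag_mem Fs sB.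
  set S := bpcore s in BS; have pS : p.-group S := pcore_pgroup _ _.
  have SN : S \subset 'N_G(B) := pcore_sub _ _.
  have BleS : B \subset S by apply: pcore_max => //; apply: normalSG.
  have SB : ~~ (S \subset B) by apply: contra BS => h; rewrite eqEsubset BleS.
  have [Q [sQ SQ maxQ]] := flag_max (A := fun Q => ~~ (S \subset Q)) Fs sB SB.
  have [QG pQ] := flag_mem Fs sQ.
  set V : {group gT} := pcore_pivot s.
  have QV : Q \subset V := apex_bigcup sQ SQ.
  have SV : S \subset V := apex_sub S s.
  have VE : V :=: (Q <*> S)%g.
    apply/eqP; rewrite eqEsubset join_subG QV SV gen_subG subUset joing_subr !andbT.
    apply/bigcupsP => P /andP[sP SP]; apply: subset_trans (joing_subl _ _).
    exact: maxQ.
  have QN : Q \subset 'N_G(B) by rewrite subsetI QG nB.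
  have VN : V \subset 'N_G(B) by rewrite VE join_subG QN SN.
  have pV : p.-group V.
    rewrite VE norm_joinEl ?pgroupM ?pQ //.
    exact: subset_trans QN (gFnorm _ _).
  have neBV : B != V by apply: contraNneq SB => ->.
  have BV : B \subset V := subset_trans BleS SV.
  have tF : tog V s \in Fl.
    apply: flag_tog => //; last by exists B.
    - exact: subset_trans VN (subsetIl _ _).
    move=> P sP; have [SP|SP] := boolP (S \subset P); last first.
      by rewrite [P \subset V]apex_bigcup.
    rewrite [V \subset P](_ : _ = true) ?orbT // VE join_subG SP andbT.
    case/orP: (flag_tot Fs sP sQ) => // PQ.
    by rewrite (subset_trans SP PQ) in SQ.
  have bE : bot (tog V s) = B.
    apply: bot_unique => [|P]; first by rewrite in_tog (negPf neBV).
    by rewrite in_tog; case: eqP => [->|_ /bot_sub].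
  have SE : bpcore (tog V s) = S by rewrite /bpcore bE.
  split; last first.
    rewrite /= -/V {2}/V /pcore_pivot SE; apply/val_inj => /=; congr <<_ :|: _>>%g.
    by apply: eq_bigl => P; rewrite in_tog; case: eqP => // ->; rewrite SV !andbF.
  apply/setDP; split; last first.
    have /negPf rE : ~~ brad (tog V s) by rewrite /brad SE bE negb_or B1.
    by rewrite in_set [brad _]rE andbF.
  rewrite in_set; apply/andP; split; first by apply/flag_pairsP; split=> //; change (u \in bot (tog V s)); rewrite bE.
  apply/forall_inP => P; change (P \in tog V s -> P \subset 'N(bot (tog V s))).
  rewrite in_tog bE; by case: eqP => [-> _|_ /nB//]; apply: subset_trans VN (subsetIr _ _).
by move=> z x Gx; rewrite /pcore_pivot /= bpcoreJ // apex_J.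
Qed.

Lemma spcl_radical_cyclic : spclG radical_pairs = spclG cyclic_pairs.
Proof. by rewrite -spcl_radical -spcl_normal spcl_cyclic. Qed.

End PairSets.

(** * Chains above a radical subgroup *)

Section Over.
Variables (p : nat) (gT : finGroupType) (N Q : {group gT}).
Local Notation T := {set {group gT}}.
Local Notation Tq := {set {group coset_of Q}}.
Hypotheses (nQN : N \subset 'N(Q)) (sQN : Q \subset N) (pQ : p.-group Q).
Implicit Types (s : T) (t : Tq) (P : {group gT}) (A : {group coset_of Q}).

Definition flags_over : {set T} := [set s in flags p N | bot s == Q].

Definition pull A : {group gT} := (coset Q @*^-1 A)%G.
(** With [Q] adjoined as bottom, the chains of [N / Q], including the empty one, become the flags
    with bottom [Q]. The extra member accounts for the negation in [par_pair]. *)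
Definition pull_chain t : T := Q |: [set pull A | A in t].

Lemma pullK A : (pull A / Q)%G = A.
Proof. exact/val_inj/cosetpreK. Qed.

Lemma pull_inj : injective pull.
Proof. by move=> A B e; rewrite -(pullK A) e pullK. Qed.

Lemma pull_neq A : A :!=: 1%g -> pull A != Q.
Proof.
move=> A1; apply: contraNneq A1 => e.
by rewrite -(pullK A) e /= trivg_quotient eqxx.
Qed.

Lemma mem_pull_chain t A : A :!=: 1%g -> (pull A \in pull_chain t) = (A \in t).
Proof.
move=> A1; rewrite in_setU1 (negPf (pull_neq A1)) /=.
by rewrite (mem_imset _ _ pull_inj).
Qed.

Let normalQ : Q <| N. Proof. by rewrite /normal sQN. Qed.

Lemma pull_quotient P : Q \subset P -> P \subset N -> pull (P / Q)%G = P.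
Proof.
move=> QP PN; apply/val_inj/quotientGK.
by rewrite /normal QP (subset_trans PN).
Qed.

Lemma pull_chain_flag t : t \in pchains p (N / Q)%G -> pull_chain t \in flags_over.
Proof.
move=> Zt; have memA A : A \in t -> pull A \subset N /\ p.-group (pull A).
  move=> /(pchain_mem Zt)[AN pA _]; split; first by rewrite /= sub_cosetpre_quo.
  by rewrite /pgroup card_cosetpre pnatM; apply/andP.
have Qle A : Q \subset pull A := sub_cosetpre _.
have Ft : pull_chain t \in flags p N.
  apply/flagsP; split=> [|P|P P'].
  - by exists Q; rewrite setU11.
  - by case/setU1P=> [->//|/imsetP[A tA ->]]; apply: memA.
  case/setU1P=> [->|/imsetP[A tA ->]]; case/setU1P=> [->|/imsetP[B tB ->]].
  - by rewrite subxx.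
  - by rewrite Qle.
  - by rewrite Qle orbT.
  by have := pchain_tot Zt tA tB; rewrite -!cosetpreSK.
rewrite in_set Ft; apply/eqP/bot_unique; first by rewrite setU11.
by move=> P /setU1P[->//|/imsetP[A _ ->]].
Qed.

Lemma pull_chain_inj : {in pchains p (N / Q)%G &, injective pull_chain}.
Proof.
suff h t t' : t \in pchains p (N / Q)%G -> pull_chain t = pull_chain t' -> t \subset t'.
  by move=> t t' Zt Zt' e; apply/eqP; rewrite eqEsubset !h.
move=> Zt e; apply/subsetP => A tA; have [_ _ A1] := pchain_mem Zt tA.
by rewrite -mem_pull_chain // -e mem_pull_chain.
Qed.

Lemma pull_chain_im : pull_chain @: pchains p (N / Q)%G = flags_over.
Proof.
apply/setP => s; apply/imsetP/idP => [[t Zt ->]|]; first exact: pull_chain_flag.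
case/setIdP=> Fs /eqP bs; have sQ : Q \in s by rewrite -{1}bs (bot_mem Fs).
have memP P : P \in s -> [/\ Q \subset P, P \subset N & p.-group P].
  move=> sP; have /flagsP[_ /(_ P sP)[PN pP] _] := Fs.
  by split=> //; rewrite -bs bot_sub.
exists [set (P / Q)%G | P in s :\ Q].
  apply: pchainP => [_ /imsetP[P /setD1P[PQ sP] ->]|].
    have [QP PN pP] := memP P sP; split.
    - exact: quotientS.
    - exact: quotient_pgroup.
    have nP := subset_trans PN nQN; rewrite -subG1 quotient_sub1 //.
    apply: contra PQ => PQ; apply/eqP/val_inj/eqP.
    by rewrite eqEsubset; apply/andP; split.
  move=> _ _ /imsetP[P /setD1P[_ sP] ->] /imsetP[P' /setD1P[_ sP'] ->].
  have /flagsP[_ _ tot] := Fs.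
  by case/orP: (tot _ _ sP sP') => h; apply/orP; [left | right]; apply: quotientS.
apply/setP => P; apply/idP/setU1P => [sP|[->//|/imsetP[_ /imsetP[P' /setD1P[_ sP'] ->] ->]]].
  have [QP PN pP] := memP P sP; have [->|PQ] := eqVneq P Q; [by left | right].
  apply/imsetP; exists (P / Q)%G; last by rewrite pull_quotient.
  by apply/imsetP; exists P; rewrite ?in_setD1 ?PQ.
by have [QP PN pP] := memP P' sP'; rewrite pull_quotient.
Qed.

Lemma pull_chainJ t x : x \in N ->
  pull_chain ('JG^*%act t (coset Q x)) = 'JG^*%act (pull_chain t) x.
Proof.
move=> Nx; have nx : x \in 'N(Q) by apply: subsetP Nx.
have gJ A : pull ('JG%act A (coset Q x)) = 'JG%act (pull A) x.
  by apply/val_inj; rewrite /= morphpreJ.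
rewrite J_setU1; congr (_ |: _); first by apply/val_inj => /=; rewrite (normP nx).
apply/setP => P; apply/imsetP/imsetP => [[_ /imsetP[A tA ->] ->]|[_ /imsetP[A tA ->] ->]].
  by exists (pull A); [apply: imset_f | apply: gJ].
by exists ('JG%act A (coset Q x)); [apply: imset_f | rewrite gJ].
Qed.

Lemma card_pull_chain t : t \in pchains p (N / Q)%G -> #|pull_chain t| = #|t|.+1.
Proof.
move=> Zt; rewrite cardsU1 (card_imset _ pull_inj) -add1n; congr (_ + _)%N.
case: (boolP (Q \in _)) => // /imsetP[A tA e].
by have [_ _ A1] := pchain_mem Zt tA; have := pull_neq A1; rewrite -e eqxx.
Qed.

Lemma flags_overJ s x : x \in N -> ('JG^*%act s x \in flags_over) = (s \in flags_over).
Proof.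
move=> Nx; rewrite [LHS]in_set [RHS]in_set flagsJ // botJ; congr (_ && _).
have eQ : 'JG%act Q x = Q by apply/val_inj => /=; rewrite (normP (subsetP nQN x Nx)).
by rewrite -{1}eQ (inj_eq (act_inj 'JG x)).
Qed.

Section PairsOver.
Variables (R : comUnitRingType).
Local Notation to := (@pair_action gT).
Local Notation pairs W := (setX W flags_over).
Local Notation spclN W := (spcl R to (@par_pair gT) N (pairs W)).

Lemma Inf_steinberg : Inf nQN (steinberg R p (N / Q)%G) = spclN [set 1%g].
Proof.
rewrite steinbergE.
apply: (@Inf_spcl R gT N Q nQN _ _ 'JG^*%act to (@odd_chain _) (@par_pair gT)
  (pchains p (N / Q)%G) (pairs [set 1%g]) (fun t => (1%g, pull_chain t))).
- exact: pchains_inv.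
- by move=> t t' Zt Zt' [e]; apply: pull_chain_inj.
- rewrite -pull_chain_im; apply/setP => -[u s]; rewrite in_setX in_set1.
  apply/imsetP/andP => [[t Zt [-> ->]]|[/eqP-> /imsetP[t Zt ->]]].
    by rewrite eqxx imset_f.
  by exists t.
- by move=> t Zt; rewrite /par_pair /odd_chain card_pull_chain //= negbK.
move=> t x Zt Nx; rewrite pull_chainJ //=.
by congr (_, _); rewrite /= conj1g.
Qed.

Definition euler_over (h : gT) : R :=
  \sum_(s in flags_over | 'JG^*%act s h == s) (-1) ^+ (~~ odd #|s|).

(** A pair is fixed exactly when both entries are, and its sign depends on the chain only. So
    passing from [[set 1%g]] to [Q] multiplies the character by [|C_Q(h)|]. *)
Lemma gchar_pairs (W : {set gT}) h : (forall x u, x \in N -> (u ^ x \in W)%g = (u \in W)) ->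
  h \in N -> gchar (spclN W) h = #|[set u in W | u ^ h == u]%g|%:R * euler_over h.
Proof.
move=> WJ Nh; have iZ : par_inv to (@par_pair gT) N (pairs W).
  split; last by move=> z x _ _; rewrite /par_pair card_J.
  apply/actsP => x Nx [u s]; rewrite !in_setX /= WJ // flags_overJ //.
rewrite /spcl gcharB // !gchar_pcl //; [|exact: par_inv_odd | exact: par_inv_even].
have sign b : #|[set z in [set z in pairs W | par_pair z == b] | to z h == z]| =
    (#|[set u in W | u ^ h == u]%g| *
     #|[set s in [set s in flags_over | 'JG^*%act s h == s] | ~~ odd #|s| == b]|)%N.
  rewrite -cardsX; apply: eq_card => -[u s]; rewrite in_setX.
  rewrite [LHS]in_set [in LHS]in_set in_setX [X in _ = X && _]in_set.
  rewrite [X in _ = _ && X]in_set [in RHS]in_set /par_pair /= xpair_eqE.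
  by do !case: (_ \in _); do !case: (_ == _).
have e (q : pred bool) b : (forall c, q c = (c == b)) ->
    [set z in [set z in pairs W | q (par_pair z)] | to z h == z] =
    [set z in [set z in pairs W | par_pair z == b] | to z h == z].
  by move=> qb; apply/setP => z; rewrite !in_set qb.
rewrite (e negb false) => [|[]//]; rewrite (e id true) => [|[]//].
rewrite !sign !natrM -mulrBr; congr (_ * _).
rewrite /euler_over (bigID (fun s : T => odd #|s|)) /= -!sum1_card !natr_sum -sumrN.
have inA b s : (s \in [set s in [set s in flags_over | 'JG^*%act s h == s] | ~~ odd #|s| == b]) =
    (s \in flags_over) && ('JG^*%act s h == s) && (~~ odd #|s| == b).
  by rewrite [LHS]in_set [X in X && _]in_set.
congr (_ + _); apply: eq_big => s; rewrite inA.
- by congr (_ && _); case: odd.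
- by case: odd; rewrite ?andbF // expr0.
- by congr (_ && _); case: odd.
by case: odd; rewrite ?andbF // expr1.
Qed.

End PairsOver.
End Over.

Section InflationCharacter.
Variables (R : comUnitRingType) (gT : finGroupType) (N Q : {group gT}).
Hypothesis nQN : N \subset 'N(Q).

Lemma gchar_Inf (M : green R (N / Q)%G) h : h \in N ->
  gchar (Inf nQN M) h = gchar M (coset Q h).
Proof.
move=> Nh; have [A [B ->]] := gclassP M.
by rewrite InfE !gcharE // mem_quotient.
Qed.

Lemma vproj_Inf1 (M : green R (N / Q)%G) : Q :=: 1%g -> vproj M -> vproj (Inf nQN M).
Proof.
move=> Q1 [A [B [PA PB ->]]]; rewrite InfE.
have proj (C : glattice R (N / Q)%G) : projective C -> projective (ginf nQN C).
  move=> /projective_higman[f f1]; apply: higman_projective; exists f; rewrite -f1 /trG.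
  have e : (N / Q)%g = [set coset Q x | x in N].
    by apply/setP => y; apply/morphimP/imsetP => [[x nx Nx ->]|[x Nx ->]];
      exists x => //; apply: subsetP Nx.
  rewrite [RHS](eq_bigl (mem [set coset Q x | x in N])) => [|y]; last by rewrite -e.
  rewrite big_imset /=; last first.
    move=> x y Nx Ny /= exy; have [nx ny] := (subsetP nQN _ Nx, subsetP nQN _ Ny).
    by move/(rcoset_kercosetP nx ny): exy; rewrite Q1 mul1g => /set1P.
  apply: eq_bigr => x Nx.
  change (C (coset Q x^-1)%g *m f *m C (coset Q x) = C (coset Q x)^-1%g *m f *m C (coset Q x)).
  by rewrite morphV // (subsetP nQN).
by exists (ginf nQN A), (ginf nQN B); split=> //; apply: proj.
Qed.

End InflationCharacter.

(** * The sum over radical subgroups *)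

Section Assembly.
Variables (p : nat) (R : idomainType) (F : fieldType).
Variables (red : {rmorphism R -> F}) (t : R) (pmt : pmodular p red t).
Variables (gT : finGroupType) (G : {group gT}) (T : {set {group gT}}).
Hypothesis hT : is_transversal T (orbit 'JG G @: radical_psubgroups p G)
            (radical_psubgroups p G).
Local Notation to := (@pair_action gT).
Local Notation S := (1%G |: T).
Local Notation N Q := ('N_G(Q)%G).
Local Notation St Q := (steinberg R p (N Q / Q)%G).
Local Notation InfSt Q := (Inf (subsetIr G 'N(Q)) (St Q)).
Local Notation Pr Q := (cover_lift (subsetIr G 'N(Q)) (St Q)).
Implicit Types Q : {group gT}.

Lemma radicalP Q : Q \in S -> [/\ Q \subset G, p.-group Q &
  (Q :==: 1%g) || (Q :==: 'O_p('N_G(Q)))].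
Proof.
case/setU1P=> [->|TQ]; first by rewrite sub1G pgroup1 eqxx.
have := subsetP (transversal_sub hT) Q TQ; rewrite in_set => /andP[].
by rewrite in_set => /and3P[-> -> _ ->]; rewrite orbT.
Qed.

(** Radical pairs fibre over their bottoms. As all members normalize the bottom [Q], the fibre
    consists of the elements of [U :&: Q] paired with the flags of [N_G(Q)] of bottom [Q]. *)
Lemma spcl_radical_sum (U : {set gT}) :
    (forall u x, x \in G -> (u ^ x \in U)%g = (u \in U)) ->
  spcl R to (@par_pair gT) G (radical_pairs p G U) =
  \sum_(Q in S) Ind (subsetIl G 'N(Q))
    (spcl R to (@par_pair gT) (N Q) (setX (U :&: Q) (flags_over p (N Q) Q))).
Proof.
move=> UJ; rewrite (@spcl_fibers R gT G _ _ to 'JG%act (@par_pair gT)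
  (radical_pairs p G U) (fun z => bot z.2) S (fun Q => N Q) (fun Q => subsetIl G 'N(Q))).
- apply: eq_bigr => Q SQ; congr (Ind _ (spcl _ _ _ _ _)); have [QG pQ rQ] := radicalP SQ.
  apply/setP => -[u s]; rewrite in_setX in_setI [LHS]in_set.
  apply/andP/andP => [[+ /eqP e]|[/andP[Uu Qu] /setIdP[Fs /eqP e]]].
    case/setIdP=> /setIdP[/flag_pairsP[/= Fs Uu bu] /forall_inP nB] _.
    rewrite Uu; split; first by rewrite -e.
    rewrite in_set e eqxx andbT; case/flagsP: Fs => ne mem tot.
    apply/flagsP; split=> // P sP; have [PG pP] := mem P sP; split=> //.
    by rewrite subsetI PG -e; apply: nB.
  case/flagsP: Fs => ne mem tot; rewrite e eqxx; split=> //.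
  have Fs : s \in flags p G.
    apply/flagsP; split=> // P sP; have [PN pP] := mem P sP; split=> //.
    exact: subset_trans PN (subsetIl _ _).
  rewrite in_set; apply/andP; split; last by change (brad p G s); rewrite /brad /bpcore e.
  rewrite in_set; apply/andP; split.
    by apply/flag_pairsP; split=> //; change (u \in bot s); rewrite e.
  apply/forall_inP => P; change (P \in s -> P \subset 'N(bot s)); rewrite e => sP.
  by have [PN _] := mem P sP; apply: subset_trans PN (subsetIr _ _).
- by apply: pair_inv => z x Gx; apply: radical_pairsJ.
- by move=> z x Zz Gx; apply: botJ.
- move=> [u s] /setIdP[/setIdP[/flag_pairsP[/= Fs _ _] _]].
  change (brad p G s -> exists2 w, w \in S & bot s \in orbit 'JG G w).
  set B := bot s; have [B1 _|B1] := eqVneq (B : {set gT}) 1%g.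
    exists 1%G; first exact: setU11.
    by rewrite (_ : B = 1%G) ?orbit_refl //; apply/val_inj.
  case/orP=> [/idPn[]//|rB]; have [_ _ /forall_inP tB] := and3P hT.
  have radB : B \in radical_psubgroups p G.
    rewrite in_set rB andbT in_set B1 andbT; apply/andP.
    by have [_ mem _] := flagsP Fs; apply: mem; apply: bot_mem Fs.
  have /cards1P[w wE] := tB _ (imset_f (orbit 'JG G) radB).
  have /setIP[Tw Bw] : w \in T :&: orbit 'JG G B by rewrite wE set11.
  by exists w; [rewrite setU1r | rewrite orbit_sym].
- have orb1 Q : Q \in orbit 'JG G 1%G -> Q = 1%G.
    by case/orbitP=> x _ <-; apply/val_inj; rewrite /= conjs1g.
  move=> w w' /setU1P[->|Tw] /setU1P[->|Tw'] //; first by move=> /orb1->.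
    by rewrite orbit_sym => /orb1.
  have [_ sT /forall_inP tB] := and3P hT => ww'.
  have /cards1P[v vE] := tB _ (imset_f (orbit 'JG G) (subsetP sT w Tw)).
  have : w' \in T :&: orbit 'JG G w by rewrite inE Tw'.
  have : w \in T :&: orbit 'JG G w by rewrite inE Tw orbit_refl.
  by rewrite vE => /set1P-> /set1P->.
move=> Q x SQ Gx; rewrite inE Gx /=; apply/normP/eqP => [e|/(congr1 val)//].
exact/val_inj.
Qed.

Lemma spcl_cyclic_pcl (U : {set gT}) :
  spcl R to (@par_pair gT) G (cyclic_pairs p G U) = pcl R to G (cyclic_pairs p G U).
Proof.
have ev z : z \in cyclic_pairs p G U -> par_pair z = false.
  by rewrite in_set => /and4P[_ _ _ /eqP e]; rewrite /par_pair e cards1.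
rewrite /spcl (_ : [set z in _ | par_pair z] = set0) ?pcl_set0 ?subr0; last first.
  by apply/setP => z; rewrite in_set0 in_set; apply/andP => -[/ev->].
by congr pcl; apply/setP => z; rewrite in_set; apply: andb_idr => /ev->.
Qed.

Lemma conj_fix_cent1 (u h : gT) : (u ^ h == u)%g = (u \in 'C[h]).
Proof.
apply/eqP/cent1P => [/conjg_fixP/commgP/commute_sym //|/commgP/conjg_fixP //].
Qed.

Lemma triv_sum : gclass (gtriv R G) = \sum_(Q in S) Ind (subsetIl G 'N(Q)) (InfSt Q).
Proof.
have UJ u x : x \in G -> (u ^ x \in [set 1%g])%g = (u \in [set 1%g]).
  by move=> Gx; rewrite !in_set1 conjg_eq1.
have := spcl_radical_sum UJ; rewrite spcl_radical_cyclic // => e.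
transitivity (spcl R to (@par_pair gT) G (cyclic_pairs p G [set 1%g])).
  rewrite spcl_cyclic_pcl.
  have -> : cyclic_pairs p G [set 1%g] = [set (1%g, [set <[1%g]>%G])].
    apply/setP => -[u s]; rewrite [LHS]in_set /= !in_set1 xpair_eqE.
    by case: (u =P 1%g) => [->|_]; rewrite ?andbF // group1 p_elt1.
  rewrite pcl_set1 // => x Gx; congr (_, _).
    exact: conj1g.
  apply: etrans (imset_set1 _ _) _; congr [set _]; apply/val_inj.
  by rewrite /= cycle1 conjs1g.
rewrite e; apply: eq_bigr => Q SQ; congr (Ind _ _); have [QG pQ _] := radicalP SQ.
rewrite Inf_steinberg //; last by rewrite subsetI QG normG.
by rewrite (setIidPl _) // sub1set group1.
Qed.

(** With u arbitrary, the term of [Q] and the induced cover have the same character on p-regular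
    elements, by [gchar_pairs] and [cover_lift_spec]. The cyclic pairs fixed by [y] are the
    p-elements of its centralizer. *)
Lemma cover_sum_char y : y \in G -> p^'.-elt y ->
  gchar (\sum_(Q in S) Ind (subsetIl G 'N(Q)) (Pr Q)) y = (Psi1 p G y)%:R :> R.
Proof.
move=> Gy p'y.
have UJ u x : x \in G -> (u ^ x \in [set: gT])%g = (u \in [set: gT]) by rewrite !inE.
have := spcl_radical_sum UJ; rewrite spcl_radical_cyclic // => e.
transitivity (gchar (spcl R to (@par_pair gT) G (cyclic_pairs p G [set: gT])) y).
  rewrite e !gchar_sum //; apply: eq_bigr => Q SQ; have [QG pQ _] := radicalP SQ.
  have sQN : Q \subset N Q by rewrite subsetI QG normG.
  apply: (@gchar_Ind_eq _ _ _ _ _ p) => // h Nh p'h.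
  have [_ ->] := cover_lift_spec pmt (subsetIr G 'N(Q)) sQN pQ (steinberg_vproj pmt (N Q / Q)%G) => //.
  have nQN := subsetIr G 'N(Q).
  rewrite -(gchar_Inf nQN) // Inf_steinberg // setTI !gchar_pairs //.
  - rewrite [X in _ * (X%:R * _)](_ : _ = 1%N) ?mul1r; last first.
      rewrite -(cards1 (1%g : gT)); apply: eq_card => u; rewrite in_set in_set1.
      by case: eqP => // ->; rewrite conj1g eqxx.
    congr (_%:R * _); apply: eq_card => u; rewrite [LHS]in_setI [RHS]in_set.
    by rewrite conj_fix_cent1.
  - by move=> x u _; rewrite !in_set1 conjg_eq1.
  by move=> x u /setIP[_ nx]; apply: memJ_norm.
rewrite spcl_cyclic_pcl gchar_pcl //; last first.
  by case: (pair_inv (cyclic_pairsJ (U := [set: gT]) p UJ)).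
rewrite /Psi1 p'y; congr (_%:R).
pose f (u : gT) : gT * {set {group gT}} := (u, [set <[u]>%G]).
rewrite -(card_imset (f := f)); last by move=> u v [].
apply: eq_card => -[u s]; rewrite in_set; apply/andP/imsetP => [[]|[v + [-> ->]]].
  rewrite in_set /= => /and4P[Gu pu _ /eqP->] /eqP[/eqP uy _].
  by exists u; rewrite // in_set pu in_setI Gu -conj_fix_cent1 uy.
rewrite in_set in_setI => /andP[/andP[Gv Cv] pv]; split.
  by rewrite in_set /= Gv pv in_setT eqxx.
rewrite -conj_fix_cent1 in Cv; apply/eqP; congr (_, _); first exact/eqP.
apply: etrans (imset_set1 _ _) _; congr [set _]; apply/val_inj.
by rewrite /= -cycleJ (eqP Cv).
Qed.

Lemma virtual_triv_sum :
  exists2 V, vproj V /\ (forall y, y \in G -> gchar V y = (Psi1 p G y)%:R :> R) &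
    V - gclass (gtriv R G) = \sum_(Q in T) Ind (subsetIl G 'N(Q)) (Pr Q - InfSt Q).
Proof.
have prV Q : Q \in S -> vproj (Pr Q).
  move=> SQ; have [QG pQ _] := radicalP SQ.
  have sQN : Q \subset N Q by rewrite subsetI QG normG.
  by have [] := cover_lift_spec pmt (subsetIr G 'N(Q)) sQN pQ (steinberg_vproj pmt (N Q / Q)%G).
have T1 : 1%G \notin T.
  apply/negP => /(subsetP (transversal_sub hT)).
  by rewrite in_set => /andP[]; rewrite in_set eqxx !andbF.
exists (\sum_(Q in S) Ind (subsetIl G 'N(Q)) (Pr Q)).
  have vV : vproj (\sum_(Q in S) Ind (subsetIl G 'N(Q)) (Pr Q)).
    by apply: vproj_sum => Q SQ; apply: vproj_Ind; apply: prV.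
  split=> // y Gy; have [p'y|py] := boolP (p^'.-elt y); first exact: cover_sum_char.
  by rewrite (vproj_singular pmt vV) // /Psi1 (negPf py).
have S1 : 1%G \in S by rewrite setU11.
rewrite triv_sum -sumrB big_setU1 //= -IndB.
(* Both sides are virtual projective, and the factor [|C_Q(h)|] is 1 for [Q = 1]; so their
   characters agree. *)
suff -> : Pr 1%G = InfSt 1%G.
  by rewrite subrr -(subrr 0) IndB subrr add0r; apply: eq_bigr => Q _; rewrite IndB.
apply: (vproj_eq pmt); [exact: prV | by apply: vproj_Inf1 => //; apply: (steinberg_vproj pmt) |].
move=> h Nh p'h; have sQN : (1%G : {group gT}) \subset N 1%G by rewrite sub1G.
have [_ ->] := cover_lift_spec pmt (subsetIr G 'N(1%G)) sQN (pgroup1 _ p) (steinberg_vproj pmt (N 1%G / 1%G)%G) => //.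
rewrite gchar_Inf // (_ : #|_| = 1%N) ?mul1r //.
by apply/eqP; rewrite -trivg_card1 -subG1 subsetIl.
Qed.

End Assembly.

Lemma splitting_pmodular (p : nat) (K : fieldType) (R : idomainType)
    (F : fieldType) (iota : {rmorphism R -> K}) (red : {rmorphism R -> F})
    (gT : finGroupType) (G : {group gT}) :
  splitting_modular_system p iota red G -> exists t, pmodular p red t.
Proof.
move=> [[t ut ct] [iota_inj _] res /pcharf0P c0 cp _ _]; exists t; split=> // n n0.
by apply/eqP; rewrite -c0 -(rmorph_nat iota) n0 rmorph0.
Qed.

(** Any element that [the_elt] may pick has the same character as [V], so [vproj_eq] identifies the
    two. *)
Lemma P1_eq (p : nat) (K : fieldType) (R : idomainType)
    (F : fieldType) (iota : {rmorphism R -> K}) (red : {rmorphism R -> F}) (t : R)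
    (gT : finGroupType) (G : {group gT}) (V : green R G) :
    injective iota -> pmodular p red t -> vproj V ->
    (forall y, y \in G -> gchar V y = (Psi1 p G y)%:R) ->
  P1 p iota G = V.
Proof.
move=> iota_inj pmt vV chV; rewrite /P1 /the_elt; case: pselect => [h|[]]; last first.
  have [A [B [PA PB eV]]] := vV; exists V, A, B; split=> // y Gy.
  by rewrite -rmorphB -gcharE // -eV chV // rmorph_nat.
case: cid => W /= {h} [A [B [PA PB eW chW]]].
apply: (vproj_eq pmt) => //; first by exists A, B.
move=> y Gy _; apply: iota_inj.
by rewrite eW gcharE // rmorphB chW // chV // rmorph_nat.
Qed.

Theorem corollary11p4 (gT : finGroupType) (G : {group gT}) (p : nat)
    (K : fieldType) (R : idomainType) (F : fieldType)
    (iota : {rmorphism R -> K}) (red : {rmorphism R -> F})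
    (hp : prime p)
    (hS : splitting_modular_system p iota red G)
    (T : {set {group gT}})
    (hT : is_transversal T (orbit 'JG G @: radical_psubgroups p G)
            (radical_psubgroups p G)) :
  P1 p iota G - gclass (gtriv R G) =
  \sum_(Q in T)
    Ind (subsetIl G 'N(Q))
      (cover_lift (subsetIr G 'N(Q)) (steinberg R p ('N_G(Q) / Q)%G)
       - Inf (subsetIr G 'N(Q)) (steinberg R p ('N_G(Q) / Q)%G)).
Proof.
have [t pmt] := splitting_pmodular hS; have [iota_inj _] := sms_frac hS.
have [V [vV chV] <-] := virtual_triv_sum pmt hT.
by rewrite (P1_eq iota_inj pmt vV chV).
Qed.
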